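(* Let $T\in(0,\infty)$. (a) Let $X=(X_t)_{t\in[0,T]}$ be an $\mathbb{R}^d$-valued Gaussian process with continuous trajectories which is $\beta$-SLND or $\beta$-LND for some $\beta\in(0,\infty)$. Then for any $\rho<(2\beta)^{-1}$ there exists $\gamma=\gamma(\rho,\beta)>1/2$ such that $X$ is $(\gamma,\rho)$-irregular with probability $1$. (b) Let $X=(X_t)_{t\in[0,T]}$ be an $\mathbb{R}^d$-valued $\beta$-eSLND Gaussian process with measurable, $L^2$-integrable trajectories and $\beta\in(0,1]$. Then $X$ is exponentially irregular with probability $1$.
   Context: For a measurable path $w:[0,T]\to\mathbb{R}^d$ set $\Phi^w_{s,t}(\xi)=\int_s^t e^{i\xi\cdot w_r}\,dr$. For $\gamma\in[0,1]$, $\rho>0$, $w$ is $(\gamma,\rho)$-irregular if there is $C$ with $|\Phi^w_{s,t}(\xi)|\le C|\xi|^{-\rho}|t-s|^\gamma$ for all $\xi\in\mathbb{R}^d\setminus\{0\}$, $s,t\in[0,T]$. $w$ is exponentially irregular if there are $c_1,c_2>0$ and $\gamma\in(0,1)$ with $|\Phi^w_{s,t}(\xi)|\le c_1e^{-c_2|\xi|}|t-s|^\gamma$ for all $\xi\ne0$, $s,t\in[0,T]$. Let $X$ be an $\mathbb{R}^d$-valued separable Gaussian process adapted to a given filtration $(\mathcal{F}_t)$; $\mathrm{Var}(X_t|\mathcal{F}_s)$ is the conditional covariance matrix, and matrix inequalities are between symmetric matrices (a.s.). $X$ is $\beta$-SLND ($\beta>0$) if there are $\delta,c>0$ with $\mathrm{Var}(X_t|\mathcal{F}_s)\ge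 c|t-s|^{2\beta}I_d$ for all $s,t$ with $0<t-s<\delta$. $X$ is $\beta$-LND if for every integer $n\ge2$ there are positive constants $c_n,\delta_n$ such that $$\mathrm{Var}\Big(\sum_{k=1}^{n-1}v_k\cdot(X_{t_{k+1}}-X_{t_k})\Big)\ge c_n\sum_{k=1}^{n-1}\mathrm{Var}\big(v_k\cdot(X_{t_{k+1}}-X_{t_k})\big)\ge c_n\sum_{k=1}^{n-1}|v_k|^2|t_{k+1}-t_k|^{2\beta}$$ for all ordered points $t_1<\dots<t_n$ in $[0,T]$ with $t_n-t_1<\delta_n$ and all $v_k\in\mathbb{R}^d$. $X$ is $\beta$-eSLND if there are $\delta,c>0$ with $\mathrm{Var}(X_t|\mathcal{F}_s)\ge c|\log(t-s)|^{-\beta}I_d$ for all $s,t$ with $0<t-s<\delta$.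
   Formalization: In (b), ''measurable trajectories'' is taken to mean that X is jointly measurable in (t, ω); with only each path measurable the claim fails (i.i.d. Gaussians realized with paths vanishing off countable sets). *)

(* Defs.v *)
From HB Require Import structures.
From mathcomp Require Import all_boot all_order all_algebra.
From mathcomp Require Import all_classical all_reals all_analysis.
From mathcomp Require Import complex.

Set Implicit Arguments.
Unset Strict Implicit.
Unset Printing Implicit Defensive.

Import Order.TTheory GRing.Theory Num.Theory.
Import numFieldNormedType.Exports.

Local Open Scope classical_set_scope.
Local Open Scope ring_scope.
Local Open Scope complex_scope.

(* Paths and processes indexed by [0, T] are represented by total functions of
   a real argument; every condition below only involves times in [0, T]. *)

Section Paths.
Context {R : realType} {d : nat}.
Implicit Types (u v xi : 'rV[R]_d) (w : R -> 'rV[R]_d).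

Definition dot u v : R := \sum_(i < d) u 0 i * v 0 i.

(* The norm `|v| that the library puts on 'rV[R]_d is the sup norm, hence: *)
Definition enorm v : R := Num.sqrt (dot v v).

Definition expi (x : R) : R[i] := cos x +i* sin x.

Definition cintegral (D : set R) (f : R -> R[i]) : R[i] :=
  Rintegral lebesgue_measure D (fun r => complex.Re (f r)) +i*
  Rintegral lebesgue_measure D (fun r => complex.Im (f r)).

(* oriented integral: Phi w s t = - Phi w t s *)
Definition Phi w (s t : R) xi : R[i] :=
  let f r := expi (dot xi (w r)) in
  if s <= t then cintegral `[s, t] f else - cintegral `[t, s] f.

(* The two notions below are meant for w measurable on [0, T]. *)
Definition irregular (T gamma rho : R) w : Prop :=
  exists C : R, forall (xi : 'rV[R]_d) (s t : R),
    xi != 0 -> 0 <= s <= T -> 0 <= t <= T ->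
    ComplexField.Normc.normc (Phi w s t xi) <=
      C * enorm xi `^ (- rho) * `|t - s| `^ gamma.

Definition exp_irregular (T : R) w : Prop :=
  exists c1 c2 gamma : R, [/\ 0 < c1, 0 < c2, 0 < gamma < 1 &
    forall (xi : 'rV[R]_d) (s t : R),
      xi != 0 -> 0 <= s <= T -> 0 <= t <= T ->
      ComplexField.Normc.normc (Phi w s t xi) <=
        c1 * expR (- c2 * enorm xi) * `|t - s| `^ gamma].

Definition loewner_le (A B : 'M[R]_d) : Prop :=
  [/\ A^T = A, B^T = B & forall v, 0 <= (v *m (B - A) *m v^T) 0 0].

End Paths.

Section Processes.
Context {R : realType} {dO : measure_display} {Omega : measurableType dO}.
Variable P : probability Omega R.

Definition sub_sigma_field (G : set (set Omega)) : Prop :=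
  sigma_algebra setT G /\ G `<=` measurable.

Definition measurable_wrt (G : set (set Omega)) (Y : Omega -> R) : Prop :=
  forall B : set R, measurable B -> G (Y @^-1` B).

(* Z is a version of E[Y | G]; versions exist and are a.s. unique for
   integrable Y. *)
Definition is_cond_exp (G : set (set Omega)) (Y Z : Omega -> R) : Prop :=
  [/\ P.-integrable setT (EFin \o Y), P.-integrable setT (EFin \o Z),
      measurable_wrt G Z &
      forall A, G A ->
        (\int[P]_(w in A) (Z w)%:E = \int[P]_(w in A) (Y w)%:E)%E].

(* V is a version of
   Var(Y | G) = E[(Y - E[Y | G])^T (Y - E[Y | G]) | G], Y a row vector. *)
Definition is_cond_var (d : nat) (G : set (set Omega))
    (Y : Omega -> 'rV[R]_d) (V : Omega -> 'M[R]_d) : Prop :=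
  exists2 m : Omega -> 'rV[R]_d,
    forall i, is_cond_exp G (fun w => Y w 0 i) (fun w => m w 0 i) &
    forall i j, is_cond_exp G
      (fun w => (Y w 0 i - m w 0 i) * (Y w 0 j - m w 0 j)) (fun w => V w i j).

Definition cond_var_ge (d : nat) (G : set (set Omega))
    (Y : Omega -> 'rV[R]_d) (A : 'M[R]_d) : Prop :=
  exists2 V : Omega -> 'M[R]_d,
    is_cond_var G Y V & \forall w \ae P, loewner_le A (V w).

Definition filtration (T : R) (F : R -> set (set Omega)) : Prop :=
  (forall s : R, 0 <= s <= T -> sub_sigma_field (F s)) /\
  (forall s t : R, 0 <= s -> s <= t -> t <= T -> F s `<=` F t).

(* Constants are allowed (Dirac law); normal_prob m sigma has standard
   deviation |sigma|, and is not a Dirac mass for sigma = 0. *)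
Definition gaussian_rv (Y : Omega -> R) : Prop :=
  measurable_fun setT Y /\
  ((exists m : R, forall A : set R, measurable A ->
      P (Y @^-1` A) = dirac m A) \/
   (exists m sigma : R, sigma != 0 /\
      forall A : set R, measurable A -> P (Y @^-1` A) = normal_prob m sigma A)).

Section Dimension.
Context {d : nat}.
Variables (T : R) (F : R -> set (set Omega)) (X : R -> Omega -> 'rV[R]_d).

Definition adapted : Prop :=
  forall t i, 0 <= t <= T -> measurable_wrt (F t) (fun w => X t w 0 i).

(* the finite-dimensional laws are (possibly degenerate, not necessarily
   centred) Gaussian *)
Definition gaussian_process : Prop :=
  forall (n : nat) (t : 'I_n -> R) (v : 'I_n -> 'rV[R]_d),
    (forall k, 0 <= t k <= T) ->
    gaussian_rv (fun w => \sum_(k < n) dot (v k) (X (t k) w)).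

(* Separability in the sense of Doob. Taking K empty shows that D is dense
   in [0, T]. *)
Definition separable_process : Prop :=
  exists D : set R, [/\ countable D, D `<=` `[0, T] &
    \forall w \ae P, forall (a b : R) (K : set 'rV[R]_d), closed K ->
      (forall t, D t -> a < t < b -> K (X t w)) ->
      (forall t, 0 <= t <= T -> a < t < b -> K (X t w))].

Definition adapted_gaussian_process : Prop :=
  [/\ filtration T F, adapted, gaussian_process & separable_process].

Definition SLND (beta : R) : Prop :=
  exists delta c : R, [/\ 0 < delta, 0 < c &
    forall s t : R, 0 <= s <= T -> 0 <= t <= T -> 0 < t - s < delta ->
      cond_var_ge (F s) (X t) (c * `|t - s| `^ (2 * beta))%:M].

(* The convention 0 `^ (- beta) = 0 is only met when t - s = 1, a case which is
   excluded by taking delta smaller. *)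
Definition eSLND (beta : R) : Prop :=
  exists delta c : R, [/\ 0 < delta, 0 < c &
    forall s t : R, 0 <= s <= T -> 0 <= t <= T -> 0 < t - s < delta ->
      cond_var_ge (F s) (X t) (c * `|ln (t - s)| `^ (- beta))%:M].

Definition LND (beta : R) : Prop :=
  forall n : nat, (2 <= n)%N ->
  exists c delta : R, [/\ 0 < c, 0 < delta &
    forall (t : nat -> R) (v : nat -> 'rV[R]_d),
      (forall k, (1 <= k <= n)%N -> 0 <= t k <= T) ->
      (forall k, (1 <= k < n)%N -> t k < t k.+1) ->
      t n - t 1%N < delta ->
      let inc k (w : Omega) := dot (v k) (X (t k.+1) w - X (t k) w) in
      let S1 := ('V_P[fun w => (\sum_(1 <= k < n) inc k w)%R])%E in
      let S2 := (c%:E * \sum_(1 <= k < n) 'V_P[inc k])%E in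
      let S3 := c * \sum_(1 <= k < n)
                  enorm (v k) ^+ 2 * `|t k.+1 - t k| `^ (2 * beta) in
      (S1 >= S2)%E /\ (S2 >= S3%:E)%E].

Definition continuous_trajectories : Prop :=
  \forall w \ae P, {within `[0, T], continuous (fun t => X t w)}.

(* joint measurability in (t, w) *)
Definition measurable_process : Prop :=
  forall i, measurable_fun (`[0, T] `*` [set: Omega])
    (fun p : R * Omega => X p.1 p.2 0 i).

Definition L2_trajectories : Prop :=
  \forall w \ae P,
    (\int[lebesgue_measure]_(t in `[0%R, T])
      (enorm (X t w) ^+ 2)%R%:E < +oo)%E.

End Dimension.
End Processes.

(* Main.v *)
Require Import Defs.
From HB Require Import structures.
From mathcomp Require Import all_boot all_order all_algebra.
From mathcomp Require Import all_classical all_reals all_analysis.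
From mathcomp Require Import complex measurable_realfun.
From mathcomp Require Import ring lra zify.

Set Implicit Arguments.
Unset Strict Implicit.
Unset Printing Implicit Defensive.

Import Order.TTheory GRing.Theory Num.Theory.
Import numFieldNormedType.Exports.

Local Open Scope classical_set_scope.
Local Open Scope ring_scope.

(** Local nondeterminism says that, given the past up to time [r - h], the
variance of [xi . X_r] is at least [v = c h^(2 beta) |xi|^2]. As [X] is Gaussian,
[E cos (xi . X_r - sum_i a_i xi . X_(t_i))] is then at most [exp (- v / 2)] in
absolute value as soon as all [t_i <= r - h].

For (a), cut [[s, t]] into [2N] cells of length about [h] and treat even and odd
cells separately, so that two cells of the same parity are at distance at
least [h]. The partial sums of [e^(i xi . X)] over such cells behave like
a martingale: expanding [|A + c|^(2n)] along the cells, all the cross terms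
are trigonometric moments as above, hence negligible, and the [2n]-th moment of
the integral is [O((h (t - s))^n)]. For (b), the logarithmic scale allows [h] to
be exponentially small in [|xi|], and the second moment is enough.

Markov's inequality on a grid of frequencies in the shell [m <= |xi| < m + 1] and
of times, with the Borel-Cantelli lemma over [m], gives almost surely
[|Phi_{s,t}(xi)| <= C (sqrt (tau_m (t - s)) + tau_m)] where [tau_m] is a
power of [h]; the trivial bound [t - s] for [t - s <= tau_m] turns this into
[C tau_m^(1 - gamma) (t - s)^gamma]. *)

(** * Characteristic functions of Gaussian variables *)

(** No conditional Gaussian law is ever formed. Gaussianity enters through the explicit
    characteristic function of each linear combination Y; the conditional variance enters through
    orthogonality in L^2, as a lower bound on E (Y - c)^2 for every c. Since [LND] knows no
    filtration and speaks only of increments, all combinations have coefficients of total zero,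
    which expanding a moment preserves: each factor contributes a difference of two times.

    In (a), with x = m + 1, put tau = x^(-theta) and h = x^(-theta'). Decay of the cross terms asks
    for theta' beta < 1; theta < theta' lets a large n pay for the grid; tau^(1 - gamma) = x^(-rho)
    forces theta = rho / (1 - gamma). Hence the condition rho beta < 1 - gamma, compatible with
    gamma > 1/2 exactly when rho < 1 / (2 beta).

    The integrals in (a) are reached through Riemann sums along continuous paths, joint
    measurability not being assumed; in (b) Fubini's theorem takes their place. *)

Section GaussianCharacteristicFunction.
Context {R : realType}.
Notation mu := (@lebesgue_measure R).

(** Integration by parts on the line: the boundary terms vanish, and dominated convergence passes
    from [-n, n] to the line. *)
Lemma Rintegral_derive_eq0 (G g : R -> R) :
  continuous g -> (forall x : R, is_derive (x : R) 1 G (g x)) ->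
  mu.-integrable setT (EFin \o g) ->
  G n%:R @[n --> \oo] --> 0 -> G (- n%:R) @[n --> \oo] --> 0 ->
  \int[mu]_x g x = 0.
Proof.
move=> cg dG ig Gp Gn.
pose A n : set R := `[- n%:R, n%:R]%classic.
(* The shift to [n.+1] keeps the interval nondegenerate. *)
have FTC n : \int[mu]_(x in A n.+1) g x = G n.+1%:R - G (- n.+1%:R).
  rewrite /Rintegral (@continuous_FTC2 _ g G) //.
  - by rewrite (@lt_trans _ _ 0)// oppr_lt0.
  - exact: continuous_subspaceT.
  - split=> [x _|| ]; first by apply: ex_derive.
      apply/cvg_at_right_filter/differentiable_continuous/derivable1_diffP.
      exact: ex_derive.
    apply/cvg_at_left_filter/differentiable_continuous/derivable1_diffP.
    exact: ex_derive.
  - by move=> x _; rewrite derive1E derive_val.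
have lim1 : \int[mu]_(x in A n.+1) g x @[n --> \oo] --> (0 : R).
  rewrite -[X in _ --> X]subr0; under eq_fun do rewrite FTC.
  apply: cvgB.
    by rewrite (cvg_shiftS (fun n => G n%:R)).
  by rewrite (cvg_shiftS (fun n => G (- n%:R))).
have lim2 : \int[mu]_(x in A n.+1) g x @[n --> \oo] --> \int[mu]_x g x.
  under eq_fun do rewrite Rintegral_mkcond.
  apply: fine_cvg; rewrite fineK; last exact: integrable_fin_num.
  have mg : measurable_fun [set: R] g by exact: continuous_measurable_fun.
  apply: (@dominated_cvg _ _ _ mu _ _ _ _ (fun x : R => (`|g x|)%:E)%E) => //.

  - move=> n; apply/measurable_EFinP/(measurable_restrictT _ _).1; last exact: measurable_funTS.
    exact: measurable_itv.
  - move=> x _; apply: cvg_near_cst; near=> n.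
    rewrite /= patchE ifT// inE /A /= in_itv/=.
    rewrite -ler_norml; near: n.
    exists (Num.truncn `|x|) => // n /= xn.
    by rewrite (le_trans (ltW (truncnS_gt _)))// ler_nat ltnS.
  - exact: (integrable_norm ig).
  - move=> n x _ /=; rewrite patchE lee_fin; case: ifP => // _.
    by rewrite normr0.
exact: (cvg_unique (@Rhausdorff R) lim2 lim1).
Unshelve. all: end_near. Qed.
Lemma normal_pdf_expE (m s x : R) : s != 0 ->
  normal_pdf m s x = normal_peak s * expR (- (x - m) ^+ 2 / (s ^+ 2 *+ 2)).
Proof. by move=> s0; rewrite normal_pdfE. Qed.

Lemma is_derive_normal_pdf (m s x : R) : s != 0 ->
  is_derive x 1 (normal_pdf m s) (- (x - m) / s ^+ 2 * normal_pdf m s x).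
Proof.
move=> s0.
have -> : normal_pdf m s = (fun x => normal_peak s * expR (- (x - m) ^+ 2 / (s ^+ 2 *+ 2))).
  by apply/funext => y; rewrite normal_pdf_expE.
apply: is_derive_eq.
rewrite /GRing.scale/=.
by field.
Qed.
(** The majorant is a multiple of the normal density with standard deviation [2 * s]. With t = (x -
    m)^2 / (8 s^2), the quotient of the two densities is a constant times exp (-3 t), which absorbs
    the quadratic factor because 1 + 3 t <= exp (3 t). *)
Lemma integrable_quadratic_normal_pdf (m s C : R) (f : R -> R) : s != 0 ->
  measurable_fun setT f -> (forall x, `|f x| <= C * (1 + (x - m) ^+ 2)) ->
  mu.-integrable setT (EFin \o (fun x => f x * normal_pdf m s x)).
Proof.
move=> s0 mf fC.
have C0 : 0 <= C.
  have := le_trans (normr_ge0 _) (fC m); rewrite subrr expr0n addr0 mulr1.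
  exact.
have s20 : 0 < s ^+ 2 by rewrite exprn_even_gt0.
have s'0 : 2 * s != 0 by rewrite mulf_neq0.
pose D := C * (1 + 8 * s ^+ 2) * normal_peak s / normal_peak (2 * s).
apply: (@le_integrable _ _ _ mu _ measurableT _
  (EFin \o (fun x => D * normal_pdf m (2 * s) x))).
- apply/measurable_EFinP/measurable_funM => //; exact: measurable_normal_pdf.
- move=> x _ /=; rewrite lee_fin normrM (ger0_norm (normal_pdf_ge0 _ _ _)).
  rewrite [leRHS]ger0_norm; last first.
    by rewrite mulr_ge0 ?normal_pdf_ge0// !mulr_ge0 ?invr_ge0 ?normal_peak_ge0//
       addr_ge0// mulr_ge0// ltW.
  apply: (@le_trans _ _ (C * (1 + (x - m) ^+ 2) * normal_pdf m s x)).
    by rewrite ler_wpM2r ?normal_pdf_ge0.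
  rewrite !normal_pdf_expE//.
  set t := (x - m) ^+ 2 / (8 * s ^+ 2).
  have t0 : 0 <= t by rewrite divr_ge0 ?sqr_ge0// mulr_ge0// ltW.
  have -> : (x - m) ^+ 2 = 8 * s ^+ 2 * t by rewrite /t mulrC divfK// mulf_neq0// gt_eqF.
  have e1 : - (8 * s ^+ 2 * t) / (s ^+ 2 *+ 2) = - t + - (3 * t) by field.
  have e2 : - (8 * s ^+ 2 * t) / ((2 * s) ^+ 2 *+ 2) = - t by field.
  rewrite e1 e2 expRD.
  rewrite /D.
  have q0 : normal_peak (2 * s) != 0 by rewrite gt_eqF// normal_peak_gt0.
  have h : 1 + 8 * s ^+ 2 * t <= (1 + 8 * s ^+ 2) * expR (3 * t).
    have := expR_ge1Dx (3 * t); move: t0 s20; clear.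
    by move: (expR _) (_ ^+ 2) => e w *; nra.
  have -> : C * (1 + 8 * s ^+ 2) * normal_peak s / normal_peak (2 * s) *
    (normal_peak (2 * s) * expR (- t)) =
    C * normal_peak s * expR (- t) * (1 + 8 * s ^+ 2) by field.
  have -> : C * (1 + 8 * s ^+ 2 * t) *
    (normal_peak s * (expR (- t) * expR (- (3 * t)))) =
    C * normal_peak s * expR (- t) * ((1 + 8 * s ^+ 2 * t) * expR (- (3 * t))).
    by ring.
  rewrite ler_wpM2l ?mulr_ge0 ?normal_peak_ge0 ?expR_ge0//.
  by rewrite expRN ler_pdivrMr ?expR_gt0.
- rewrite /comp; under eq_fun do rewrite EFinM.
  exact: integrableZl (integrable_normal_pdf _ _).
Qed.

Lemma integrable_EFinZ d (S : measurableType d) (K : realType)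
    (nu : {measure set S -> \bar K}) (D : set S) (k : K) (f : S -> K) :
  measurable D -> nu.-integrable D (EFin \o f) ->
  nu.-integrable D (EFin \o (fun x => k * f x)).
Proof. by move=> mD fi; exact: (integrableZl mD k fi). Qed.

Lemma integrable_EFinD d (S : measurableType d) (K : realType)
    (nu : {measure set S -> \bar K}) (D : set S) (f g : S -> K) :
  measurable D -> nu.-integrable D (EFin \o f) ->
  nu.-integrable D (EFin \o g) ->
  nu.-integrable D (EFin \o (fun x => f x + g x)).
Proof. by move=> mD fi gi; exact: (integrableD mD fi gi). Qed.

(** These are the boundary terms of the integration by parts, [e] being 1 or -1. The inequality exp
    (-t) <= 1 / (1 + t) already gives decay of order 1 / (n + 1). *)
Lemma normal_pdf_cvg0 (m s : R) (u : R -> R) (e : R) : s != 0 -> `|e| = 1 ->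
  (forall x, `|u x| <= 1) ->
  u (e * n%:R) * normal_pdf m s (e * n%:R) @[n --> \oo] --> 0.
Proof.
move=> s0 e1 u1.
pose K := normal_peak s * (`|m| + 2 + 2 * s ^+ 2).
have s20 : 0 < s ^+ 2 by rewrite exprn_even_gt0.
have H n : `|u (e * n%:R) * normal_pdf m s (e * n%:R)| <= K * harmonic n.
  rewrite normrM (@le_trans _ _ (normal_pdf m s (e * n%:R)))//.
    by rewrite [`|normal_pdf _ _ _|]ger0_norm ?normal_pdf_ge0// ler_piMl ?normal_pdf_ge0.
  rewrite normal_pdf_expE// /K -mulrA ler_wpM2l ?normal_peak_ge0//.
  set x := e * n%:R; set t := (x - m) ^+ 2 / (s ^+ 2 *+ 2).
  have t0 : 0 <= t by rewrite divr_ge0 ?sqr_ge0// mulrn_wge0// ltW.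
  rewrite mulNr -/t expRN /harmonic/= ler_pdivlMr// mulrC ler_pdivrMr ?expR_gt0//.
  apply: (@le_trans _ _ ((`|m| + 2 + 2 * s ^+ 2) * (1 + t))); last first.
    by rewrite ler_wpM2l ?expR_ge1Dx// addr_ge0// ?addr_ge0// mulr_ge0// ltW.
  have nx : n%:R = `|x| by rewrite /x normrM e1 mul1r ger0_norm.
  have xm : (x - m) ^+ 2 = 2 * s ^+ 2 * t by rewrite /t; field.
  have : `|x| <= `|m| + `|x - m| by rewrite addrC -{1}[x](subrK m) ler_normD.
  rewrite -natr1 nx.
  have : `|x - m| ^+ 2 = 2 * s ^+ 2 * t by rewrite real_normK ?num_real.
  have m0 := normr_ge0 m.
  move: t0 s20 m0; clear; move: t (s ^+ 2) `|x| `|m| `|x - m| => t w a b c t0 w0 b0 cE abc.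
  have : c <= 1 + c ^+ 2 by nra.
  have := mulr_ge0 b0 t0; nra.
apply: norm_cvg0; apply: (@squeeze_cvgr _ _ _ _ (cst 0) (fun n => K * harmonic n)).
- by near=> n; rewrite normr_ge0 H.
- exact: cvg_cst.
- rewrite -[X in _ --> X](mulr0 K); apply: cvgM; first exact: cvg_cst.
  exact: cvg_harmonic.
Unshelve. all: end_near. Qed.

(** The integral [F a] solves F' = - s^2 a F, so F(a) exp (s^2 a^2 / 2) is constant. The free phase
    [th] covers sine and cosine at once and keeps the integrals real. *)
Lemma Rintegral_cos_normal_pdf (m s b th : R) : s != 0 ->
  \int[mu]_x (cos (b * x + th) * normal_pdf m s x) =
  cos (b * m + th) * expR (- (s ^+ 2 / 2 * b ^+ 2)).
Proof.
move=> s0.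
(* The argument is centred at [m] and the phase b m + th stays fixed as [a] varies: [a = b] gives
   the wanted integrand, [a = 0] a constant times the density. *)
pose f (a x : R) : R := cos (a * (x - m) + (b * m + th)) * normal_pdf m s x.
pose F (a : R) : R := \int[mu]_x f a x.
have mcs (h : R -> R) a : measurable_fun setT h ->
    measurable_fun setT (fun x : R => h (a * (x - m) + (b * m + th))).
  move=> mh; apply: (measurableT_comp mh).
  apply: measurable_funD => //; apply: measurable_funM => //.
  exact: measurable_funB.
have mcos := continuous_measurable_fun (@continuous_cos R).
have msin := continuous_measurable_fun (@continuous_sin R).
have if_ a : mu.-integrable setT (EFin \o f a).
  apply: (@integrable_quadratic_normal_pdf m s 1) => //; first exact: mcs.
  move=> x; rewrite mul1r (le_trans (_ : _ <= 1))//; last by rewrite lerDl sqr_ge0.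
  by rewrite ler_norml cos_geN1 cos_le1.
pose g (a x : R) : R := - ((x - m) * sin (a * (x - m) + (b * m + th))) * normal_pdf m s x.
have ig a : mu.-integrable setT (EFin \o g a).
  apply: (@integrable_quadratic_normal_pdf m s 1) => //.
    apply: measurableT_comp => //; apply: measurable_funM; last exact: mcs.
    exact: measurable_funB.
  move=> x; rewrite mul1r normrN normrM.
  have : `|sin (a * (x - m) + (b * m + th))| <= 1 by rewrite ler_norml sin_geN1 sin_le1.
  rewrite -[_ ^+ 2]real_normK ?num_real//; have := normr_ge0 (x - m).
  have := normr_ge0 (sin (a * (x - m) + (b * m + th))).
  by move: `|_| `|_| => u v *; nra.
have iG : mu.-integrable setT (EFin \o (fun x => `|x - m| * normal_pdf m s x)).
  apply: (@integrable_quadratic_normal_pdf m s 1) => //.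
    apply: measurableT_comp => //; exact: measurable_funB.
  move=> x; rewrite mul1r normr_id.
  by rewrite -[_ ^+ 2]real_normK ?num_real//; move: `|_| => u; nra.
have df (a x : R) : is_derive a 1 (f ^~ x) (g a x).
  by rewrite /f /g; apply: is_derive_eq; rewrite /GRing.scale/=; ring.
have dF (a : R) : is_derive a 1 F (\int[mu]_x g a x).
  have aI : [set` `]a - 1, a + 1[%R] a by rewrite /= in_itv/=; lra.
  have G0 (y : R) : 0 <= `|y - m| * normal_pdf m s y.
    by rewrite mulr_ge0 ?normal_pdf_ge0.
  have d1 (x y : R) : [set` `]a - 1, a + 1[%R] x -> setT y ->
     derivable (f ^~ y) x 1 by move=> _ _; exact: ex_derive.
  have d2 (x y : R) : [set` `]a - 1, a + 1[%R] x -> setT y ->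
     `|partial1of2 f x y| <= `|y - m| * normal_pdf m s y.
    move=> _ _; rewrite partial1of2E derive_val /g normrM normrN.
    rewrite [`|normal_pdf _ _ _|]ger0_norm ?normal_pdf_ge0// ler_wpM2r ?normal_pdf_ge0//.
    rewrite normrM ler_piMr// ler_norml sin_geN1 sin_le1//.
  apply: DeriveDef.
    exact: (derivable_under_integral measurableT aI (fun x _ => if_ x) d1 G0 iG d2).
  rewrite -derive1E (differentiation_under_integral measurableT aI (fun x _ => if_ x) d1 G0 iG d2).
  by apply: eq_Rintegral => x _; rewrite partial1of2E derive_val.
(* The derivative [g'] of [G] integrates to zero, which expresses the integral of [g a] through
   [F a]. *)
have intg a : \int[mu]_x g a x = - (s ^+ 2 * a * F a).
  pose G (x : R) := sin (a * (x - m) + (b * m + th)) * normal_pdf m s x.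
  pose g' (x : R) := a * f a x + (s ^+ 2)^-1 * g a x.
  have dG (x : R) : is_derive x 1 G (g' x).
    have := is_derive_normal_pdf m x s0 => ?.
    by rewrite /G /g' /f /g; apply: is_derive_eq; rewrite /GRing.scale/=; field.
  have cg' : continuous g'.
    move=> x; apply: cvgD; (apply: cvgM; first exact: cvg_cst);
     apply: cvgM; try exact: continuous_normal_pdf.
      apply: continuous_comp; last exact: continuous_cos.
      apply: cvgD; last exact: cvg_cst.
      apply: cvgM; first exact: cvg_cst.
      by apply: cvgB; [exact: cvg_id|exact: cvg_cst].
    apply: cvgN; apply: cvgM.
      by apply: cvgB; [exact: cvg_id|exact: cvg_cst].
    apply: continuous_comp; last exact: continuous_sin.
    apply: cvgD; last exact: cvg_cst.
    apply: cvgM; first exact: cvg_cst.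
    by apply: cvgB; [exact: cvg_id|exact: cvg_cst].
  have i1 : mu.-integrable setT (EFin \o (fun x => a * f a x)).
    exact: integrable_EFinZ.
  have i2 : mu.-integrable setT (EFin \o (fun x => (s ^+ 2)^-1 * g a x)).
    exact: integrable_EFinZ.
  have ig' : mu.-integrable setT (EFin \o g').
    exact: integrable_EFinD.
  have s1 x : `|sin (a * (x - m) + (b * m + th))| <= 1 by rewrite ler_norml sin_geN1 sin_le1.
  have : \int[mu]_x g' x = 0.
    apply: Rintegral_derive_eq0 dG ig' _ _ => //.
      have := @normal_pdf_cvg0 m s _ 1 s0 (normr1 _) s1.
      by under eq_fun do rewrite mul1r.
    have := @normal_pdf_cvg0 m s _ (-1) s0 (normrN1 _) s1.
    by under eq_fun do rewrite mulN1r.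
  rewrite RintegralD// !RintegralZl// -/(F a) => /eqP.
  by rewrite addr_eq0 => /eqP h; rewrite -mulrA h mulrN opprK mulrA divff ?mul1r// mulf_neq0.
have dH (a : R) : is_derive a 1 (fun a => F a * expR (s ^+ 2 / 2 * a ^+ 2)) 0.
  have := dF a; rewrite intg => ?.
  by apply: is_derive_eq; rewrite /GRing.scale/=; field.
have := is_derive_0_is_cst b 0 dH.
rewrite expr0n mulr0 expR0 mulr1.
have -> : F 0 = cos (b * m + th).
  transitivity (\int[mu]_x (cos (b * m + th) * normal_pdf m s x)).
    by apply: eq_Rintegral => x _; rewrite /f mul0r add0r.
  rewrite RintegralZl//; last exact: integrable_normal_pdf.
  by rewrite /Rintegral integral_normal_pdf mulr1.
move=> <-; rewrite expRN mulfK ?gt_eqF ?expR_gt0//.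
by apply: eq_Rintegral => x _; rewrite /f mulrBr addrA subrK.
Qed.

Lemma integrable_bounded d (S : measurableType d) (K : realType)
    (nu : {measure set S -> \bar K}) (D : set S) (M : K) (f : S -> K) :
  measurable D -> (nu D < +oo)%E -> measurable_fun D f ->
  (forall x, D x -> `|f x| <= M) -> nu.-integrable D (EFin \o f).
Proof.
move=> mD nuD mf fM; apply: measurable_bounded_integrable => //.
exists M; split; first exact: num_real.
by move=> x Mx y Dy /=; rewrite (le_trans (fM y Dy))// ltW.
Qed.

Lemma integral_normal_prob (m s M : R) (f : R -> R) :
  measurable_fun setT f -> (forall x, `|f x| <= M) ->
  \int[normal_prob m s]_x f x = \int[mu]_x (f x * normal_pdf m s x).
Proof.
move=> mf fM; congr fine; under [RHS]eq_integral do rewrite EFinM.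
have fi : (normal_prob m s).-integrable setT (EFin \o f).
  apply: (@integrable_bounded _ _ _ _ _ M) => //.
  by rewrite (le_lt_trans (probability_le1 _ _)) ?ltry.
rewrite -(Radon_Nikodym_change_of_variables (normal_prob_dominates m s))//=.
apply: ae_eq_integral => //.
- apply: emeasurable_funM => //; first exact/measurable_EFinP.
  apply: (measurable_int mu); apply: Radon_Nikodym_integrable.
  exact: normal_prob_dominates.
- apply: emeasurable_funM => //=; apply/measurable_EFinP => //.
  exact: measurable_normal_pdf.
- apply: ae_eqe_mul2l => /=.
  rewrite Radon_NikodymE//=; first exact: normal_prob_dominates.
  move=> dom; case: cid => /= h [h1 h2 h3].
  apply: integral_ae_eq => //=.
  + by apply/measurable_EFinP; exact: measurable_normal_pdf.
  + by move=> E E01 mE; rewrite -h3.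
Qed.

(** By the half-angle formula this is the square of the difference quotient at 0, with step 1 / (n +
    1), of x -> 2 sin (y x / 2), whose slope there is y. *)
Lemma cvg_onem_cos_scaled (y : R) :
  2 * n.+1%:R ^+ 2 * (1 - cos (y / n.+1%:R)) @[n --> \oo] --> y ^+ 2.
Proof.
pose g (x : R) := 2 * sin (y / 2 * x).
have h n : 2 * n.+1%:R ^+ 2 * (1 - cos (y / n.+1%:R)) =
    ((harmonic n)^-1 * (g (harmonic n + 0) - g 0)) ^+ 2.
  have -> : y / n.+1%:R = (y / 2 * harmonic n) *+ 2 :> R.
    by rewrite /harmonic/= -mulr_natl; field; rewrite addrC natr1 pnatr_eq0.
  rewrite cos_mulr2n cos2sin2 /g addr0 mulr0 sin0 mulr0 subr0 /harmonic/= invrK.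
  by rewrite -mulr_natl; ring.
under eq_fun do rewrite h.
have dg : is_derive (0 : R) 1 g y.
  by apply: is_derive_eq; rewrite /GRing.scale/= mulr0 cos0; field.
have /cvgr_dnbhsP/(_ harmonic) cg : h^-1 *: (g (h *: 1 + 0) - g 0) @[h --> 0^'] --> y.
  have [dg1 dg2] := dg; rewrite -dg2; exact: dg1.
apply: cvgM; under eq_fun do rewrite -[X in g (X + _)]mulr1;
 apply: cg; split; try exact: cvg_harmonic; move=> n; rewrite invr_neq0// pnatr_eq0.
Qed.

Lemma Rintegral_gaussian_law d (Om : measurableType d) (P : probability Om R)
    (Y : Om -> R) (nu : probability (measurableTypeR R) R) (f : R -> R) (M : R) :
  measurable_fun setT Y ->
  (forall A : set R, measurable A -> P (Y @^-1` A) = nu A) ->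
  measurable_fun setT f -> (forall x, `|f x| <= M) ->
  \int[P]_w f (Y w) = \int[nu]_x f x.
Proof.
move=> mY PY mf fM.
have mY' : @measurable_fun _ _ Om (measurableTypeR R) setT Y := mY.
pose Y' := @mfun_Sub _ _ Om (measurableTypeR R) Y (mem_set mY').
have fi : P.-integrable setT ((EFin \o f) \o Y').
  apply: (@integrable_bounded _ _ _ _ _ M (f \o Y')) => //.
  - by rewrite (le_lt_trans (probability_le1 _ _)) ?ltry.
  - apply: measurableT_comp => //; exact: mf.
  - by move=> x _; exact: fM.
transitivity (fine (\int[distribution P Y']_y (f y)%:E)%E).
  by rewrite (integral_distribution _ fi)//; exact/measurable_EFinP.
by congr fine; apply: eq_measure_integral => A mA _; exact: PY.
Qed.

(** A constant fits the same formula with [v = 0]. From here on this formula stands for the law. *)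
Lemma gaussian_rv_cos d (Om : measurableType d) (P : probability Om R)
    (Y : Om -> R) : gaussian_rv P Y ->
  exists m v : R, 0 <= v /\ forall b th : R,
    \int[P]_w cos (b * Y w + th) = cos (b * m + th) * expR (- (v / 2 * b ^+ 2)).
Proof.
move=> [mY YP].
have mc (b th : R) : measurable_fun setT (fun x : R => cos (b * x + th)).
  apply: (measurableT_comp (continuous_measurable_fun (@continuous_cos R))).
  by apply: measurable_funD => //; exact: measurable_funM.
have c1 (b th x : R) : `|cos (b * x + th)| <= 1 by rewrite ler_norml cos_geN1 cos_le1.
case: YP => [[m Ym]|[m [s [s0 Ys]]]].
  exists m, 0; split=> // b th; rewrite mul0r mul0r oppr0 expR0 mulr1.
  rewrite (@Rintegral_gaussian_law _ _ P Y (@dirac _ (measurableTypeR R) m R) _ _ mY Ym (mc b th) (c1 b th)).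
  rewrite /Rintegral integral_dirac ?diracT ?mul1e//; apply/measurable_EFinP; exact: mc.
exists m, (s ^+ 2); split=> [|b th]; first exact: sqr_ge0.
rewrite (@Rintegral_gaussian_law _ _ P Y (normal_prob m s) _ _ mY Ys (mc b th) (c1 b th)).
by rewrite (integral_normal_prob _ _ (mc b th) (c1 b th)) Rintegral_cos_normal_pdf.
Qed.

Lemma Rintegral_prob_cst d (Om : measurableType d) (P : probability Om R) (c : R) :
  \int[P]_w c = c.
Proof. by have := expectation_cst P c; rewrite unlock /Rintegral => ->. Qed.

(** The nonnegative functions [f n] tend to (Y - m)^2 and have mean 2 k^2 (1 - exp (- v / (2 k^2)))
    <= v with k = n + 1; Fatou's lemma yields finiteness and the bound together. *)
Lemma second_moment_le_of_cos d (Om : measurableType d) (P : probability Om R)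
    (Y : Om -> R) (m v : R) :
  measurable_fun setT Y ->
  (forall b th : R,
    \int[P]_w cos (b * Y w + th) = cos (b * m + th) * expR (- (v / 2 * b ^+ 2))) ->
  (\int[P]_w ((Y w - m) ^+ 2)%:E <= v%:E)%E.
Proof.
move=> mY Yc.
pose f n w := 2 * n.+1%:R ^+ 2 * (1 - cos ((Y w - m) / n.+1%:R)).
have mcos := continuous_measurable_fun (@continuous_cos R).
have mc n : measurable_fun setT (fun w => cos ((Y w - m) / n.+1%:R)).
  apply: measurableT_comp => //; apply: measurable_funM => //.
  exact: measurable_funB.
have mf n : measurable_fun setT (f n).
  by apply: measurable_funM => //; apply: measurable_funB.
have f0 n w : 0 <= f n w.
  by rewrite /f mulr_ge0 ?mulr_ge0 ?sqr_ge0 ?subr_ge0 ?cos_le1.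
have P1 : (P setT < +oo)%E by rewrite (le_lt_trans (probability_le1 _ _)) ?ltry.
have ic n : P.-integrable setT (EFin \o (fun w => cos ((Y w - m) / n.+1%:R))).
  apply: (@integrable_bounded _ _ _ _ _ 1) => //.
  by move=> x _; rewrite ler_norml cos_geN1 cos_le1.
have intf n : (\int[P]_w (f n w)%:E <= v%:E)%E.
  have i1 : P.-integrable setT (EFin \o (fun w : Om => (1:R))).
    by apply: (@integrable_bounded _ _ _ _ _ 1) => //; move=> *; rewrite normr1.
  have i2 : P.-integrable setT (EFin \o f n).
    have h := integrable_EFinD measurableT i1 (integrable_EFinZ (-1) measurableT (ic n)).
    have := integrable_EFinZ (2 * n.+1%:R ^+ 2) measurableT h.
    by apply: eq_integrable => // w _; rewrite /f /= mulN1r.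
  rewrite -[X in (X <= _)%E]fineK; last exact: integrable_fin_num.
  rewrite lee_fin -/(Rintegral P setT (f n)) /f RintegralZl//; last first.
    have h := integrable_EFinD measurableT i1 (integrable_EFinZ (-1) measurableT (ic n)).
    by apply: eq_integrable h => // w _; rewrite /= mulN1r.
  rewrite (RintegralB measurableT i1 (ic n)) Rintegral_prob_cst.
  have -> : \int[P]_x cos ((Y x - m) / n.+1%:R) =
      expR (- (v / 2 * (n.+1%:R^-1) ^+ 2)).
    have := Yc n.+1%:R^-1 (- (m / n.+1%:R)).
    rewrite [_ * m]mulrC subrr cos0 mul1r => <-.
    by apply: eq_Rintegral => w _; congr cos; rewrite mulrBl mulrC.
  have n0 : (n.+1%:R : R) != 0 by rewrite pnatr_eq0.
  set t := v / 2 * _.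
  have -> : v = 2 * n.+1%:R ^+ 2 * t by rewrite /t; field; rewrite addrC natr1.
  rewrite ler_wpM2l ?mulr_ge0 ?sqr_ge0//.
  by rewrite lerBlDr -lerBlDl (le_trans _ (expR_ge1Dx _)).
rewrite (_ : (fun w => _) = (fun w => limn_einf (fun n => (f n w)%:E))); last first.
  apply/funext => w.
  have cf : (f n w)%:E @[n --> \oo] --> ((Y w - m) ^+ 2)%:E.
    by apply: cvg_EFin; [exact: nearW|exact: cvg_onem_cos_scaled].
  rewrite is_cvg_limn_einfE; last by apply/cvg_ex; exists ((Y w - m) ^+ 2)%:E.
  by apply/esym/cvg_lim.
apply: le_trans.
  apply: fatou => //; first by move=> n; exact/measurable_EFinP.
  by move=> n w _; rewrite lee_fin.
rewrite limn_einf_lim; apply: lime_le.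
  exact: is_cvg_einfs.
apply: nearW => n; rewrite (le_trans _ (intf n))//.
by apply: ereal_inf_lbound; exists n => /=.
Qed.

Lemma integrable_mul_of_sqr d (Om : measurableType d) (P : {measure set Om -> \bar R})
    (X Y : Om -> R) :
  measurable_fun setT X -> measurable_fun setT Y ->
  P.-integrable setT (EFin \o (fun w => X w ^+ 2)) ->
  P.-integrable setT (EFin \o (fun w => Y w ^+ 2)) ->
  P.-integrable setT (EFin \o (fun w => X w * Y w)).
Proof.
move=> mX mY iX iY.
apply: (le_integrable measurableT _ _ (integrable_EFinD measurableT iX iY)).
  by apply/measurable_EFinP; exact: measurable_funM.
move=> w _ /=; rewrite lee_fin [leRHS]ger0_norm ?addr_ge0 ?sqr_ge0//.
by rewrite ler_norml; nra.
Qed.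

Lemma integrable_of_sqr d (Om : measurableType d) (P : probability Om R)
    (Y : Om -> R) : measurable_fun setT Y ->
  P.-integrable setT (EFin \o (fun w => Y w ^+ 2)) ->
  P.-integrable setT (EFin \o Y).
Proof.
move=> mY iY; have P1 : (P setT < +oo)%E.
  by rewrite (le_lt_trans (probability_le1 _ _)) ?ltry.
have i1 : P.-integrable setT (EFin \o (fun w : Om => (1:R) ^+ 2)).
  by apply: (@integrable_bounded _ _ _ _ _ 1) => //; move=> *; rewrite expr1n normr1.
have := integrable_mul_of_sqr mY (measurable_cst (1 : R)) iY i1.
by apply: eq_integrable => // w _ /=; rewrite mulr1.
Qed.

Lemma variance_le_second_moment d (Om : measurableType d) (P : probability Om R)
    (Y : Om -> R) (m : R) : measurable_fun setT Y ->
  ('V_P[Y] <= \int[P]_w ((Y w - m) ^+ 2)%:E)%E.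
Proof.
move=> mY; have [->|fin] := eqVneq (\int[P]_w ((Y w - m) ^+ 2)%:E)%E +oo%E.
  by rewrite leey.
have mYm : measurable_fun setT (fun w => Y w - m) by exact: measurable_funB.
have i2 : P.-integrable setT (EFin \o (fun w => (Y w - m) ^+ 2)).
  apply/integrableP; split; first by apply/measurable_EFinP; exact: measurable_funX.
  under eq_integral do rewrite gee0_abs ?lee_fin ?sqr_ge0//.
  by rewrite ltey.
have i1 := integrable_of_sqr mYm i2.
have ic c : P.-integrable setT (EFin \o (fun w : Om => (c:R))).
  apply: (@integrable_bounded _ _ _ _ _ `|c|) => //.
  by rewrite (le_lt_trans (probability_le1 _ _)) ?ltry.
have iY : P.-integrable setT (EFin \o Y).
  by have := integrable_EFinD measurableT i1 (ic m); apply: eq_integrable => // w _ /=; rewrite subrK.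
rewrite /variance unlock.
have -> : fine 'E_P[Y] = \int[P]_w (Y w - m) + m.
  rewrite RintegralB// Rintegral_prob_cst subrK.
  by rewrite unlock.
set c := \int[P]_w (Y w - m).
rewrite unlock (_ : (\int[P]_w _)%E = (\int[P]_w ((Y w - m) ^+ 2 + (c ^+ 2 + (- 2 * c) * (Y w - m)))%:E)%E); last first.
  by apply: eq_integral => w _ /=; congr EFin; rewrite !fctE /=; ring.
have i3 := integrable_EFinZ (-2 * c) measurableT i1.
have i4 := integrable_EFinD measurableT (ic (c ^+ 2)) i3.
rewrite -[leLHS]fineK; last exact: integrable_fin_num (integrable_EFinD measurableT i2 i4).
rewrite -[leRHS]fineK; last exact: integrable_fin_num i2.
rewrite lee_fin -!/(Rintegral P _ _) !RintegralD// Rintegral_prob_cst.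
rewrite (RintegralZl (-2 * c) measurableT i1) -/c gerDl.
by rewrite -mulrA mulNr -expr2 -{1}[c ^+ 2]mul1r -mulrBl; have := sqr_ge0 c; lra.
Qed.

(** The centre [m] of [gaussian_rv_cos] is existential, so the lower bound is asked about every
    centre [c]; at c = m it gives s <= v. *)
Lemma gaussian_cos_le d (Om : measurableType d) (P : probability Om R)
    (Y : Om -> R) (s th : R) : gaussian_rv P Y ->
  (forall c, s%:E <= \int[P]_w ((Y w - c) ^+ 2)%:E)%E ->
  `|\int[P]_w cos (Y w + th)| <= expR (- (s / 2)).
Proof.
move=> gY sY; have [m [v [v0 Yc]]] := gaussian_rv_cos gY.
have mY : measurable_fun setT Y by case: gY.
have := Yc 1 th; under eq_Rintegral do rewrite mul1r; move=> ->.
rewrite normrM (ger0_norm (expR_ge0 _)) expr1n mulr1.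
rewrite (@le_trans _ _ (expR (- (v / 2))))//.
  by rewrite ler_piMl ?expR_ge0// ler_norml cos_geN1 cos_le1.
rewrite ler_expR lerN2 ler_wpM2r// -lee_fin.
by rewrite (le_trans (sY m))//; apply: second_moment_le_of_cos.
Qed.

Lemma gaussian_cos_le_variance d (Om : measurableType d) (P : probability Om R)
    (Y : Om -> R) (s th : R) : gaussian_rv P Y -> (s%:E <= 'V_P[Y])%E ->
  `|\int[P]_w cos (Y w + th)| <= expR (- (s / 2)).
Proof.
move=> gY sY; apply: gaussian_cos_le => // c; rewrite (le_trans sY)//.
by apply: variance_le_second_moment; case: gY.
Qed.

End GaussianCharacteristicFunction.

(** * Conditional variance and local nondeterminism *)

Section ConditionalVariance.
Context {R : realType} {dO : measure_display} {Omega : measurableType dO}.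
Variable P : probability Omega R.

Implicit Types (G : set (set Omega)) (W Z : Omega -> R).

Lemma measurable_wrt_measurable_fun G Z : sub_sigma_field G ->
  measurable_wrt G Z -> measurable_fun setT Z.
Proof. by move=> [_ GS] mZ _ B mB; rewrite setTI; apply/GS/mZ. Qed.

(** Layer-cake form of the integer part: it turns a discretised random variable into a finite sum of
    indicators of level sets. *)
Lemma sum_indic_truncn (M : nat) (y : R) : 0 <= y -> y <= M%:R ->
  \sum_(j < M) ((j.+1%:R <= y)%R%:R : R) = (Num.truncn y)%:R.
Proof.
move=> y0 yM; under eq_bigr => j _ do rewrite -truncn_gt_nat.
rewrite -natr_sum; congr (_%:R).
have tM : (Num.truncn y <= M)%N by rewrite truncn_le_nat (le_lt_trans yM)// ltr_nat.
rewrite -(big_mkord xpredT (fun j => (j < Num.truncn y : bool) : nat)).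
rewrite (big_cat_nat (leq0n _) tM)/= -[RHS]addn0; congr (_ + _)%N.
  rewrite (eq_big_nat _ _ (F2 := fun=> 1%N)) ?sum_nat_const_nat ?subn0 ?muln1//.
  by move=> j /andP[_ ->].
by rewrite big_nat big1// => j /andP[tj _]; rewrite ltnNge tj.
Qed.

(** [Z] is within 1 / n of the step function [ze], whose level sets belong to [G]; [ze] is
    orthogonal to [W] by hypothesis, and the error is at most E |W| / n. *)
Lemma Rintegral_orthogonal_bounded G W Z (N : nat) : sub_sigma_field G ->
  P.-integrable setT (EFin \o W) ->
  (forall A, G A -> \int[P]_w (W w * \1_A w) = 0) ->
  measurable_wrt G Z -> (forall w, `|Z w| <= N%:R) ->
  \int[P]_w (W w * Z w) = 0.
Proof.
move=> sG iW WG mZ ZN.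
have mW : measurable_fun setT W by apply/measurable_EFinP; case/integrableP: iW.
have mZ' := measurable_wrt_measurable_fun sG mZ.
pose D := \int[P]_w `|W w|.
have D0 : 0 <= D by apply: Rintegral_ge0.
have iWb (f : Omega -> R) (K : R) : measurable_fun setT f ->
    (forall w, `|f w| <= K) -> P.-integrable setT (EFin \o (fun w => W w * f w)).
  move=> mf fK; apply: (le_integrable measurableT _ _ (integrable_EFinZ K measurableT (integrable_norm iW))).
    by apply/measurable_EFinP; exact: measurable_funM.
  move=> w _ /=; rewrite lee_fin normrM mulrC [leRHS]ger0_norm; last first.
    by rewrite mulr_ge0// (le_trans (normr_ge0 _) (fK w)).
  by rewrite ler_wpM2r.
apply/eqP; rewrite -normr_le0; apply/ler_addgt0Pr => e e0; rewrite add0r.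
(* This makes D / n smaller than [e]. *)
pose n := (Num.truncn (D / e)).+1.
have n0 : (0 : R) < n%:R by rewrite ltr0n.
pose M := ((N + N) * n)%N.
pose E (j : nat) := Z @^-1` [set x | j.+1%:R <= n%:R * (x + N%:R)].
have mE j : G (E j).
  apply: mZ; rewrite -[X in measurable X]setTI.
  apply: measurable_fun_le => //; apply: measurable_funM => //.
  exact: measurable_funD.
pose ze w := n%:R^-1 * (\sum_(j < M) (\1_(E j) w : R)) - N%:R.
have GT : G setT by case: sG => -[G0 GC _] _; have := GC _ G0; rewrite setD0.
have W0 : \int[P]_w W w = 0.
  have := WG _ GT; under eq_Rintegral do rewrite indicT/= mulr1.
  exact.
have zeE w : `|Z w - ze w| <= n%:R^-1.
  have := ZN w; rewrite ler_norml => /andP[Z1 Z2].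
  have y0 : 0 <= n%:R * (Z w + N%:R) by rewrite mulr_ge0// -lerBlDr sub0r.
  have yM : n%:R * (Z w + N%:R) <= M%:R.
    by rewrite /M natrM natrD mulrC ler_wpM2r// lerD2r.
  have -> : ze w = n%:R^-1 * (Num.truncn (n%:R * (Z w + N%:R)))%:R - N%:R.
    rewrite /ze -(sum_indic_truncn y0 yM); congr (_ * _ - _).
    by apply: eq_bigr => j _; rewrite indicE mem_setE.
  have := truncn_itv y0; rewrite -natr1 => /andP[t1 t2].
  move: t1 t2; set t := (Num.truncn _)%:R => t1 t2.
  have -> : Z w - (n%:R^-1 * t - N%:R) = n%:R^-1 * (n%:R * (Z w + N%:R) - t).
    by field; rewrite gt_eqF.
  rewrite ger0_norm; last by rewrite mulr_ge0// ?invr_ge0 ?ler0n// subr_ge0.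
  by rewrite -[leRHS]mulr1 ler_wpM2l ?invr_ge0 ?ler0n// lerBlDl ltW.
have mze : measurable_fun setT ze.
  apply: measurable_funB => //; apply: measurable_funM => //.
  apply: measurable_sum => j; apply: measurable_indic.
  by case: sG => _; apply; exact: mE.
have Wze : \int[P]_w (W w * ze w) = 0.
  have iWE (j : nat) : P.-integrable setT (EFin \o (fun w => W w * \1_(E j) w)).
    apply: (iWb _ 1).
      by apply: measurable_indic; case: sG => _; apply; exact: mE.
    by move=> w; rewrite indicE; case: (_ \in _); rewrite ?normr1 ?normr0.
  have H (k : nat) : P.-integrable setT (EFin \o (fun w => W w * \sum_(j < k) \1_(E j) w)) /\
     \int[P]_w (W w * \sum_(j < k) \1_(E j) w) = 0.
    elim: k => [|k [IH1 IH2]].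
      split; last by under eq_Rintegral do rewrite big_ord0 mulr0; rewrite Rintegral_prob_cst.
      apply: (iWb _ 1); first by under eq_fun do rewrite big_ord0; exact: measurable_cst.
      by move=> w; rewrite big_ord0 normr0.
    have H w : W w * \sum_(j < k.+1) \1_(E j) w = W w * \sum_(j < k) \1_(E j) w + W w * \1_(E k) w.
      by rewrite big_ord_recr/= mulrDr.
    split.
      by have := integrable_EFinD measurableT IH1 (iWE k); apply: eq_integrable => // w _ /=; rewrite H.
    under eq_Rintegral do rewrite H.
    by rewrite RintegralD// IH2 WG// addr0.
  have [H1 H2] := H M.
  under eq_Rintegral do rewrite /ze mulrBr mulrCA.
  rewrite RintegralB//; last 2 first.
  - exact: integrable_EFinZ.
  - by have := integrable_EFinZ N%:R measurableT iW; apply: eq_integrable => // w _ /=; rewrite mulrC.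
  by rewrite RintegralZl// H2 mulr0 RintegralZr// W0 mul0r subr0.
have mZze : measurable_fun setT (fun w => Z w - ze w) by exact: measurable_funB.
have i1 := iWb _ _ mZze zeE.
have -> : \int[P]_w (W w * Z w) = \int[P]_w (W w * (Z w - ze w)).
  rewrite -[RHS]addr0 -Wze -RintegralD//; last first.
    apply: (iWb _ (N%:R + n%:R^-1)) => // w.
    have -> : ze w = Z w + (ze w - Z w) by rewrite addrC subrK.
    by rewrite (le_trans (ler_normD _ _))// lerD// distrC.
  by apply: eq_Rintegral => w _; rewrite -mulrDr subrK.
rewrite (le_trans (le_normr_Rintegral _ i1))//.
apply: (@le_trans _ _ (\int[P]_w (n%:R^-1 * `|W w|))).
  apply: le_Rintegral => //.
  - exact: (integrable_norm i1).
  - exact: integrable_EFinZ (integrable_norm iW).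
  - by move=> w _; rewrite normrM mulrC ler_wpM2r.
rewrite RintegralZl//; last exact: (integrable_norm iW).
rewrite mulrC ler_pdivrMr// mulrC -ler_pdivrMr// ltW//.
by rewrite truncnS_gt.
Qed.

(** [Z] is truncated to |Z| <= k, and |W Z| dominates as k grows. *)
Lemma Rintegral_orthogonal G W Z : sub_sigma_field G ->
  P.-integrable setT (EFin \o W) ->
  (forall A, G A -> \int[P]_w (W w * \1_A w) = 0) ->
  measurable_wrt G Z -> P.-integrable setT (EFin \o (fun w => W w * Z w)) ->
  \int[P]_w (W w * Z w) = 0.
Proof.
move=> sG iW WG mZ iWZ.
have mW : measurable_fun setT W by apply/measurable_EFinP; case/integrableP: iW.
have mZ' := measurable_wrt_measurable_fun sG mZ.
pose h (k : nat) (x : R) : R := x * \1_(`[- k%:R, k%:R] : set R) x.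
have mh k : measurable_fun setT (h k).
  by apply: measurable_funM => //; apply: measurable_indic; exact: measurable_itv.
have mhZ k : measurable_fun setT (h k \o Z) by exact: measurableT_comp.
have hZ0 k : \int[P]_w (W w * h k (Z w)) = 0.
  apply: (@Rintegral_orthogonal_bounded G _ (h k \o Z) k) => //.
    move=> B mB; rewrite comp_preimage; apply: mZ.
    by rewrite -[X in measurable X]setTI; exact: mh.
  move=> w /=; rewrite /h indicE mem_setE in_itv/= -ler_norml.
  by case: (leP `|Z w| k%:R) => // H; rewrite ?mulr1 ?mulr0 ?normr0.
have : \int[P]_w (W w * h k (Z w)) @[k --> \oo] --> \int[P]_w (W w * Z w).
  apply: fine_cvg; rewrite fineK; last exact: integrable_fin_num.
  apply: (@dominated_cvg _ _ _ P _ _ _ _ (fun w => (`|W w * Z w|)%:E)%E) => //.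
  - by move=> k; apply/measurable_EFinP; apply: measurable_funM => //; exact: mhZ.
  - move=> w _; apply: cvg_near_cst; near=> k.
    congr EFin; congr (_ * _); rewrite /h indicE mem_setE in_itv/= -ler_norml.
    suff -> : `|Z w| <= k%:R by rewrite mulr1.
    near: k; exists (Num.truncn `|Z w|).+1 => // n /= xn.
    by rewrite (le_trans (ltW (truncnS_gt _)))// ler_nat.
  - exact: (integrable_norm iWZ).
  - move=> n w _; rewrite abse_EFin lee_fin [leLHS]normrM [leRHS]normrM ler_wpM2l// /h normrM indicE.
    by case: (_ \in _); rewrite ?normr1 ?normr0 ?mulr1 ?mulr0.
under eq_fun do rewrite hZ0.
move=> /(cvg_unique (@Rhausdorff R)); apply; exact: cvg_cst.
Unshelve. all: end_near. Qed.

(** Pythagoras: E (W + Z)^2 = E W^2 + E Z^2. Either the right side of the inequality is infinite, or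
    the integrability of W Z and Z^2 follows from that of (W + Z)^2 and W^2. *)
Lemma second_moment_orthogonal_le G W Z : sub_sigma_field G ->
  P.-integrable setT (EFin \o W) ->
  P.-integrable setT (EFin \o (fun w => W w ^+ 2)) ->
  (forall A, G A -> \int[P]_w (W w * \1_A w) = 0) ->
  measurable_wrt G Z ->
  ((\int[P]_w (W w ^+ 2))%R%:E <= \int[P]_w ((W w + Z w) ^+ 2)%:E)%E.
Proof.
move=> sG iW iW2 WG mZ.
have mW : measurable_fun setT W by apply/measurable_EFinP; case/integrableP: iW.
have mZ' := measurable_wrt_measurable_fun sG mZ.
have [->|fin] := eqVneq (\int[P]_w ((W w + Z w) ^+ 2)%:E)%E +oo%E.
  by rewrite leey.
have mWZ : measurable_fun setT (fun w => W w + Z w) by exact: measurable_funD.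
have iWZ2 : P.-integrable setT (EFin \o (fun w => (W w + Z w) ^+ 2)).
  apply/integrableP; split; first by apply/measurable_EFinP; exact: measurable_funX.
  under eq_integral do rewrite gee0_abs ?lee_fin ?sqr_ge0//.
  by rewrite ltey.
have i3 := integrable_mul_of_sqr mW mWZ iW2 iWZ2.
have iWZ : P.-integrable setT (EFin \o (fun w => W w * Z w)).
  have := integrable_EFinD measurableT i3 (integrable_EFinZ (-1) measurableT iW2).
  by apply: eq_integrable => // w _ /=; congr EFin; ring.
have iZ2 : P.-integrable setT (EFin \o (fun w => Z w ^+ 2)).
  have := integrable_EFinD measurableT iWZ2 (integrable_EFinD measurableT
    (integrable_EFinZ (-1) measurableT iW2) (integrable_EFinZ (-2) measurableT iWZ)).
  by apply: eq_integrable => // w _ /=; congr EFin; ring.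
rewrite -[leRHS]fineK; last exact: integrable_fin_num iWZ2.
rewrite lee_fin -/(Rintegral P _ _).
have i4 := integrable_EFinZ 2 measurableT iWZ.
have -> : \int[P]_w ((W w + Z w) ^+ 2) =
    \int[P]_w (W w ^+ 2 + (2 * (W w * Z w) + Z w ^+ 2)).
  by apply: eq_Rintegral => w _; ring.
have i5 := integrable_EFinD measurableT i4 iZ2.
rewrite RintegralD// lerDl RintegralD// RintegralZl// (Rintegral_orthogonal sG)//.
by rewrite mulr0 add0r; apply: Rintegral_ge0 => w _; exact: sqr_ge0.
Qed.

Lemma integrable_EFin_sum d (S : measurableType d) (K : realType)
    (nu : {measure set S -> \bar K}) (D : set S) (I : Type) (r : seq I)
    (F : I -> S -> K) : measurable D ->
  (forall i, nu.-integrable D (EFin \o F i)) ->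
  nu.-integrable D (EFin \o (fun x => \sum_(i <- r) F i x)).
Proof.
move=> mD iF; elim: r => [|i r IH].
  apply: (eq_integrable mD (cst 0%E)); last exact: integrable0.
  by move=> x _ /=; rewrite big_nil.
have := integrable_EFinD mD (iF i) IH.
by apply: eq_integrable => // x _ /=; rewrite big_cons.
Qed.

Lemma Rintegral_sum d (S : measurableType d) (K : realType)
    (nu : {measure set S -> \bar K}) (D : set S) (I : Type) (r : seq I)
    (F : I -> S -> K) : measurable D ->
  (forall i, nu.-integrable D (EFin \o F i)) ->
  \int[nu]_(x in D) (\sum_(i <- r) F i x) = \sum_(i <- r) \int[nu]_(x in D) F i x.
Proof.
move=> mD iF; elim: r => [|i r IH].
  rewrite big_nil /Rintegral; under eq_integral do rewrite big_nil.
  by rewrite integral0.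
under eq_Rintegral do rewrite big_cons.
by rewrite big_cons RintegralD// ?IH//; exact: integrable_EFin_sum.
Qed.

Lemma Rintegral_ae_ge0 (f : Omega -> R) : P.-integrable setT (EFin \o f) ->
  (\forall w \ae P, 0 <= f w) -> 0 <= \int[P]_w f w.
Proof.
move=> fi f0; rewrite /Rintegral (ae_eq_integral (fun w => (`|f w|)%:E)) //.
- by apply: fine_ge0; apply: integral_ge0 => w _; rewrite lee_fin.
- by case/integrableP: fi.
- by have := integrable_norm fi; case/integrableP.
- by apply: filterS f0 => w fw _; rewrite ger0_norm.
Qed.

Lemma sub_sigma_field_setT G : sub_sigma_field G -> G setT.
Proof. by case=> -[G0 GC _] _; have := GC _ G0; rewrite setD0. Qed.

(** The type [g_sigma_algebraType G] gives access to the closure properties of measurable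
    functions. *)
Lemma measurable_wrtP G Z : sub_sigma_field G ->
  measurable_wrt G Z <->
  @measurable_fun _ _ (g_sigma_algebraType G) R setT Z.
Proof.
move=> [sG _]; rewrite /measurable_fun /measurable_wrt.
have GE : <<s G >> = G by exact: sigma_algebra_id.
split=> [mZ _ B mB|mZ B mB].
  by rewrite setTI; rewrite /measurable/= GE; exact: mZ.
have := mZ measurableT B mB.
by rewrite setTI /measurable/= GE.
Qed.

Lemma measurable_wrt_sum G (I : Type) (r : seq I) (F : I -> Omega -> R) :
  sub_sigma_field G -> (forall i, measurable_wrt G (F i)) ->
  measurable_wrt G (fun w => \sum_(i <- r) F i w).
Proof.
move=> sG mF; apply/(measurable_wrtP _ sG).
by apply: measurable_sum => i; apply/(measurable_wrtP _ sG).
Qed.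

Lemma measurable_wrtZ G (c : R) Z :
  sub_sigma_field G -> measurable_wrt G Z -> measurable_wrt G (fun w => c * Z w).
Proof.
move=> sG mF; apply/(measurable_wrtP _ sG); apply: measurable_funM => //.
by apply/(measurable_wrtP _ sG).
Qed.

Lemma measurable_wrtD G Z Z' :
  sub_sigma_field G -> measurable_wrt G Z -> measurable_wrt G Z' ->
  measurable_wrt G (fun w => Z w + Z' w).
Proof.
move=> sG mZ mZ'; apply/(measurable_wrtP _ sG).
by apply: measurable_funD; apply/(measurable_wrtP _ sG).
Qed.

Lemma measurable_wrt_cst G (c : R) :
  sub_sigma_field G -> measurable_wrt G (fun=> c).
Proof. by move=> sG; apply/(measurable_wrtP _ sG). Qed.

Lemma row_mulmx_trE d (v : 'rV[R]_d) (M : 'M[R]_d) :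
  (v *m M *m v^T) 0 0 = \sum_i \sum_j v 0 i * v 0 j * M i j.
Proof.
rewrite mxE exchange_big/=; apply: eq_bigr => j _; rewrite mxE mulr_suml.
by apply: eq_bigr => i _; rewrite !mxE; ring.
Qed.

(** Let W = v . (Y - E[Y | G]). It is orthogonal to [G], and E W^2 is the mean of v V v^T, hence at
    least c |v|^2. The remainder v . E[Y | G] + Z is measurable for [G], so adding it cannot lower
    the second moment. *)
Lemma cond_var_ge_second_moment d G (Y : Omega -> 'rV[R]_d) (c : R)
    (v : 'rV[R]_d) Z :
  sub_sigma_field G -> cond_var_ge P G Y c%:M -> measurable_wrt G Z ->
  ((c * dot v v)%:E <= \int[P]_w ((dot v (Y w) + Z w) ^+ 2)%:E)%E.
Proof.
move=> sG [V [m Ym Vm] VA] mZ.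
pose D i w := Y w 0 i - m w 0 i.
have iD i : P.-integrable setT (EFin \o D i).
  have [iY im _ _] := Ym i.
  have := integrable_EFinD measurableT iY (integrable_EFinZ (-1) measurableT im).
  by apply: eq_integrable => // w _ /=; rewrite mulN1r.
have DG i A : G A -> \int[P]_w (D i w * \1_A w) = 0.
  move=> GA; have [iY im _ mY] := Ym i.
  have mA : measurable A by case: sG => _; apply.
  transitivity (\int[P]_(w in A) D i w).
    rewrite [RHS]Rintegral_mkcond; apply: eq_Rintegral => w _.
    by rewrite patchE indicE; case: ifP; rewrite ?mulr1 ?mulr0.
  rewrite RintegralB//; [|exact: (integrableS measurableT)..].
  by rewrite /Rintegral mY// subrr.
have iDD i j : P.-integrable setT (EFin \o (fun w => D i w * D j w)).
  by have [] := Vm i j.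
have VD i j : \int[P]_w V w i j = \int[P]_w (D i w * D j w).
  by have [_ _ _ h] := Vm i j; rewrite /Rintegral h//; exact: sub_sigma_field_setT.
have iV i j : P.-integrable setT (EFin \o (fun w => V w i j)) by have [] := Vm i j.
pose W w := \sum_i v 0 i * D i w.
have iW : P.-integrable setT (EFin \o W).
  by apply: integrable_EFin_sum => // i; exact: integrable_EFinZ.
have W2 w : W w ^+ 2 = \sum_i \sum_j v 0 i * v 0 j * (D i w * D j w).
  rewrite expr2 /W mulr_suml; apply: eq_bigr => i _; rewrite mulr_sumr.
  by apply: eq_bigr => j _; ring.
have iW2 : P.-integrable setT (EFin \o (fun w => W w ^+ 2)).
  apply: (eq_integrable measurableT (EFin \o (fun w => \sum_i \sum_j v 0 i * v 0 j * (D i w * D j w)))).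
    by move=> w _ /=; rewrite W2.
  apply: integrable_EFin_sum => // i; apply: integrable_EFin_sum => // j.
  exact: integrable_EFinZ.
have WG A : G A -> \int[P]_w (W w * \1_A w) = 0.
  move=> GA; under eq_Rintegral do rewrite /W mulr_suml.
  have mA : measurable A by case: sG => _; apply.
  have iDA i : P.-integrable setT (EFin \o (fun w => D i w * \1_A w)).
    apply: (le_integrable measurableT _ _ (iD i)).
      apply/measurable_EFinP; apply: measurable_funM.
        by apply/measurable_EFinP; case/integrableP: (iD i).
      exact: measurable_indic.
    move=> w _; rewrite abse_EFin abse_EFin lee_fin normrM indicE.
    by case: (_ \in _); rewrite ?normr1 ?normr0 ?mulr1 ?mulr0.
  rewrite Rintegral_sum//.
    rewrite big1// => i _; under eq_Rintegral do rewrite -mulrA.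
    by rewrite RintegralZl// DG// mulr0.
  move=> i; have := integrable_EFinZ (v 0 i) measurableT (iDA i).
  by apply: eq_integrable => // w _ /=; rewrite mulrA.
have cW : c * dot v v <= \int[P]_w (W w ^+ 2).
  pose f w := \sum_i \sum_j v 0 i * v 0 j * V w i j.
  have if_ : P.-integrable setT (EFin \o f).
    apply: integrable_EFin_sum => // i; apply: integrable_EFin_sum => // j.
    exact: integrable_EFinZ.
  have ic : P.-integrable setT (EFin \o (fun w : Omega => - (c * dot v v))).
    apply: (@integrable_bounded _ _ _ _ _ `|- (c * dot v v)|) => //.
    by rewrite (le_lt_trans (probability_le1 _ _)) ?ltry.
  have : 0 <= \int[P]_w (f w - c * dot v v).
    apply: Rintegral_ae_ge0; first exact: integrable_EFinD.
    apply: filterS VA => w [_ _ /(_ v)].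
    rewrite mulmxBr mulmxBl mxE row_mulmx_trE [X in _ + X]mxE.
    suff -> : (v *m c%:M *m v^T) 0 0 = c * dot v v by [].
    rewrite mul_mx_scalar -scalemxAl mxE /dot mxE.
    by congr (_ * _); apply: eq_bigr => i _; rewrite mxE.
  rewrite RintegralD// Rintegral_prob_cst subr_ge0 => /le_trans; apply.
  rewrite le_eqVlt; apply/orP; left; apply/eqP.
  under [RHS]eq_Rintegral do rewrite W2.
  rewrite /f Rintegral_sum//; last first.
    by move=> i; apply: integrable_EFin_sum => // j; exact: integrable_EFinZ.
  rewrite [RHS]Rintegral_sum//; last first.
    by move=> i; apply: integrable_EFin_sum => // j; exact: integrable_EFinZ.
  apply: eq_bigr => i _.
  rewrite Rintegral_sum//; last by move=> j; exact: integrable_EFinZ.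
  rewrite [RHS]Rintegral_sum//; last by move=> j; exact: integrable_EFinZ.
  by apply: eq_bigr => j _; rewrite !RintegralZl// VD.
pose Z' w := dot v (m w) + Z w.
have mZ' : measurable_wrt G Z'.
  apply: measurable_wrtD => //; apply: measurable_wrt_sum => // i.
  by apply: measurable_wrtZ => //; have [] := Ym i.
apply: le_trans (le_trans (second_moment_orthogonal_le sG iW iW2 WG mZ') _).
  by rewrite lee_fin.
rewrite le_eqVlt; apply/orP; left; apply/eqP; apply: eq_integral => w _.
congr EFin; rewrite /Z' addrA; congr ((_ + _) ^+ 2).
rewrite /W /dot -big_split/=; apply: eq_bigr => i _.
by rewrite -mulrDr subrK.
Qed.

(** * Linear combinations of the process at several times *)

Section Combinations.
Context {d : nat}.
Variables (T : R) (F : R -> set (set Omega)) (X : R -> Omega -> 'rV[R]_d).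
Implicit Types (xi : 'rV[R]_d) (l : seq (R * R)).

(** Times may repeat in [l], since expanding a moment produces repetitions. *)
Definition lincomb xi l (w : Omega) : R :=
  \sum_(p <- l) p.1 * dot xi (X p.2 w).

Lemma dotZl (a : R) (u v : 'rV[R]_d) : dot (a *: u) v = a * dot u v.
Proof. by rewrite /dot mulr_sumr; apply: eq_bigr => i _; rewrite mxE mulrA. Qed.

Lemma gaussian_lincomb xi l : gaussian_process P T X ->
  (forall p, p \in l -> 0 <= p.2 <= T) -> gaussian_rv P (lincomb xi l).
Proof.
move=> gX lT.
have := gX (size l) (fun k => (tnth (in_tuple l) k).2)
  (fun k => (tnth (in_tuple l) k).1 *: xi).
have -> : (fun w => \sum_(k < size l) dot ((tnth (in_tuple l) k).1 *: xi)
   (X (tnth (in_tuple l) k).2 w)) = lincomb xi l.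
  apply/funext => w; rewrite /lincomb [RHS]big_tnth.
  by apply: eq_bigr => k _; rewrite dotZl.
by apply=> k; apply: lT; exact: mem_tnth.
Qed.

(** The terms of [l] are measurable for [F s], so together with the centre [a] they form the [Z] of
    [cond_var_ge_second_moment]. *)
Lemma cond_var_cos_le xi l (s t c th : R) :
  adapted_gaussian_process P T F X ->
  0 <= s -> s <= t -> t <= T -> cond_var_ge P (F s) (X t) c%:M ->
  (forall p, p \in l -> 0 <= p.2 <= s) ->
  `|\int[P]_w cos (lincomb xi ((1, t) :: l) w + th)| <= expR (- (c * dot xi xi / 2)).
Proof.
move=> [[Fsub Finc] Xad gX _] s0 st tT cv ls.
have sF : sub_sigma_field (F s) by apply: Fsub; rewrite s0 (le_trans st).
apply: gaussian_cos_le.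
  apply: gaussian_lincomb => // p; rewrite inE => /predU1P[->/=|/ls /andP[-> ps]].
    by rewrite tT (le_trans s0).
  by rewrite (le_trans ps)// (le_trans st).
move=> a; pose Z w := (\sum_(p <- l) p.1 * dot xi (X p.2 w)) - a.
have -> : (fun w => ((lincomb xi ((1, t) :: l) w - a) ^+ 2)%:E) =
          (fun w => ((dot xi (X t w) + Z w) ^+ 2)%:E).
  by apply/funext => w; rewrite /lincomb big_cons/= mul1r addrA.
apply: (cond_var_ge_second_moment xi sF cv).
apply: measurable_wrtD => //; last exact: measurable_wrt_cst.
have -> : (fun w => \sum_(p <- l) p.1 * dot xi (X p.2 w)) =
   (fun w => \sum_(k < size l) (tnth (in_tuple l) k).1 * dot xi (X (tnth (in_tuple l) k).2 w)).
  by apply/funext => w; rewrite [LHS]big_tnth.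
apply: measurable_wrt_sum => // k; apply: measurable_wrtZ => //.
apply: measurable_wrt_sum => // i; apply: measurable_wrtZ => //.
have /ls/andP[p0 ps] : tnth (in_tuple l) k \in l by exact: mem_tnth.
move=> B mB; apply: (Finc (tnth (in_tuple l) k).2 s) => //.
  by rewrite (le_trans st).
by apply: Xad => //; rewrite p0 (le_trans ps)// (le_trans st).
Qed.

Lemma dotBr (u v w : 'rV[R]_d) : dot u (v - w) = dot u v - dot u w.
Proof.
by rewrite /dot -sumrB; apply: eq_bigr => i _; rewrite !mxE mulrBr.
Qed.

Lemma dot_ge0 (u : 'rV[R]_d) : 0 <= dot u u.
Proof. by rewrite /dot sumr_ge0// => i _; rewrite -expr2 sqr_ge0. Qed.

Lemma enorm_sqr (u : 'rV[R]_d) : enorm u ^+ 2 = dot u u.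
Proof. by rewrite /enorm sqr_sqrtr// dot_ge0. Qed.

(** When the coefficients have total zero, only increments remain, the form in which [LND] sees the
    process. The last increment has coefficient [a n]. *)
Lemma abel_summation (a y : nat -> R) n : (0 < n)%N ->
  \sum_(1 <= k < n.+1) a k * y k =
  (\sum_(1 <= k < n.+1) a k) * y 1%N +
  \sum_(1 <= k < n) (\sum_(k.+1 <= j < n.+1) a j) * (y k.+1 - y k).
Proof.
elim: n => // -[_ _|n IH _].
  by rewrite !big_nat1 big_geq// addr0.
rewrite big_nat_recr//= IH// [in RHS]big_nat_recr//= [X in _ = _ + X]big_nat_recr//=.
rewrite big_nat1.
have -> : \sum_(1 <= k < n.+1) (\sum_(k.+1 <= j < n.+3) a j) * (y k.+1 - y k) =
    \sum_(1 <= k < n.+1) (\sum_(k.+1 <= j < n.+2) a j) * (y k.+1 - y k) +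
    a n.+2 * (y n.+1 - y 1%N).
  rewrite -(telescope_sumr y (isT : 0 < n.+1)%N) mulr_sumr -big_split/=.
  apply: eq_big_nat => k /andP[k1 kn].
  by rewrite big_nat_recr/= ?mulrDl// ltnS ltnW.
ring.
Qed.

(** Merges repeated times, as [LND] asks for strictly increasing ones. *)
Lemma sum_group_by (u : seq R) (l : seq (R * R)) (f : R -> R) : uniq u ->
  (forall p, p \in l -> p.2 \in u) ->
  \sum_(p <- l) p.1 * f p.2 = \sum_(q <- u) (\sum_(p <- l | p.2 == q) p.1) * f q.
Proof.
move=> uu lu; under [RHS]eq_bigr do rewrite mulr_suml big_mkcond/=.
rewrite exchange_big/= big_seq [RHS]big_seq; apply: eq_bigr => p pl.
rewrite (bigD1_seq p.2)//= ?lu// eqxx big1 ?addr0// => q /negPf.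
by rewrite eq_sym => ->.
Qed.

(** The constants of [LND] depend on the number of times, which varies after merging; minima over n
    <= N make them uniform. Of all the increments only the last is kept. *)
Lemma LND_last_gap (beta : R) N : LND P T X beta ->
  exists c delta : R, [/\ 0 < c, 0 < delta &
    forall n, (2 <= n <= N)%N ->
    forall (t : nat -> R) (v : nat -> 'rV[R]_d),
      (forall k, (1 <= k <= n)%N -> 0 <= t k <= T) ->
      (forall k, (1 <= k < n)%N -> t k < t k.+1) ->
      t n - t 1%N < delta ->
      ((c * (enorm (v n.-1) ^+ 2 * `|t n - t n.-1| `^ (2 * beta)))%:E <=
       'V_P[fun w => (\sum_(1 <= k < n) dot (v k) (X (t k.+1) w - X (t k) w))%R])%E].
Proof.
move=> lnd; elim: N => [|N [c [delta [c0 delta0 H]]]].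
  by exists 1, 1; split=> // n; case: n => // n; rewrite andbF.
have [N1|N2] := leqP N 0.
  by exists 1, 1; split=> // n /andP[n2 nN]; have := leq_trans n2 nN; rewrite ltnS ltnNge N1.
have [c' [delta' [c'0 delta'0 H']]] := lnd N.+1 N2.
exists (Num.min c c'), (Num.min delta delta'); split; rewrite ?lt_min ?c0 ?delta0//.
move=> n /andP[n2]; rewrite leq_eqVlt => /predU1P[->|nN] t v tT tlt; rewrite lt_min => /andP[td td'].
  have [S12 S23] := H' t v tT tlt td'.
  apply: le_trans (le_trans S23 S12); rewrite lee_fin.
  apply: (@le_trans _ _ (c' * (enorm (v N) ^+ 2 * `|t N.+1 - t N| `^ (2 * beta)))).
    by apply: ler_wpM2r; rewrite ?ge_min ?lexx ?orbT// mulr_ge0 ?sqr_ge0 ?powR_ge0.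
  rewrite ler_wpM2l ?(ltW c'0)// -(ltn_predK N2) [leRHS]big_nat_recr//=.
  rewrite lerDr; apply: sumr_ge0 => k _.
  by rewrite mulr_ge0 ?sqr_ge0 ?powR_ge0.
have nN' : (2 <= n <= N)%N by rewrite n2 -ltnS.
apply: le_trans (H n nN' t v tT tlt td); rewrite lee_fin.
by apply: ler_wpM2r; rewrite ?ge_min ?lexx// mulr_ge0 ?sqr_ge0 ?powR_ge0.
Qed.

(** The distinct times of [l] are sorted and [r] is put last. The coefficients have total zero, so
    Abel summation leaves increments, and the last one carries exactly [xi] because [r] does not
    occur in [l]. *)
Lemma LND_cos_le (beta : R) N : 0 < beta -> gaussian_process P T X ->
  LND P T X beta ->
  exists c delta : R, [/\ 0 < c, 0 < delta &
    forall xi l (r h th : R), 0 < h -> r <= T -> (size l < N)%N ->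
      \sum_(p <- l) p.1 = -1 ->
      (forall p, p \in l -> [/\ 0 <= p.2, p.2 <= r - h & r - p.2 < delta]) ->
      `|\int[P]_w cos (lincomb xi ((1, r) :: l) w + th)| <=
      expR (- (c * h `^ (2 * beta) * dot xi xi / 2))].
Proof.
move=> beta0 gX /(LND_last_gap N)[c [delta [c0 delta0 H]]].
exists c, delta; split=> // xi l r h th h0 rT lN l1 lr.
pose u := sort <=%R (undup (map snd l)).
have uE q : (q \in u) = (q \in map snd l) by rewrite mem_sort mem_undup.
have uP q : q \in u -> [/\ 0 <= q, q <= r - h & r - q < delta].
  by rewrite uE => /mapP[p /lr + ->].
have ltu q : q \in u -> q < r.
  by move=> /uP[_ qr _]; rewrite (le_lt_trans qr)// ltrBlDr ltrDl.
pose u' := rcons u r.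
have uu' : uniq u'.
  rewrite rcons_uniq sort_uniq undup_uniq andbT; apply/negP => /ltu.
  by rewrite ltxx.
have su' : sorted <%R u'.
  rewrite sorted_pairwise ?pairwise_rcons; last exact: lt_trans.
  apply/andP; split; first by apply/allP => q /ltu.
  rewrite -sorted_pairwise; last exact: lt_trans.
  by rewrite lt_sorted_uniq_le sort_uniq undup_uniq sort_sorted//; exact: le_total.
pose m := size u.
(* The coefficients add up to -1, so [l] is nonempty and [LND] has its two times. *)
have m0 : (0 < m)%N.
  rewrite /m size_sort; case: l l1 {lN lr u uE uP ltu u' uu' su' m} => [|p l _].
    by rewrite big_nil => /esym/eqP; rewrite oppr_eq0 oner_eq0.
  by rewrite -has_predT; apply/hasP; exists p.2 => //; rewrite mem_undup inE eqxx.
have mN : (m < N)%N.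
  rewrite (leq_ltn_trans _ lN)// /m size_sort.
  by rewrite (leq_trans (size_undup _))// size_map.
pose t k := nth 0 u' k.-1.
have tE k : (1 <= k <= m)%N -> t k = nth 0 u k.-1.
  by case: k => // k /andP[_ km]; rewrite /t nth_rcons km.
have tu k : (1 <= k <= m)%N -> t k \in u.
  by move=> km; rewrite tE// mem_nth//; case: k km.
have tm : t m.+1 = r by rewrite /t nth_rcons ltnn eqxx.
have tT k : (1 <= k <= m.+1)%N -> 0 <= t k <= T.
  move=> /andP[k1]; rewrite leq_eqVlt => /predU1P[->|km].
    have /uP[q0 qr _] := tu 1%N m0; rewrite tm rT andbT.
    by rewrite (le_trans q0)// (le_trans qr)// lerBlDr lerDl ltW.
  have /uP[q0 qr _] := tu k (introT andP (conj k1 km)).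
  by rewrite q0 (le_trans qr)// lerBlDr (le_trans rT)// lerDl ltW.
have tlt k : (1 <= k < m.+1)%N -> t k < t k.+1.
  case: k => // k /andP[_ km].
  by rewrite /t (sorted_ltn_nth lt_trans)// ?inE ?size_rcons//= ltnW.
have td : t m.+1 - t 1%N < delta by rewrite tm; have /uP[] := tu 1%N m0.
pose l' := (1 : R, r) :: l.
pose a k : R := \sum_(p <- l' | p.2 == t k) p.1.
pose v k := (\sum_(k.+1 <= j < m.+2) a j) *: xi.
have lu' p : p \in l' -> p.2 \in u'.
  rewrite inE => /predU1P[->|pl]; first by rewrite mem_rcons inE eqxx.
  by rewrite mem_rcons inE uE map_f ?orbT.
have sumE (f : R -> R) : \sum_(p <- l') p.1 * f p.2 = \sum_(1 <= k < m.+2) a k * f (t k).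
  rewrite (sum_group_by f uu' lu') (big_nth 0) size_rcons big_add1/=.
  exact: eq_big_nat.
have a0 : \sum_(1 <= k < m.+2) a k = 0.
  have := sumE (fun=> 1); rewrite -!mulr_suml !mulr1 => <-.
  by rewrite big_cons l1 subrr.
have am : a m.+1 = 1.
  rewrite /a tm big_cons eqxx big_seq_cond big1 ?addr0// => p /andP[pl /eqP pr].
  have : p.2 \in u by rewrite uE map_f.
  by move=> /ltu; rewrite pr ltxx.
have lE w : lincomb xi l' w =
    \sum_(1 <= k < m.+1) dot (v k) (X (t k.+1) w - X (t k) w).
  rewrite /lincomb (sumE (fun q => dot xi (X q w))) abel_summation// a0 mul0r add0r.
  by apply: eq_bigr => k _; rewrite dotZl dotBr.
apply: gaussian_cos_le_variance.
  apply: gaussian_lincomb => // p pl.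
  have := lu' _ pl => /(nthP 0)[k]; rewrite size_rcons => km <-.
  exact: (tT k.+1).
rewrite (_ : lincomb xi _ = (fun w => \sum_(1 <= k < m.+1) dot (v k) (X (t k.+1) w - X (t k) w))); last by apply/funext => w; exact: lE.
apply: le_trans (H m.+1 _ t v tT tlt td); last by rewrite ltnS m0.
rewrite lee_fin -mulrA ler_wpM2l ?(ltW c0)//= mulrC.
have -> : v m = xi by rewrite /v big_nat1 am scale1r.
rewrite enorm_sqr ler_wpM2l ?dot_ge0// tm.
have /uP[_ qr _] := tu m (introT andP (conj m0 (leqnn m))).
have hm : h <= r - t m by rewrite lerBrDr addrC -lerBrDr.
rewrite ge0_ler_powR ?nnegrE ?mulr_ge0 ?(ltW h0)//; first exact: ltW.
by rewrite ger0_norm// (le_trans (ltW h0)).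
Qed.

End Combinations.

End ConditionalVariance.

(** * Moments of trigonometric sums *)

(** One step of [moment_recursion]: with [x = |A|^2] and [a = <A, c>], the number
    [x + 2 a + f] is [|A + c|^2], and only the term linear in [a] may grow faster
    than [x ^+ m]; its expectation is small. *)
Lemma expr_incr_le (R : realType) (m : nat) : exists2 C : R, 0 <= C &
  forall x a f : R, 0 <= x -> a ^+ 2 <= 2 * x -> 0 <= f <= 2 -> 0 <= x + 2 * a + f ->
  (x + 2 * a + f) ^+ m.+1 <=
  x ^+ m.+1 + 2 * m.+1%:R * (x ^+ m * a) + C * (x ^+ m + 1).
Proof.
elim: m => [|m [C C0 IH]].
  exists 2 => // x a f x0 ax /andP[f0 f2] y0.
  by rewrite !expr1 expr0 mulr1 mul1r; lra.
exists (2 + 20 * m.+1%:R + 20 * C) => [|x a f x0 ax f02 y0].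
  by rewrite !addr_ge0 ?mulr_ge0.
have /andP[f0 f2] := f02.
have := ler_wpM2r y0 (IH x a f x0 ax f02 y0); rewrite -exprSr => /le_trans; apply.
rewrite (exprS x m.+1) (exprS x m) -[m.+2%:R]natr1.
have M0 : (0 : R) <= m.+1%:R by [].
move: (m.+1%:R) M0 => M M0.
have h0 : 0 <= x ^+ m by exact: exprn_ge0.
have h1 : x ^+ m <= x * x ^+ m + 1.
  have [x1|x1] := leP x 1; first by apply: (@le_trans _ _ 1); [exact: exprn_ile1|rewrite lerDr mulr_ge0].
  by rewrite (@le_trans _ _ (x * x ^+ m))// ?ler_peMl ?(ltW x1)// lerDl.
have h2 : x <= x * x ^+ m + 1.
  have [x1|x1] := leP x 1; first by rewrite (le_trans x1)// lerDr mulr_ge0.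
  by rewrite (@le_trans _ _ (x * x ^+ m))// ?lerDl// ler_peMr// exprn_ege1// ltW.
move: (x ^+ m) h0 h1 h2 => z z0 h1 h2.
have y3 : x + 2 * a + f <= 3 * (x + 1).
  have : 2 * a <= a ^+ 2 + 1 by have := sqr_ge0 (a - 1); rewrite sqrrB; lra.
  by lra.
have e1 : (x * z + 2 * M * (z * a) + C * (z + 1)) * (x + 2 * a + f) =
  x * (x * z) + 2 * x * z * a + f * (x * z) + 2 * M * (x * z * a) +
  4 * M * (z * a ^+ 2) + 2 * M * z * (a * f) + C * ((z + 1) * (x + 2 * a + f)) by ring.
rewrite e1.
have b1 : f * (x * z) <= 2 * (x * z) by rewrite ler_wpM2r// mulr_ge0.
have b2 : 4 * M * (z * a ^+ 2) <= 8 * M * (x * z).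
  have -> : 8 * M * (x * z) = 4 * M * (z * (2 * x)) by ring.
  by rewrite ler_wpM2l ?mulr_ge0// ler_wpM2l.
have b3 : 2 * M * z * (a * f) <= 2 * M * (z * (x + 2)).
  rewrite -mulrA ler_wpM2l ?mulr_ge0// ler_wpM2l//.
  have : 2 * (a * f) <= a ^+ 2 + f ^+ 2 by have := sqr_ge0 (a - f); rewrite sqrrB; lra.
  have : f ^+ 2 <= 4 by nra.
  by lra.
have b4 : C * ((z + 1) * (x + 2 * a + f)) <= C * (12 * (x * z + 1)).
  rewrite ler_wpM2l//.
  apply: (@le_trans _ _ ((z + 1) * (3 * (x + 1)))); last by nra.
  by rewrite ler_wpM2l// addr_ge0.
have b5 : M * z <= M * (x * z + 1) by rewrite ler_wpM2l.
have b6 : 0 <= x * z by rewrite mulr_ge0.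
have b7 : 0 <= M * (x * z) by rewrite mulr_ge0.
have b8 : 0 <= C * (x * z) by rewrite mulr_ge0.
nra.
Qed.

Section Moments.
Context {R : realType} {dO : measure_display} {Omega : measurableType dO}.
Variable P : probability Omega R.
Implicit Types f g : Omega -> R.

Definition bounded_rv f :=
  measurable_fun setT f /\ exists M : R, forall w, `|f w| <= M.

Lemma bounded_rv_integrable f : bounded_rv f -> P.-integrable setT (EFin \o f).
Proof.
move=> [mf [M fM]]; apply: (@integrable_bounded _ _ _ _ _ M) => //.
by rewrite (le_lt_trans (probability_le1 _ _)) ?ltry.
Qed.

Lemma bounded_rv_cst (c : R) : bounded_rv (fun=> c).
Proof. by split => //; exists `|c|. Qed.

Lemma bounded_rvD f g : bounded_rv f -> bounded_rv g ->
  bounded_rv (fun w => f w + g w).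
Proof.
move=> [mf [M fM]] [mg [M' gM]]; split; first exact: measurable_funD.
by exists (M + M') => w; rewrite (le_trans (ler_normD _ _))// lerD.
Qed.

Lemma bounded_rvM f g : bounded_rv f -> bounded_rv g ->
  bounded_rv (fun w => f w * g w).
Proof.
move=> [mf [M fM]] [mg [M' gM]]; split; first exact: measurable_funM.
by exists (M * M') => w; rewrite normrM ler_pM.
Qed.

Lemma bounded_rvX f n : bounded_rv f -> bounded_rv (fun w => f w ^+ n).
Proof.
move=> bf; elim: n => [|n IH]; first exact: bounded_rv_cst.
by under eq_fun do rewrite exprS; exact: bounded_rvM.
Qed.

Lemma bounded_rv_sum (I : Type) (r : seq I) (F : I -> Omega -> R) :
  (forall i, bounded_rv (F i)) -> bounded_rv (fun w => \sum_(i <- r) F i w).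
Proof.
move=> bF; elim: r => [|i r IH].
  by under eq_fun do rewrite big_nil; exact: bounded_rv_cst.
by under eq_fun do rewrite big_cons; exact: bounded_rvD.
Qed.

Lemma bounded_rv_cos f : measurable_fun setT f -> bounded_rv (fun w => cos (f w)).
Proof.
move=> mf; split; last by exists 1 => w; rewrite ler_norml cos_geN1 cos_le1.
exact: measurableT_comp (continuous_measurable_fun (@continuous_cos R)) mf.
Qed.

Lemma bounded_rv_sin f : measurable_fun setT f -> bounded_rv (fun w => sin (f w)).
Proof.
move=> mf; split; last by exists 1 => w; rewrite ler_norml sin_geN1 sin_le1.
exact: measurableT_comp (continuous_measurable_fun (@continuous_sin R)) mf.
Qed.

(** With X = A^2 + B^2, [expr_incr_le] bounds the growth of E X^(m+1) in one step by the cross term,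
    bounded by hypothesis, plus C (E X^m + 1), of order N^m by induction on the exponent. At most N
    steps give N^(m+1). *)
Lemma moment_recursion (m : nat) : exists2 K : R, 0 <= K &
  forall (A B c s : nat -> Omega -> R) (N : nat), (0 < N)%N ->
  (forall j, bounded_rv (c j)) -> (forall j, bounded_rv (s j)) ->
  (forall j w, `|c j w| <= 1) -> (forall j w, `|s j w| <= 1) ->
  (forall w, A 0%N w = 0) -> (forall w, B 0%N w = 0) ->
  (forall j w, A j.+1 w = A j w + c j w) ->
  (forall j w, B j.+1 w = B j w + s j w) ->
  (forall m' j, (m' < m)%N -> (j < N)%N ->
    \int[P]_w ((A j w ^+ 2 + B j w ^+ 2) ^+ m' * (A j w * c j w + B j w * s j w)) <= 1) ->
  forall j, (j <= N)%N ->
  \int[P]_w ((A j w ^+ 2 + B j w ^+ 2) ^+ m) <= K * N%:R ^+ m.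
Proof.
elim: m => [|m [K K0 IH]].
  exists 1 => // A B c s N N0 bc bs c1 s1 A0 B0 AS BS H j jN.
  by under eq_Rintegral do rewrite expr0; rewrite Rintegral_prob_cst expr0 mulr1.
have [C C0 CP] := expr_incr_le R m.
pose L := 2 * m.+1%:R + C * (K + 1).
have L0 : 0 <= L by rewrite addr_ge0 ?mulr_ge0 ?addr_ge0.
exists L => // A B c s N N0 bc bs c1 s1 A0 B0 AS BS H j jN.
have N1 : (1 : R) <= N%:R ^+ m by rewrite exprn_ege1// ler1n.
pose X j w := A j w ^+ 2 + B j w ^+ 2.
pose a j w := A j w * c j w + B j w * s j w.
have bA i : bounded_rv (A i).
  elim: i => [|i IHi].
    by rewrite (_ : A 0%N = fun=> 0); [exact: bounded_rv_cst|exact/funext].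
  by rewrite (_ : A i.+1 = fun w => A i w + c i w); [exact: bounded_rvD|exact/funext].
have bB i : bounded_rv (B i).
  elim: i => [|i IHi].
    by rewrite (_ : B 0%N = fun=> 0); [exact: bounded_rv_cst|exact/funext].
  by rewrite (_ : B i.+1 = fun w => B i w + s i w); [exact: bounded_rvD|exact/funext].
have bX i n : bounded_rv (fun w => X i w ^+ n).
  by apply: bounded_rvX; apply: bounded_rvD; exact: bounded_rvX.
have ba i : bounded_rv (a i) by apply: bounded_rvD; exact: bounded_rvM.
suff : \int[P]_w (X j w ^+ m.+1) <= j%:R * (L * N%:R ^+ m).
  move=> /le_trans; apply; rewrite exprS mulrCA ler_wpM2l//.
  by rewrite ler_wpM2r ?ler_nat// (le_trans _ N1).
elim: j jN => [_|j IHj jN].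
  under eq_Rintegral do rewrite /X A0 B0 expr0n addr0 expr0n/=.
  by rewrite Rintegral_prob_cst mul0r.
have step : \int[P]_w (X j.+1 w ^+ m.+1) <=
    \int[P]_w (X j w ^+ m.+1 + (2 * m.+1%:R * (X j w ^+ m * a j w) + C * (X j w ^+ m + 1))).
  apply: le_Rintegral => //.
  - exact: bounded_rv_integrable.
  - apply: bounded_rv_integrable; apply: bounded_rvD => //.
    apply: bounded_rvD; (apply: bounded_rvM; first exact: bounded_rv_cst).
      exact: bounded_rvM.
    by apply: bounded_rvD => //; exact: bounded_rv_cst.
  - move=> w _; rewrite addrA.
    have XS : X j.+1 w = X j w + 2 * a j w + (c j w ^+ 2 + s j w ^+ 2).
      by rewrite /X /a AS BS; ring.
    rewrite XS; have := c1 j w; have := s1 j w; rewrite !ler_norml => /andP[s1' s2'] /andP[c1' c2'].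
    have cc : c j w ^+ 2 <= 1 by nra.
    have ss : s j w ^+ 2 <= 1 by nra.
    apply: CP.
    + by rewrite addr_ge0 ?sqr_ge0.
    + rewrite /a /X.
      (* Cauchy-Schwarz through Lagrange's identity. *)
      apply: (@le_trans _ _ ((A j w ^+ 2 + B j w ^+ 2) * (c j w ^+ 2 + s j w ^+ 2))).
        rewrite -subr_ge0 (_ : _ - _ = (A j w * s j w - B j w * c j w) ^+ 2) ?sqr_ge0//; ring.
      by rewrite mulrC ler_wpM2r ?addr_ge0 ?sqr_ge0//; lra.
    + by rewrite addr_ge0 ?sqr_ge0//=; lra.
    + by rewrite -XS addr_ge0 ?sqr_ge0.
apply: (le_trans step).
have iX n := bounded_rv_integrable (bX j n).
have iXa := bounded_rv_integrable (bounded_rvM (bX j m) (ba j)).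
have i1 := bounded_rv_integrable (bounded_rvD (bX j m) (bounded_rv_cst 1)).
have i2 := integrable_EFinZ (2 * m.+1%:R) measurableT iXa.
have i3 := integrable_EFinZ C measurableT i1.
rewrite (RintegralD measurableT (iX m.+1) (integrable_EFinD measurableT i2 i3)).
rewrite (RintegralD measurableT i2 i3) (RintegralZl _ measurableT iXa) (RintegralZl _ measurableT i1).
rewrite (RintegralD measurableT (iX m) (bounded_rv_integrable (bounded_rv_cst 1))) Rintegral_prob_cst.
have -> : j.+1%:R * (L * N%:R ^+ m) = j%:R * (L * N%:R ^+ m) + L * N%:R ^+ m.
  by rewrite -natr1 mulrDl mul1r.
rewrite lerD//; first exact/IHj/ltnW.
have Hj : \int[P]_w (X j w ^+ m * a j w) <= 1 by apply: H.
have Xm : \int[P]_w (X j w ^+ m) <= K * N%:R ^+ m.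
  apply: (IH A B c s N) => // [m' j' mm' jj'|]; last exact: ltnW.
  by apply: H => //; exact: ltnW.
have M0 : 0 <= 2 * m.+1%:R :> R by rewrite mulr_ge0.
rewrite /L; move: (2 * _) (N%:R ^+ m) N1 M0 Hj Xm => M n n1 M0.
move: (Rintegral _ _ _) (Rintegral _ _ _) => I1 I2 Hj Xm.
apply: (@le_trans _ _ (M * n + C * (K * n + n))).
  by rewrite lerD// ler_wpM2l// ?(le_trans Hj)// lerD.
by rewrite le_eqVlt; apply/orP; left; apply/eqP; ring.
Qed.

(** The real part of |sum_p exp (i y_p)|^2 exp (i z), expanded as a double sum. *)
Lemma sqr_cos_sum (I : Type) (u : seq I) (y : I -> R) (z : R) :
  ((\sum_(p <- u) cos (y p)) ^+ 2 + (\sum_(p <- u) sin (y p)) ^+ 2) * cos z =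
  \sum_(p <- u) \sum_(p' <- u) cos (z + (y p - y p')).
Proof.
set C := \sum_(p <- u) cos (y p); set S := \sum_(p <- u) sin (y p).
under eq_bigr => p _.
  under eq_bigr => p' _ do rewrite cosD cosB sinB.
  rewrite (_ : \sum_(p' <- u) _ =
    cos z * (cos (y p) * C + sin (y p) * S) - sin z * (sin (y p) * C - cos (y p) * S)).
    over.
  rewrite /C /S !mulr_sumr -big_split/= -sumrB !mulr_sumr -sumrB.
  by apply: eq_bigr => p' _; ring.
rewrite sumrB -!mulr_sumr big_split/= sumrB -!mulr_suml -/C -/S.
ring.
Qed.

(** The real part of the sum of exp (i y) over [v] times the conjugate of the sum over [u]. *)
Lemma cos_sum_prod (I : Type) (u v : seq I) (y : I -> R) :
  (\sum_(p <- u) cos (y p)) * (\sum_(p <- v) cos (y p)) +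
  (\sum_(p <- u) sin (y p)) * (\sum_(p <- v) sin (y p)) =
  \sum_(t <- v) \sum_(p <- u) cos (y t - y p).
Proof.
rewrite mulr_sumr [X in _ + X]mulr_sumr -big_split/=; apply: eq_bigr => t _.
rewrite !mulr_suml -big_split/=; apply: eq_bigr => p _.
by rewrite cosB; ring.
Qed.

Lemma ler_norm_sum_size (I : eqType) (u : seq I) (f : I -> R) (K : R) :
  (forall p, p \in u -> `|f p| <= K) ->
  `|\sum_(p <- u) f p| <= (size u)%:R * K.
Proof.
move=> fK; rewrite big_seq (le_trans (ler_norm_sum _ _ _))//.
rewrite (le_trans (ler_sum _ fK))// -big_seq big_const_seq count_predT iter_addr_0.
by rewrite mulr_natl.
Qed.

Section Trig.
Variable Y : R -> Omega -> R.
Hypothesis mY : forall p, measurable_fun setT (Y p).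
Implicit Types (u v : seq R) (l : seq (R * R)).

Let trig l (w : Omega) : R := \sum_(p <- l) p.1 * Y p.2 w.
Let X u w : R := (\sum_(p <- u) cos (Y p w)) ^+ 2 + (\sum_(p <- u) sin (Y p w)) ^+ 2.

Let mtrig l : measurable_fun setT (trig l).
Proof.
elim: l => [|p l IH]; rewrite /trig; first by under eq_fun do rewrite big_nil; exact: measurable_cst.
under eq_fun do rewrite big_cons.
by apply: measurable_funD => //; exact: measurable_funM.
Qed.

Let bX u m : bounded_rv (fun w => X u w ^+ m).
Proof.
apply: bounded_rvX; apply: bounded_rvD; apply: bounded_rvX; apply: bounded_rv_sum => p.
  exact: bounded_rv_cos.
exact: bounded_rv_sin.
Qed.

(** Each factor |sum_u exp (i Y)|^2 prepends to [l] two times from [u] with coefficients 1 and -1.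
    The total -1 is kept, the length grows by two, and the number of pairs costs (size u)^2. *)
Lemma trig_moment_le (n : nat) (eta : R) u (t : R) : 0 <= eta ->
  (forall l, (size l <= n)%N -> \sum_(p <- l) p.1 = -1 ->
    (forall p, p \in l -> p.2 \in u) ->
    `|\int[P]_w cos (trig ((1, t) :: l) w)| <= eta) ->
  forall m l, (size l + 2 * m <= n)%N -> \sum_(p <- l) p.1 = -1 ->
    (forall p, p \in l -> p.2 \in u) ->
    `|\int[P]_w (X u w ^+ m * cos (trig ((1, t) :: l) w))| <= (size u)%:R ^+ (2 * m) * eta.
Proof.
move=> eta0 H; elim=> [|m IH] l ln l1 lu.
  rewrite muln0 expr0 mul1r; under eq_Rintegral do rewrite expr0 mul1r.
  by apply: H => //; rewrite (leq_trans _ ln)// leq_addr.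
have E w : X u w ^+ m.+1 * cos (trig ((1, t) :: l) w) =
    \sum_(p <- u) \sum_(p' <- u)
      X u w ^+ m * cos (trig [:: (1, t), (1, p), (-1, p') & l] w).
  rewrite exprSr -mulrA {2}/X (sqr_cos_sum u (fun p => Y p w)) mulr_sumr.
  apply: eq_bigr => p _; rewrite mulr_sumr; apply: eq_bigr => p' _.
  congr (_ * cos _); rewrite /trig !big_cons/=; ring.
under eq_Rintegral do rewrite E.
have bb l' : P.-integrable setT (EFin \o (fun w => X u w ^+ m * cos (trig l' w))).
  by apply: bounded_rv_integrable; apply: bounded_rvM => //; exact: bounded_rv_cos.
rewrite Rintegral_sum//; last by move=> p; exact: integrable_EFin_sum.
rewrite mulnS exprD -mulrA expr2 -mulrA; apply: ler_norm_sum_size => p pu.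
rewrite Rintegral_sum//; apply: ler_norm_sum_size => p' pu'.
apply: IH.
- by rewrite /= !addSn (leq_trans _ ln)// mulnS addnCA.
- by rewrite !big_cons/= addNKr.
- move=> p''; rewrite !inE => /or3P[/eqP->|/eqP->|]//; exact: lu.
Qed.

(** The product of the sums consists of cosines of Y_t - Y_p, so [trig_moment_le] starts from a list
    with the single entry (-1, p); this entry accounts for 2 m < n. *)
Lemma trig_cross_moment_le (n m : nat) (eta : R) u v : 0 <= eta ->
  (forall t, t \in v -> forall l, (size l <= n)%N -> \sum_(p <- l) p.1 = -1 ->
    (forall p, p \in l -> p.2 \in u) ->
    `|\int[P]_w cos (trig ((1, t) :: l) w)| <= eta) ->
  (2 * m < n)%N ->
  `|\int[P]_w (X u w ^+ m *
     ((\sum_(p <- u) cos (Y p w)) * (\sum_(p <- v) cos (Y p w)) +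
      (\sum_(p <- u) sin (Y p w)) * (\sum_(p <- v) sin (Y p w))))| <=
  (size v)%:R * ((size u)%:R * ((size u)%:R ^+ (2 * m) * eta)).
Proof.
move=> eta0 H mn.
have E w : X u w ^+ m *
     ((\sum_(p <- u) cos (Y p w)) * (\sum_(p <- v) cos (Y p w)) +
      (\sum_(p <- u) sin (Y p w)) * (\sum_(p <- v) sin (Y p w))) =
    \sum_(t <- v) \sum_(p <- u) X u w ^+ m * cos (trig [:: (1, t); (-1, p)] w).
  rewrite (cos_sum_prod u v (fun p => Y p w)) mulr_sumr.
  apply: eq_bigr => t _; rewrite mulr_sumr; apply: eq_bigr => p _.
  by congr (_ * cos _); rewrite /trig !big_cons big_nil/=; ring.
under eq_Rintegral do rewrite E.
have bb l' : P.-integrable setT (EFin \o (fun w => X u w ^+ m * cos (trig l' w))).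
  by apply: bounded_rv_integrable; apply: bounded_rvM => //; exact: bounded_rv_cos.
rewrite Rintegral_sum//; last by move=> p; exact: integrable_EFin_sum.
apply: ler_norm_sum_size => t tv.
rewrite Rintegral_sum//; apply: ler_norm_sum_size => p pu.
apply: (trig_moment_le eta0 (H t tv)) => //.
  by rewrite big_seq1.
by move=> p'; rewrite inE => /eqP ->.
Qed.

Fixpoint concat_blocks (r : nat -> seq R) (j : nat) : seq R :=
  if j is j'.+1 then concat_blocks r j' ++ r j' else [::].

Lemma size_concat_blocks r q j : (forall j, size (r j) = q) ->
  size (concat_blocks r j) = (j * q)%N.
Proof. by move=> rq; elim: j => //= j IH; rewrite size_cat IH rq mulSn addnC. Qed.

Lemma mem_concat_blocks r j p : p \in concat_blocks r j ->
  exists2 i, (i < j)%N & p \in r i.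
Proof.
elim: j => //= j IH; rewrite mem_cat => /orP[/IH[i ij pi]|pj].
  by exists i => //; exact: ltnW.
by exists j.
Qed.

End Trig.

(** Averaging over the [q] points of a cell keeps the increments at most 1, and [K] is independent
    of [q], so the mesh can later tend to 0. The smallness of [eta] against N^(2n) makes every cross
    term at most 1. *)
Lemma block_moment_le (n : nat) : exists2 K : R, 0 <= K &
  forall (Y : R -> Omega -> R) (r : nat -> seq R) (q N : nat) (eta : R),
  (forall p, measurable_fun setT (Y p)) ->
  (0 < q)%N -> (0 < N)%N -> (forall j, size (r j) = q) ->
  0 <= eta -> N%:R ^+ (2 * n) * eta <= 1 ->
  (forall j t l, (j < N)%N -> t \in r j -> (size l <= 2 * n)%N ->
    \sum_(p <- l) p.1 = -1 ->
    (forall p, p \in l -> p.2 \in concat_blocks r j) ->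
    `|\int[P]_w cos (\sum_(p <- (1, t) :: l) p.1 * Y p.2 w)| <= eta) ->
  \int[P]_w (((q%:R^-1 * \sum_(p <- concat_blocks r N) cos (Y p w)) ^+ 2 +
              (q%:R^-1 * \sum_(p <- concat_blocks r N) sin (Y p w)) ^+ 2) ^+ n)
  <= K * N%:R ^+ n.
Proof.
have [K K0 HK] := moment_recursion n; exists K => // Y r q N eta mY q0 N0 rq eta0 Neta H.
have qr0 : (0 : R) < q%:R by rewrite ltr0n.
pose A j w := q%:R^-1 * \sum_(p <- concat_blocks r j) cos (Y p w).
pose B j w := q%:R^-1 * \sum_(p <- concat_blocks r j) sin (Y p w).
pose c j w := q%:R^-1 * \sum_(p <- r j) cos (Y p w).
pose s j w := q%:R^-1 * \sum_(p <- r j) sin (Y p w).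
have avg (f : R -> R) j : (forall p, `|f p| <= 1) -> `|q%:R^-1 * \sum_(p <- r j) f p| <= 1.
  move=> f1; rewrite normrM gtr0_norm ?invr_gt0// ler_pdivrMl// mulr1.
  by rewrite (le_trans (ler_norm_sum_size (K := 1) _))// ?rq ?mulr1.
apply: (HK A B c s N) => //.
- move=> j; apply: bounded_rvM; first exact: bounded_rv_cst.
  by apply: bounded_rv_sum => p; exact: bounded_rv_cos.
- move=> j; apply: bounded_rvM; first exact: bounded_rv_cst.
  by apply: bounded_rv_sum => p; exact: bounded_rv_sin.
- by move=> j w; apply: avg => p; rewrite ler_norml cos_geN1 cos_le1.
- by move=> j w; apply: avg => p; rewrite ler_norml sin_geN1 sin_le1.
- by move=> w; rewrite /A big_nil mulr0.
- by move=> w; rewrite /B big_nil mulr0.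
- by move=> j w; rewrite /A /= big_cat mulrDr.
- by move=> j w; rewrite /B /= big_cat mulrDr.
move=> m j mn jN.
pose u := concat_blocks r j; pose v := r j.
pose Q w := ((\sum_(p <- u) cos (Y p w)) ^+ 2 + (\sum_(p <- u) sin (Y p w)) ^+ 2) ^+ m *
     ((\sum_(p <- u) cos (Y p w)) * (\sum_(p <- v) cos (Y p w)) +
      (\sum_(p <- u) sin (Y p w)) * (\sum_(p <- v) sin (Y p w))).
have bsum (w : seq R) : bounded_rv (fun x => \sum_(p <- w) cos (Y p x)) /\
    bounded_rv (fun x => \sum_(p <- w) sin (Y p x)).
  by split; apply: bounded_rv_sum => p; [exact: bounded_rv_cos|exact: bounded_rv_sin].
have bQ : bounded_rv Q.
  have [u1 u2] := bsum u; have [v1 v2] := bsum v.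
  apply: bounded_rvM; first by apply/bounded_rvX/bounded_rvD; exact: bounded_rvX.
  by apply: bounded_rvD; exact: bounded_rvM.
have E w : (A j w ^+ 2 + B j w ^+ 2) ^+ m * (A j w * c j w + B j w * s j w) =
    q%:R^-1 ^+ (2 * m).+2 * Q w.
  rewrite /A /B /c /s /Q -/u -/v.
  rewrite [X in _ = X * _](_ : _ = (q%:R^-1 ^+ 2) ^+ m * q%:R^-1 ^+ 2); last first.
    by rewrite -exprM -exprD addn2.
  rewrite [RHS]mulrACA -[X in _ = X * _]exprMn; congr (_ ^+ _ * _); ring.
under eq_Rintegral do rewrite E.
rewrite RintegralZl//; last exact: bounded_rv_integrable.
have mn2 : (2 * m < 2 * n)%N by rewrite ltn_mul2l.
have Hv t : t \in v -> forall l, (size l <= 2 * n)%N -> \sum_(p <- l) p.1 = -1 ->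
    (forall p, p \in l -> p.2 \in u) ->
    `|\int[P]_w cos (\sum_(p <- (1, t) :: l) p.1 * Y p.2 w)| <= eta.
  by move=> tv l ln l1 lu; exact: (H j).
have := trig_cross_moment_le mY eta0 Hv mn2.
rewrite -/(Q _) /u (size_concat_blocks j rq) /v rq => HQ.
rewrite (le_trans (ler_norm _))// normrM ger0_norm ?exprn_ge0 ?invr_ge0 ?ler0n//.
apply: le_trans (ler_wpM2l _ HQ) _; first by rewrite exprn_ge0 ?invr_ge0 ?ler0n.
(* All powers of [q] cancel, and j^(2m+1) <= N^(2n) since m < n and j < N. *)
have -> : q%:R^-1 ^+ (2 * m).+2 * (q%:R * ((j * q)%:R * ((j * q)%:R ^+ (2 * m) * eta))) =
    j%:R ^+ (2 * m).+1 * eta.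
  rewrite natrM exprVn !exprMn [X in X^-1]exprS [X in (_ * X)^-1]exprS exprS.
  by field; rewrite !(expf_neq0, gt_eqF).
apply: le_trans Neta; rewrite ler_wpM2r//.
have j1 : (j%:R : R) <= N%:R by rewrite ler_nat ltnW.
apply: (@le_trans _ _ (N%:R ^+ (2 * m).+1)); first by rewrite lerXn2r ?nnegrE.
by rewrite ler_weXn2l ?ler1n.
Qed.

End Moments.

(** * Oscillatory integrals along a path *)

Section Paths.
Context {R : realType}.
Notation mu := (@lebesgue_measure R).

Lemma ler_norm_cosB (a b : R) : `|cos a - cos b| <= `|a - b|.
Proof.
wlog ab : a b / a < b.
  move=> H; have [/H//|/H|->] := ltgtP a b; last by rewrite !subrr.
  by rewrite distrC [leRHS]distrC.
have dcos x : x \in `]a, b[ -> is_derive x 1 (@cos R) (- sin x).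
  by move=> _; exact: is_derive_cos.
have ccos : {within `[a, b], continuous (@cos R)}.
  by apply: continuous_subspaceT; exact: continuous_cos.
have [c _] := MVT ab dcos ccos.
rewrite distrC => ->; rewrite [leRHS]distrC normrM normrN.
by rewrite ler_piMl// ler_norml sin_geN1 sin_le1.
Qed.

Lemma ler_norm_sinB (a b : R) : `|sin a - sin b| <= `|a - b|.
Proof.
by rewrite -!cosBpihalf (le_trans (ler_norm_cosB _ _))// opprB addrA subrK.
Qed.

Section BoundedIntegrand.
Variables (T : R) (f : R -> R).
Hypothesis mf : measurable_fun `[0, T] f.
Hypothesis f1 : forall x, `|f x| <= 1.

Lemma integrable_unit_itv (s t : R) : 0 <= s -> t <= T ->
  mu.-integrable `[s, t] (EFin \o f).
Proof.
move=> s0 tT; apply: (@integrable_bounded _ _ _ _ _ 1) => //.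
  by rewrite /= lebesgue_measure_itv/=; case: ifPn => //; rewrite -EFinD ltry.
apply: measurable_funS mf => //.
by apply: subset_itv; rewrite bnd_simp.
Qed.

Lemma ler_norm_Rintegral_itv (s t : R) : 0 <= s -> s <= t -> t <= T ->
  `|\int[mu]_(x in `[s, t]) f x| <= t - s.
Proof.
move=> s0 st tT; have fi := integrable_unit_itv s0 tT.
rewrite (le_trans (le_normr_Rintegral _ fi))//.
apply: (@le_trans _ _ (\int[mu]_(x in `[s, t]) 1)).
  apply: le_Rintegral => //; first exact: (integrable_norm fi).
  apply: (@integrable_bounded _ _ _ _ _ 1) => //.
    by rewrite /= lebesgue_measure_itv/=; case: ifPn => //; rewrite -EFinD ltry.
  by move=> x _; rewrite normr1.
rewrite Rintegral_cst//= mul1r lebesgue_measure_itv/= lte_fin.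
by case: ltP => //= ts; rewrite subr_ge0.
Qed.

Lemma Rintegral_itv_split (s u t : R) : 0 <= s -> s <= u -> u <= t -> t <= T ->
  \int[mu]_(x in `[s, t]) f x =
  \int[mu]_(x in `[s, u]) f x + \int[mu]_(x in `[u, t]) f x.
Proof.
move=> s0 su ut tT; have fi := integrable_unit_itv s0 tT.
have := Rintegral_itvB fi (x := u); rewrite !bnd_simp => /(_ su ut) E.
rewrite -(@Rintegral_itv_obnd_cbnd _ u (BRight t)) -?E; first by rewrite addrC subrK.
by apply: integrableS fi => //; apply: subset_itv; rewrite bnd_simp.
Qed.

Lemma Rintegral_itv_near (s t s' t' tau : R) :
  0 <= s' -> s' <= s -> s <= t -> s' <= t' -> t' <= t -> t <= T ->
  s - s' <= tau -> t - t' <= tau ->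
  `|\int[mu]_(x in `[s, t]) f x| <= `|\int[mu]_(x in `[s', t']) f x| + 2 * tau.
Proof.
move=> s'0 ss st st' tt tT stau ttau.
have s'T : s <= T by exact: le_trans tT.
have e1 := Rintegral_itv_split s'0 ss st tT.
have e2 := Rintegral_itv_split s'0 st' tt tT.
have b1 := ler_norm_Rintegral_itv s'0 ss s'T.
have b2 := ler_norm_Rintegral_itv (le_trans s'0 st') tt tT.
have -> : \int[mu]_(x in `[s, t]) f x = \int[mu]_(x in `[s', t']) f x +
   (\int[mu]_(x in `[t', t]) f x - \int[mu]_(x in `[s', s]) f x).
  by rewrite addrA -e2 e1 addrC addKr.
rewrite (le_trans (ler_normD _ _))// lerD2l (le_trans (ler_normB _ _))//.
lra.
Qed.

End BoundedIntegrand.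

Section VectorPath.
Variables (d : nat) (T : R) (w : R -> 'rV[R]_d).
Implicit Types xi : 'rV[R]_d.

Definition measurable_path := forall i, measurable_fun `[0, T] (fun t => w t 0 i).

Definition cos_int xi (s t : R) := \int[mu]_(r in `[s, t]) cos (dot xi (w r)).
Definition sin_int xi (s t : R) := \int[mu]_(r in `[s, t]) sin (dot xi (w r)).
(** The l^1 norm of the real and imaginary parts: it dominates the modulus of [Phi] and keeps the
    estimates real. *)
Definition osc xi (s t : R) := `|cos_int xi s t| + `|sin_int xi s t|.

Lemma normc_le (z : R[i]) :
  ComplexField.Normc.normc z <= `|complex.Re z| + `|complex.Im z|.
Proof.
case: z => x y /=; rewrite -[leRHS]ger0_norm ?addr_ge0// -sqrtr_sqr.
rewrite ler_wsqrtr// -(real_normK (num_real x)) -(real_normK (num_real y)).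
by have := mulr_ge0 (normr_ge0 x) (normr_ge0 y); nra.
Qed.

Lemma normc_Phi_le xi (s t : R) : s <= t ->
  ComplexField.Normc.normc (Phi w s t xi) <= osc xi s t.
Proof. by move=> st; rewrite /Phi st; exact: normc_le. Qed.

Lemma normc_PhiC xi (s t : R) :
  ComplexField.Normc.normc (Phi w s t xi) = ComplexField.Normc.normc (Phi w t s xi).
Proof.
have [->//|st] := eqVneq s t.
wlog lst : s t st / s < t.
  move=> H; have [lt|lt|e] := ltgtP s t; [exact: H|by rewrite (H t s)// eq_sym|].
  by rewrite e eqxx in st.
rewrite /Phi (ltW lst) leNgt lst /=.
by rewrite !sqrrN.
Qed.

Hypothesis mw : measurable_path.

Lemma measurable_dot_path xi : measurable_fun `[0, T] (fun r => dot xi (w r)).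
Proof. by apply: measurable_sum => i; apply: measurable_funM => //; exact: mw. Qed.

Lemma measurable_cos_path xi : measurable_fun `[0, T] (fun r => cos (dot xi (w r))).
Proof.
apply: (measurableT_comp (continuous_measurable_fun (@continuous_cos R))).
exact: measurable_dot_path.
Qed.

Lemma measurable_sin_path xi : measurable_fun `[0, T] (fun r => sin (dot xi (w r))).
Proof.
apply: (measurableT_comp (continuous_measurable_fun (@continuous_sin R))).
exact: measurable_dot_path.
Qed.

Let cos1 xi r : `|cos (dot xi (w r))| <= 1. Proof. by rewrite ler_norml cos_geN1 cos_le1. Qed.
Let sin1 xi r : `|sin (dot xi (w r))| <= 1. Proof. by rewrite ler_norml sin_geN1 sin_le1. Qed.

Lemma osc_le xi (s t : R) : 0 <= s -> s <= t -> t <= T -> osc xi s t <= 2 * (t - s).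
Proof.
move=> s0 st tT; rewrite mulrDl mul1r lerD//.
  exact: (ler_norm_Rintegral_itv (measurable_cos_path xi) (cos1 xi) s0 st tT).
exact: (ler_norm_Rintegral_itv (measurable_sin_path xi) (sin1 xi) s0 st tT).
Qed.

Lemma osc_split xi (s u t : R) : 0 <= s -> s <= u -> u <= t -> t <= T ->
  osc xi s t <= osc xi s u + osc xi u t.
Proof.
move=> s0 su ut tT; rewrite /osc /cos_int /sin_int.
rewrite (Rintegral_itv_split (measurable_cos_path xi) (cos1 xi) s0 su ut tT).
rewrite (Rintegral_itv_split (measurable_sin_path xi) (sin1 xi) s0 su ut tT).
by rewrite addrACA lerD// ler_normD.
Qed.

Lemma osc_near xi (s t s' t' tau : R) :
  0 <= s' -> s' <= s -> s <= t -> s' <= t' -> t' <= t -> t <= T ->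
  s - s' <= tau -> t - t' <= tau -> osc xi s t <= osc xi s' t' + 4 * tau.
Proof.
move=> a1 a2 a3 a4 a5 a6 a7 a8.
have := Rintegral_itv_near (measurable_cos_path xi) (cos1 xi) a1 a2 a3 a4 a5 a6 a7 a8.
have := Rintegral_itv_near (measurable_sin_path xi) (sin1 xi) a1 a2 a3 a4 a5 a6 a7 a8.
rewrite /osc /cos_int /sin_int; lra.
Qed.

Hypothesis iw : forall i, mu.-integrable `[0, T] (EFin \o (fun r => w r 0 i)).

(** A Lipschitz constant, for the sup norm on frequencies, of the cosine and sine integrals. *)
Definition path_mass : R := \sum_i \int[mu]_(r in `[0, T]) `|w r 0 i|.

Lemma dot_near (xi xi' v : 'rV[R]_d) (tau : R) :
  (forall i, `|xi 0 i - xi' 0 i| <= tau) ->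
  `|dot xi v - dot xi' v| <= tau * \sum_i `|v 0 i|.
Proof.
move=> H; rewrite /dot -sumrB (le_trans (ler_norm_sum _ _ _))// mulr_sumr.
by apply: ler_sum => i _; rewrite -mulrBl normrM ler_wpM2r.
Qed.

Lemma integrable_EFinB d' (S : measurableType d') (K : realType)
    (nu : {measure set S -> \bar K}) (D : set S) (f g : S -> K) :
  measurable D -> nu.-integrable D (EFin \o f) ->
  nu.-integrable D (EFin \o g) ->
  nu.-integrable D (EFin \o (fun x => f x - g x)).
Proof. by move=> mD fi gi; exact: (integrableB mD fi gi). Qed.

Lemma Rintegral_trig_near (g : R -> R) xi xi' (s t tau : R) :
  measurable_fun setT g -> (forall x, `|g x| <= 1) ->
  (forall a b, `|g a - g b| <= `|a - b|) ->
  0 <= s -> s <= t -> t <= T -> 0 <= tau -> (forall i, `|xi 0 i - xi' 0 i| <= tau) ->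
  `|\int[mu]_(r in `[s, t]) g (dot xi (w r))| <=
  `|\int[mu]_(r in `[s, t]) g (dot xi' (w r))| + tau * path_mass.
Proof.
move=> mg g1 glip s0 st tT tau0 H.
have mgx z : measurable_fun `[0, T] (fun r => g (dot z (w r))).
  by apply: measurableT_comp => //; exact: measurable_dot_path.
have ig z : mu.-integrable `[s, t] (EFin \o (fun r => g (dot z (w r)))).
  by apply: (integrable_unit_itv (mgx z)).
have sub : `[s, t] `<=` `[0, T] by apply: subset_itv; rewrite bnd_simp.
have iA : mu.-integrable `[0, T] (EFin \o (fun r => tau * \sum_i `|w r 0 i|)).
  apply: integrable_EFinZ => //; apply: integrable_EFin_sum => // i.
  exact: (integrable_norm (iw i)).
have iD : mu.-integrable `[s, t] (EFin \o (fun r => g (dot xi (w r)) - g (dot xi' (w r)))).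
  exact: integrable_EFinB.
rewrite -lerBlDl; apply: le_trans (lerB_dist _ _) _.
rewrite -RintegralB//.
rewrite (le_trans (le_normr_Rintegral _ iD))//.
apply: (@le_trans _ _ (\int[mu]_(r in `[s, t]) (tau * \sum_i `|w r 0 i|))).
  apply: le_Rintegral => //; first exact: (integrable_norm iD).
    by apply: integrableS iA.
  by move=> r _; rewrite (le_trans (glip _ _))// dot_near.
apply: (@le_trans _ _ (\int[mu]_(r in `[0, T]) (tau * \sum_i `|w r 0 i|))).
  rewrite /Rintegral fine_le//.
  - by apply: integrable_fin_num => //; by apply: integrableS iA.
  - exact: integrable_fin_num.
  - apply: ge0_subset_integral => //; first by case/integrableP: iA.
    by move=> r _; rewrite lee_fin mulr_ge0// sumr_ge0.
rewrite le_eqVlt; apply/orP; left; apply/eqP.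
rewrite RintegralZl//; last first.
  by apply: integrable_EFin_sum => // i; exact: (integrable_norm (iw i)).
rewrite Rintegral_sum// => i; exact: (integrable_norm (iw i)).
Qed.

Lemma osc_freq_near xi xi' (s t tau : R) :
  0 <= s -> s <= t -> t <= T -> 0 <= tau -> (forall i, `|xi 0 i - xi' 0 i| <= tau) ->
  osc xi s t <= osc xi' s t + 2 * tau * path_mass.
Proof.
move=> s0 st tT tau0 H.
have c1 (x : R) : `|cos x| <= 1 by rewrite ler_norml cos_geN1 cos_le1.
have c2 (x : R) : `|sin x| <= 1 by rewrite ler_norml sin_geN1 sin_le1.
have := Rintegral_trig_near (continuous_measurable_fun (@continuous_cos R))
  c1 ler_norm_cosB s0 st tT tau0 H.
have := Rintegral_trig_near (continuous_measurable_fun (@continuous_sin R))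
  c2 ler_norm_sinB s0 st tT tau0 H.
rewrite /osc /cos_int /sin_int; lra.
Qed.

Lemma truncn_grid (k : nat) (x : R) : (0 < k)%N -> 0 <= x ->
  let g : R := (Num.truncn (k%:R * x))%:R / k%:R in
  [/\ 0 <= g, g <= x & x - g <= k%:R^-1].
Proof.
move=> k0 x0 g.
have kr0 : (0 : R) < k%:R by rewrite ltr0n.
have := truncn_itv (mulr_ge0 (ltW kr0) x0); rewrite -natr1 => /andP[t1 t2].
split; first by rewrite /g divr_ge0.
  by rewrite /g ler_pdivrMr// [x * _]mulrC.
rewrite -(ler_pM2l kr0) mulrBr /g mulrCA divff ?gt_eqF//; move: t2; lra.
Qed.

(** Moving to grid times costs 4 / k and moving to the grid frequency 2 [path_mass] / k. The rounded
    interval is shorter than t - s + 1 / k, or equal, hence shorter than [delta]. *)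
Lemma osc_time_grid (k : nat) (xi xi' : 'rV[R]_d) (K delta : R) :
  (0 < k)%N -> 0 <= K -> (forall i, `|xi 0 i - xi' 0 i| <= k%:R^-1) ->
  (forall a b : nat, (a < b)%N -> b%:R / k%:R <= T -> b%:R / k%:R - a%:R / k%:R < delta ->
     osc xi' (a%:R / k%:R) (b%:R / k%:R) <= K * Num.sqrt (b%:R / k%:R - a%:R / k%:R)) ->
  forall s t, 0 <= s -> s <= t -> t <= T -> k%:R^-1 <= t - s -> t - s + k%:R^-1 < delta ->
    osc xi s t <= 2 * K * Num.sqrt (t - s) + (4 + 2 * path_mass) * k%:R^-1.
Proof.
move=> k0 K0 nr H s t s0 st tT kst std.
have kV0 : (0 : R) < k%:R^-1 by rewrite invr_gt0 ltr0n.
have t0 := le_trans s0 st.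
have [s'0 s1 s2] := truncn_grid k0 s0; have [t'0 t1 t2] := truncn_grid k0 t0.
have st' : (Num.truncn (k%:R * s) <= Num.truncn (k%:R * t))%N.
  by apply: le_truncn; rewrite ler_wpM2l.
set s' : R := _ / k%:R in s'0 s1 s2; set t' : R := _ / k%:R in t'0 t1 t2.
have st'' : s' <= t' by rewrite ler_wpM2r ?(ltW kV0)// ler_nat.
have h1 := osc_freq_near s0 st tT (ltW kV0) nr.
have h2 := osc_near xi' s'0 s1 st st'' t1 tT s2 t2.
have h3 : osc xi' s' t' <= 2 * K * Num.sqrt (t - s).
  have [e|ne] := eqVneq s' t'.
    rewrite -e; apply: le_trans (osc_le xi' s'0 (lexx _) (le_trans s1 (le_trans st tT))) _.
    by rewrite subrr mulr0 !mulr_ge0 ?sqrtr_ge0.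
  have lab : (Num.truncn (k%:R * s) < Num.truncn (k%:R * t))%N.
    by rewrite ltn_neqAle st' andbT; apply: contra ne => /eqP e; rewrite /s' /t' e.
  apply: le_trans (H _ _ lab (le_trans t1 tT) _) _; first by rewrite -/s' -/t'; lra.
  rewrite -/s' -/t' [2 * K]mulrC -mulrA ler_wpM2l//.
  (* The rounded length is at most t - s + 1 / k <= 2 (t - s), below the 4 (t - s) that the factor 2
     provides after squaring. *)
  rewrite -(@ler_pXn2r _ 2) ?nnegrE ?mulr_ge0 ?sqrtr_ge0// exprMn !sqr_sqrtr ?subr_ge0//.
  by lra.
lra.
Qed.

End VectorPath.

(** * From frequency shells to a power of |t - s| *)

Section Regularity.
Variables (d : nat) (T : R) (w : R -> 'rV[R]_d).
Hypothesis mw : measurable_path T w.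
Implicit Types xi : 'rV[R]_d.

(** Bisection: each doubling of the admissible length costs a factor 2, which lifts the restriction
    to intervals shorter than [delta]. *)
Lemma osc_doubling xi (A gamma delta : R) : 0 <= A -> 0 <= gamma -> 0 < delta ->
  (forall s t, 0 <= s -> s <= t -> t <= T -> t - s < delta ->
    osc w xi s t <= A * (t - s) `^ gamma) ->
  forall k s t, 0 <= s -> s <= t -> t <= T -> t - s < 2 ^+ k * delta ->
    osc w xi s t <= 2 ^+ k * A * (t - s) `^ gamma.
Proof.
move=> A0 g0 d0 H; elim=> [|k IH] s t s0 st tT.
  by rewrite expr0 !mul1r; exact: H.
rewrite exprS => std; pose u := (s + t) / 2.
have su : s <= u by rewrite /u; lra.
have ut : u <= t by rewrite /u; lra.
have hs : (u - s) `^ gamma <= (t - s) `^ gamma.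
  by rewrite ge0_ler_powR ?nnegrE ?subr_ge0// lerD2r.
have ht : (t - u) `^ gamma <= (t - s) `^ gamma.
  by rewrite ge0_ler_powR ?nnegrE ?subr_ge0// lerD2l lerN2.
rewrite (le_trans (osc_split mw xi s0 su ut tT))//.
have h1 : osc w xi s u <= 2 ^+ k * A * (t - s) `^ gamma.
  apply: le_trans (IH s u s0 su (le_trans ut tT) _) _; first by move: std; rewrite /u; lra.
  by rewrite ler_wpM2l// mulr_ge0// exprn_ge0.
have h2 : osc w xi u t <= 2 ^+ k * A * (t - s) `^ gamma.
  apply: le_trans (IH u t (le_trans s0 su) ut tT _) _; first by move: std; rewrite /u; lra.
  by rewrite ler_wpM2l// mulr_ge0// exprn_ge0.
by rewrite -!mulrA mulrDl mul1r lerD// mulrA.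
Qed.

Lemma powR_split (x a b : R) : 0 < x -> x `^ (a + b) = x `^ a * x `^ b.
Proof. by move=> x0; rewrite powRD ?(gt_eqF x0) ?implybT. Qed.

(** The power gamma - 1/2, nonnegative by hypothesis, is moved from [tau] to the larger [x]. *)
Lemma sqrt_mul_le_powR (tau x gamma : R) : 0 < tau -> tau <= x -> 2^-1 <= gamma ->
  Num.sqrt tau * Num.sqrt x <= tau `^ (1 - gamma) * x `^ gamma.
Proof.
move=> t0 tx g1; have x0 := lt_le_trans t0 tx.
rewrite -!powR12_sqrt ?(ltW t0) ?(ltW x0)//.
have -> : tau `^ 2^-1 = tau `^ (1 - gamma) * tau `^ (gamma - 2^-1).
  by rewrite -powR_split//; congr (_ `^ _); lra.
have -> : x `^ gamma = x `^ (gamma - 2^-1) * x `^ 2^-1.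
  by rewrite -powR_split//; congr (_ `^ _); lra.
rewrite -mulrA ler_wpM2l ?powR_ge0// ler_wpM2r ?powR_ge0//.
by rewrite ge0_ler_powR ?nnegrE ?subr_ge0// ltW.
Qed.

(** Intervals longer than [delta] are reached by [osc_doubling]; the finitely many shells below [m1]
    are covered by the trivial bound and absorbed in the constant [D]. *)
Lemma regularity_of_shells (gamma delta C1 : R) (tau : nat -> R) (m1 : nat) :
  0 < T -> 2^-1 <= gamma < 1 -> 0 < delta -> 0 <= C1 -> (forall m, 0 < tau m <= 1) ->
  (forall m xi s t, (m1 <= m)%N -> m%:R <= enorm xi -> enorm xi < m.+1%:R ->
    0 <= s -> s <= t -> t <= T -> tau m <= t - s -> t - s < delta ->
    osc w xi s t <= C1 * (Num.sqrt (tau m) * Num.sqrt (t - s) + tau m)) ->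
  exists2 C : R, 0 < C & forall m xi s t, m%:R <= enorm xi -> enorm xi < m.+1%:R ->
    0 <= s <= T -> 0 <= t <= T ->
    ComplexField.Normc.normc (Phi w s t xi) <=
    C * (tau m `^ (1 - gamma) * `|t - s| `^ gamma).
Proof.
move=> T0 /andP[g1 g2] d0 C10 tau01 H.
have g0 : 0 < gamma by rewrite (lt_le_trans _ g1).
have triv xi s t : 0 <= s -> s <= t -> t <= T -> forall b, t - s <= b -> 0 < b ->
    osc w xi s t <= 2 * b `^ (1 - gamma) * (t - s) `^ gamma.
  move=> s0 st tT b tsb b0; apply: le_trans (osc_le mw xi s0 st tT) _.
  rewrite -mulrA ler_wpM2l//.
  have [->|ne] := eqVneq s t; first by rewrite subrr mulr_ge0 ?powR_ge0.
  have ts0 : 0 < t - s by rewrite subr_gt0 lt_neqAle ne.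
  have e : (t - s) `^ (1 - gamma) * (t - s) `^ gamma = t - s.
    by rewrite -powR_split// subrK powRr1// ltW.
  rewrite -{1}e ler_wpM2r ?powR_ge0//.
  by rewrite ge0_ler_powR ?nnegrE ?subr_ge0// ltW.
(* Enough doublings to pass from [delta] to [T], as 2^k > k. *)
pose k := (Num.truncn (T / delta)).+1.
have kT : T < 2 ^+ k * delta.
  rewrite -ltr_pdivrMr//; apply: lt_le_trans (truncnS_gt _) _.
  by rewrite -natrX ler_nat ltnW// ltn_expl.
pose C2 := 2 * C1 + 2; have C20 : 0 < C2 by rewrite /C2; lra.
pose D := \sum_(m < m1) 2 * T `^ (1 - gamma) / tau m `^ (1 - gamma).
have D0 : 0 <= D.
  by apply: sumr_ge0 => m _; rewrite divr_ge0 ?powR_ge0// mulr_ge0// powR_ge0.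
have C0 : 0 < 2 ^+ k * C2 + D.
  by rewrite ltr_pwDl// mulr_gt0// exprn_gt0.
exists (2 ^+ k * C2 + D) => // m xi s t mxi xim sT tT.
wlog st : s t sT tT / s <= t.
  move=> W; have [st|/ltW ts] := leP s t; first exact: W.
  by rewrite normc_PhiC distrC; exact: W.
move: sT tT => /andP[s0 _] /andP[_ tT].
rewrite ger0_norm ?subr_ge0//.
apply: le_trans (normc_Phi_le w xi st) _.
have /andP[tm0 tm1] := tau01 m.
have R0 : 0 <= tau m `^ (1 - gamma) * (t - s) `^ gamma by rewrite mulr_ge0 ?powR_ge0.
have tsT : t - s <= T by lra.
have [mm1|m1m] := ltnP m m1.
  apply: le_trans (triv xi s t s0 st tT T tsT T0) _.
  apply: (@le_trans _ _ (D * (tau m `^ (1 - gamma) * (t - s) `^ gamma))); last first.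
    by rewrite ler_wpM2r// lerDr mulr_ge0 ?exprn_ge0// ltW.
  rewrite mulrA ler_wpM2r ?powR_ge0// -ler_pdivrMr ?powR_gt0//.
  rewrite /D (bigD1 (Ordinal mm1))//= lerDl.
  by apply: sumr_ge0 => i _; rewrite divr_ge0 ?powR_ge0// mulr_ge0// powR_ge0.
apply: (@le_trans _ _ (2 ^+ k * (C2 * tau m `^ (1 - gamma)) * (t - s) `^ gamma)); last first.
  by rewrite -!mulrA mulrA ler_wpM2r// lerDl.
apply: (@osc_doubling xi (C2 * tau m `^ (1 - gamma)) gamma delta) => //.
- by rewrite mulr_ge0 ?powR_ge0// ltW.
- exact: ltW.
- move=> s' t' s'0 st' t'T tsd.
  have [x1|x1] := ltP (t' - s') (tau m).
    apply: le_trans (triv xi s' t' s'0 st' t'T _ (ltW x1) tm0) _.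
    by rewrite ler_wpM2r ?powR_ge0// ler_wpM2r ?powR_ge0// /C2; lra.
  apply: le_trans (H m xi s' t' m1m mxi xim s'0 st' t'T x1 tsd) _.
  have h1 := sqrt_mul_le_powR tm0 x1 g1.
  have h2 : tau m <= tau m `^ (1 - gamma) * (t' - s') `^ gamma.
    have e : tau m `^ (1 - gamma) * tau m `^ gamma = tau m.
      by rewrite -powR_split// subrK powRr1// ltW.
    rewrite -{1}e.
    rewrite ler_wpM2l ?powR_ge0// ge0_ler_powR ?nnegrE ?(ltW g0) ?(ltW tm0)//.
    by rewrite (le_trans (ltW tm0)).
  rewrite -mulrA /C2; move: h1 h2; move: (_ `^ _ * _ `^ _) (Num.sqrt _ * _) => a b h1 h2.
  have a0 : 0 <= a by rewrite (le_trans (ltW tm0)).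
  have := ler_wpM2l C10 h1; have := ler_wpM2l C10 h2; lra.
- by rewrite (le_lt_trans tsT).
Qed.

End Regularity.

End Paths.

(** * Tail estimates for continuous processes *)

Section Riemann.
Context {R : realType}.
Notation mu := (@lebesgue_measure R).

(** Heine-Cantor, from the near-covering form of compactness with a radius tending to 0 from the
    right. *)
Lemma within_itv_unif_continuous (g : R -> R) (a b e : R) : 0 < e ->
  {within `[a, b], continuous g} ->
  exists2 delta : R, 0 < delta & forall x y, a <= x <= b -> a <= y <= b ->
    `|x - y| < delta -> `|g x - g y| < e.
Proof.
move=> e0 cg.
have cpt : compact `[a, b] by exact: segment_compact.
have := (compact_near_coveringP _).1 cpt.
move=> /(_ R (0^'+) (fun dl x => forall y, a <= x <= b -> a <= y <= b ->
   `|x - y| < dl -> `|g x - g y| < e) _) H.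
have : \forall dl \near 0^'+, `[a, b] `<=` (fun x => forall y, a <= x <= b -> a <= y <= b ->
   `|x - y| < dl -> `|g x - g y| < e).
  apply: H => x xab.
  have := (subspace_continuousP _ _).1 cg x xab.
  move=> /cvgrPdist_lt/(_ (e / 2) (divr_gt0 e0 (ltr0n _ 2))).
  rewrite near_withinE => /nbhs_ballP[r /= r0 br].
  have br' (z : R) : `|x - z| < r -> a <= z <= b -> `|g x - g z| < e / 2.
    by move=> xz zab; apply: (br z xz); rewrite in_itv.
  have r20 : 0 < r / 2 by rewrite divr_gt0.
  near=> x' dl => y /= x'ab yab x'y.
  have xx' : `|x - x'| < r / 2.
    by near: x'; apply/nbhs_ballP; exists (r / 2).
  have dlr : dl < r / 2 by near: dl; exact: nbhs_right_lt.
  have h1 : `|g x - g x'| < e / 2 by apply: br' => //; lra.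
  have h2 : `|g x - g y| < e / 2.
    apply: br' => //; have -> : x - y = (x - x') + (x' - y) by rewrite addrA subrK.
    rewrite (le_lt_trans (ler_normD _ _))//; lra.
  have -> : g x' - g y = (g x - g y) - (g x - g x').
    by ring.
  rewrite (le_lt_trans (ler_normB _ _))//; lra.
move=> Hn; have [dl [dl0 Hdl]] : exists dl : R, 0 < dl /\ `[a, b] `<=` (fun x => forall y, a <= x <= b -> a <= y <= b ->
   `|x - y| < dl -> `|g x - g y| < e).
  near ((0 : R)^'+) => dl; exists dl; split; near: dl; last exact: Hn.
  exact: nbhs_right_gt.
by exists dl => // x y xab yab; apply: Hdl => //; rewrite /= in_itv.
Unshelve. all: end_near. Qed.

Lemma riemann_cells (T : R) (g : R -> R) (e l : R) :
  measurable_fun `[0, T] g -> (forall x, `|g x| <= 1) ->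
  0 <= e -> 0 <= l ->
  (forall x y, 0 <= x <= T -> 0 <= y <= T -> `|x - y| <= l -> `|g x - g y| <= e) ->
  forall n a, 0 <= a -> a + n%:R * l <= T ->
  `|\int[mu]_(x in `[a, a + n%:R * l]) g x - l * \sum_(0 <= i < n) g (a + i%:R * l)|
    <= e * (n%:R * l).
Proof.
move=> mg g1 e0 l0 H; elim=> [|n IH] a a0.
  by rewrite mul0r addr0 big_geq// set_itv1 Rintegral_set1 !mulr0 subr0 normr0.
rewrite -natr1 mulrDl mul1r addrA => anT.
have nl0 : 0 <= n%:R * l by rewrite mulr_ge0.
set x := a + n%:R * l in anT *.
have x0 : 0 <= x by rewrite addr_ge0.
have ax : a <= x by rewrite lerDl.
have xl : x <= x + l by rewrite lerDl.
rewrite (Rintegral_itv_split mg g1 a0 ax xl anT) big_nat_recr//= -/x mulrDr.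
have -> (A B C D : R) : A + B - (C + D) = (A - C) + (B - D) by ring.
rewrite (le_trans (ler_normD _ _))// mulrDr lerD//.
  by apply: IH => //; rewrite -/x; lra.
have ix := integrable_unit_itv mg g1 x0 anT.
have cE (c : R) : \int[mu]_(y in `[x, x + l]) c = c * l.
  rewrite Rintegral_cst//= lebesgue_measure_itv/= lte_fin.
  case: ltP => /= h; first by rewrite addrC addKr.
  by rewrite (_ : l = 0) ?mulr0//; lra.
have ic (c : R) : mu.-integrable `[x, x + l] (EFin \o (fun=> c)).
  apply: (@integrable_bounded _ _ _ _ _ `|c|) => //.
  by rewrite /= lebesgue_measure_itv/=; case: ifPn => //; rewrite -EFinD ltry.
rewrite (_ : l * g x = \int[mu]_(y in `[x, x + l]) g x); last by rewrite cE mulrC.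
rewrite -(RintegralB _ ix (ic (g x)))//.
have iD : mu.-integrable `[x, x + l] (EFin \o (fun y => g y - g x)).
  by apply: integrable_EFinB => //; exact: ic.
rewrite (le_trans (le_normr_Rintegral _ iD))//.
rewrite -(cE e) le_Rintegral//; first exact: (integrable_norm iD).
move=> y; rewrite /= in_itv/= => /andP[xy yx]; apply: H.
- by rewrite (le_trans x0 xy) (le_trans yx).
- by rewrite x0 (le_trans xl).
- by rewrite ger0_norm ?subr_ge0// lerBlDl.
Qed.

Definition block_pts (a h : R) (q i : nat) : seq R :=
  [seq a + i%:R * h + k%:R * (h / q%:R) | k <- iota 0 q].

Lemma size_block_pts a h q i : size (block_pts a h q i) = q.
Proof. by rewrite size_map size_iota. Qed.

Lemma mem_block_pts a h q i p : 0 < h -> p \in block_pts a h q i ->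
  a + i%:R * h <= p < a + i.+1%:R * h.
Proof.
move=> h0 /mapP[k]; rewrite mem_iota add0n => /andP[_ kq] ->.
have q0 : (0 : R) < q%:R by rewrite ltr0n (leq_ltn_trans _ kq).
rewrite lerDl mulr_ge0 ?divr_ge0 ?(ltW h0)//= -addrA ltrD2l -natr1 mulrDl mul1r ltrD2l.
by rewrite mulrA ltr_pdivrMr// mulrC ltr_pM2l// ltr_nat.
Qed.

(** Even and odd cells are summed separately because [block_moment_le] needs cells
    at distance at least [h]. *)
Lemma riemann_blocks (T : R) (g : R -> R) (e a h : R) (q : nat) :
  measurable_fun `[0, T] g -> (forall x, `|g x| <= 1) ->
  0 <= e -> 0 < h -> (0 < q)%N -> 0 <= a ->
  (forall x y, 0 <= x <= T -> 0 <= y <= T -> `|x - y| <= h / q%:R -> `|g x - g y| <= e) ->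
  forall N, a + (2 * N)%:R * h <= T ->
  `|\int[mu]_(x in `[a, a + (2 * N)%:R * h]) g x -
    h / q%:R * (\sum_(p <- concat_blocks (fun j => block_pts a h q (2 * j)) N) g p +
                \sum_(p <- concat_blocks (fun j => block_pts a h q (2 * j).+1) N) g p)|
  <= e * ((2 * N)%:R * h).
Proof.
move=> mg g1 e0 h0 q0 a0 H.
have qr0 : (0 : R) < q%:R by rewrite ltr0n.
have hq : h = q%:R * (h / q%:R) by rewrite mulrC divfK// gt_eqF.
have cell b : 0 <= b -> b + h <= T ->
  `|\int[mu]_(x in `[b, b + h]) g x - h / q%:R * \sum_(0 <= k < q) g (b + k%:R * (h / q%:R))| <= e * h.
  move=> b0 bT; have := riemann_cells mg g1 e0 (divr_ge0 (ltW h0) (ltW qr0)) H (n := q) b0.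
  by rewrite -hq; exact.
elim=> [_|N IH NT].
  by rewrite muln0 mul0r addr0 set_itv1 Rintegral_set1 /= !big_nil addr0 !mulr0 subr0 normr0.
pose b := a + (2 * N)%:R * h.
have e1 : a + (2 * N.+1)%:R * h = b + h + h by rewrite /b mulnS natrD; ring.
rewrite e1 in NT *.
have b0 : 0 <= b by rewrite addr_ge0 ?mulr_ge0 ?(ltW h0).
have ab : a <= b by rewrite lerDl mulr_ge0 ?(ltW h0).
have bT : b + h <= T by lra.
rewrite (Rintegral_itv_split mg g1 (u := b) a0 ab _ NT); last by lra.
rewrite (Rintegral_itv_split mg g1 (u := b + h) b0 _ _ NT); [|lra..].
rewrite /= !big_cat/= !big_map.
have c1 := cell b b0 bT.
have c2 := cell (b + h) _ NT.
have IH' := IH (le_trans _ bT).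
rewrite -/b in IH'.
set S1 := \sum_(p <- concat_blocks _ N) _ in IH' *.
set S2 := \sum_(p <- concat_blocks _ N) _ in IH' *.
set S3 := \sum_(k <- iota 0 q) _.
set S4 := \sum_(k <- iota 0 q) _.
set I1 := \int[mu]_(x in `[a, b]) g x in IH' *.
set I2 := \int[mu]_(x in `[b, b + h]) g x in c1 *.
set I3 := \int[mu]_(x in `[b + h, b + h + h]) g x in c2 *.
have c1' : `|I2 - h / q%:R * S3| <= e * h.
  rewrite (_ : S3 = \sum_(0 <= k < q) g (b + k%:R * (h / q%:R)))//.
  by rewrite /index_iota subn0.
have c2' : `|I3 - h / q%:R * S4| <= e * h.
  rewrite (_ : S4 = \sum_(0 <= k < q) g (b + h + k%:R * (h / q%:R))); first by apply: c2; lra.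
  rewrite /index_iota subn0; apply: eq_bigr => k _; congr (g (_ + _)).
  by rewrite /b -natr1 mulrDl mul1r addrA.
have -> : I1 + (I2 + I3) - h / q%:R * (S1 + S3 + (S2 + S4)) =
  (I1 - h / q%:R * (S1 + S2)) + (I2 - h / q%:R * S3) + (I3 - h / q%:R * S4) by ring.
rewrite (le_trans (ler_normD _ _))// -[leRHS]/(e * _).
have -> : e * ((2 * N.+1)%:R * h) = e * ((2 * N)%:R * h) + e * h + e * h.
  by rewrite mulnS natrD; ring.
rewrite lerD// (le_trans (ler_normD _ _))// lerD//.
by apply: IH'; lra.
Qed.

End Riemann.

(** * Tail bound for one frequency and one time interval *)

Section Tail.
Context {R : realType} {dO : measure_display} {Omega : measurableType dO}.
Variable P : probability Omega R.
Notation mu := (@lebesgue_measure R).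

Lemma markov_bounded_rv (f : Omega -> R) (a : R) : bounded_rv f ->
  (forall w, 0 <= f w) -> 0 < a ->
  (P [set w | (a < f w)%R] <= (\int[P]_w f w / a)%:E)%E.
Proof.
move=> bf f0 a0; have [mf _] := bf.
set A := [set w | _].
have mA : measurable A.
  have := mf measurableT `]a, +oo[%classic (measurable_itv _); rewrite setTI.
  suff -> : f @^-1` `]a, +oo[ = A by [].
  by apply/seteqP; split=> w /=; rewrite in_itv/= andbT.
have iA : bounded_rv (\1_A : Omega -> R).
  split; first exact: measurable_indic.
  by exists 1 => w; rewrite indicE; case: (_ \in _); rewrite ?normr1 ?normr0.
have PA : (P A = (\int[P]_w \1_A w)%R%:E)%E.
  by rewrite /Rintegral integral_indic// setIT fineK// fin_num_measure.
rewrite PA lee_fin ler_pdivlMr// mulrC -RintegralZl//; last exact: bounded_rv_integrable.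
apply: le_Rintegral => //; try exact: bounded_rv_integrable.
  by apply: bounded_rv_integrable; apply: bounded_rvM => //; exact: bounded_rv_cst.
move=> w _; rewrite indicE; case: (boolP (w \in A)) => [|_]; last by rewrite mulr0.
by rewrite inE /A /= mulr1 => /ltW.
Qed.

(** An increasing union of sets, each inside some [D q]. It supplies a measurable event around a
    limit event without measurability of the limit. *)
Lemma probability_eventually_le (D : nat -> set Omega) (p : R) :
  (forall q, measurable (D q)) -> (forall q, (P (D q) <= p%:E)%E) ->
  measurable (\bigcup_Q \bigcap_(q in [set q | (Q <= q)%N]) D q) /\
  (P (\bigcup_Q \bigcap_(q in [set q | (Q <= q)%N]) D q) <= p%:E)%E.
Proof.
move=> mD Dp; pose E Q := \bigcap_(q in [set q | (Q <= q)%N]) D q.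
have mE Q : measurable (E Q) by apply: bigcap_measurable => //; exists Q => /=.
have mU : measurable (\bigcup_Q E Q) by exact: bigcup_measurable.
split => //.
have cE : P (E Q) @[Q --> \oo] --> P (\bigcup_Q E Q).
  apply: nondecreasing_cvg_mu => // Q Q' QQ'; apply/subsetPset => w Ew q /= Q'q.
  by apply: Ew => /=; rewrite (leq_trans QQ').
rewrite -(cvg_lim _ cE)//; apply: lime_le; first by apply/cvg_ex; exists (P (\bigcup_Q E Q)).
apply: nearW => Q; apply: le_trans (Dp Q); apply: le_measure; rewrite ?inE//.
by move=> w; apply => /=.
Qed.

Lemma continuous_dot d (xi : 'rV[R]_d) : continuous (fun v : 'rV[R]_d => dot xi v).
Proof.
rewrite /dot; elim: (index_enum _) => [|i r IH] v.
  rewrite (_ : (fun _ => _) = cst 0); first exact: cst_continuous.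
  by apply/funext => u; rewrite big_nil.
rewrite (_ : (fun _ : 'rV[R]_d => _) = (fun u : 'rV[R]_d => xi 0 i * u 0 i + \sum_(j <- r) xi 0 j * u 0 j)); last first.
  by apply/funext => u; rewrite big_cons.
have h1 : {for v, continuous (fun u : 'rV[R]_d => xi 0 i * u 0 i)}.
  apply: (@continuousM R 'rV[R]_d (cst (xi 0 i)) (fun u : 'rV[R]_d => u 0 i)).
    exact: cst_continuous.
  exact: coord_continuous.
exact: (@continuousD R R^o 'rV[R]_d _ _ v h1 (IH v)).
Qed.

Lemma within_continuous_comp d (A : set R) (w : R -> 'rV[R]_d) (f : 'rV[R]_d -> R) :
  {within A, continuous w} -> continuous f -> {within A, continuous (fun r => f (w r))}.
Proof. by move=> cw cf x; apply: (continuous_comp (cw x)); exact: cf. Qed.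

Lemma continuous_measurable_path d (T : R) (w : R -> 'rV[R]_d) :
  {within `[0, T], continuous w} -> measurable_path T w.
Proof.
move=> cw i; apply: subspace_continuous_measurable_fun; first exact: measurable_itv.
apply: (@within_continuous_comp d _ w (fun v => v 0 i)) => //.
exact: coord_continuous.
Qed.

Lemma expr_add_le (n : nat) (x y : R) : 0 <= x -> 0 <= y ->
  (x + y) ^+ n <= 2 ^+ n * (x ^+ n + y ^+ n).
Proof.
move=> x0 y0; wlog xy : x y x0 y0 / x <= y.
  by move=> H; have [|/ltW] := leP x y => xy; [|rewrite addrC [x ^+ n + _]addrC]; exact: H.
apply: (@le_trans _ _ ((2 * y) ^+ n)).
  by apply: lerXn2r; rewrite ?nnegrE ?addr_ge0 ?mulr_ge0//; lra.
by rewrite exprMn ler_wpM2l ?exprn_ge0// lerDr exprn_ge0.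
Qed.

Lemma cvg_riemann_blocks (T : R) (g : R -> R) (a h : R) (N : nat) :
  {within `[0, T], continuous g} -> (forall x, `|g x| <= 1) ->
  0 < h -> 0 <= a -> a + (2 * N)%:R * h <= T ->
  h / q.+1%:R * (\sum_(p <- concat_blocks (fun j => block_pts a h q.+1 (2 * j)) N) g p +
                \sum_(p <- concat_blocks (fun j => block_pts a h q.+1 (2 * j).+1) N) g p)
  @[q --> \oo] --> \int[mu]_(x in `[a, a + (2 * N)%:R * h]) g x.
Proof.
move=> cg g1 h0 a0 aT.
have mg : measurable_fun `[0, T] g.
  by apply: subspace_continuous_measurable_fun => //; exact: measurable_itv.
have L0 : 0 <= (2 * N)%:R * h by rewrite mulr_ge0 ?(ltW h0).
apply/cvgrPdist_le => e e0.
pose e' := e / ((2 * N)%:R * h + 1).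
have e'0 : 0 < e' by rewrite divr_gt0// ltr_pwDr.
have [dl dl0 H] := within_itv_unif_continuous e'0 cg.
exists (Num.truncn (h / dl)) => // q /= hq.
have q0 : (0 : R) < q.+1%:R by [].
have hdl : h / q.+1%:R < dl.
  rewrite ltr_pdivrMr// mulrC -ltr_pdivrMr//.
  by rewrite (lt_le_trans (truncnS_gt _))// ler_nat ltnS.
apply: le_trans (riemann_blocks mg g1 (ltW e'0) h0 (ltn0Sn q) a0 _ aT) _.
  by move=> x y xT yT xy; apply/ltW/H => //; exact: le_lt_trans hdl.
by rewrite /e' mulrAC ler_pdivrMr ?ltr_pwDr// ler_pM2l// lerDl.
Qed.

(** The moments of the Riemann sums are bounded uniformly in the mesh, and Markov's inequality
    applies to each sum. [B] is the event that the sums are large for all large [q]; if the integral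
    along a continuous path is large, convergence puts the path in [B]. *)
Lemma osc_tail (n : nat) : (0 < n)%N -> exists2 C : R, 0 <= C &
  forall d (T : R) (X : R -> Omega -> 'rV[R]_d) (xi : 'rV[R]_d) (h eta s t kappa : R),
  (forall p, 0 <= p <= T -> measurable_fun setT (fun w => dot xi (X p w))) ->
  0 <= s -> t <= T -> 0 < h -> 2 * h <= t - s -> 0 < kappa -> 0 <= eta ->
  ((t - s) / (2 * h)) ^+ (2 * n) * eta <= 1 ->
  (forall l r, s <= r <= t -> (size l <= 2 * n)%N -> \sum_(p <- l) p.1 = -1 ->
    (forall p, p \in l -> s <= p.2 /\ p.2 <= r - h) ->
    `|\int[P]_w cos (lincomb X xi ((1, r) :: l) w)| <= eta) ->
  exists B : set Omega, [/\ measurable B,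
    (P B <= (C * (h * (t - s) / kappa ^+ 2) ^+ n)%:E)%E &
    forall w, {within `[0, T], continuous (X ^~ w)} -> ~ B w ->
      osc (X ^~ w) xi s t <= kappa].
Proof.
move=> n0.
have ar1 (j b N : nat) : (j < N)%N -> (b <= 1)%N -> ((2 * j + b).+1 <= 2 * N)%N by lia.
have ar2 (i j b : nat) : (i < j)%N -> ((2 * i + b).+2 <= 2 * j + b)%N by lia.
have [K K0 HK] := block_moment_le P n.
(* The 2 comes from the two parities; in 8^n, a factor 4^n comes from 4 h'^2 N <= 4 h L and 2^n from
   the threshold kappa^2 / 2. *)
exists (2 * 8 ^+ n * K); first by rewrite !mulr_ge0// exprn_ge0.
move=> d T X xi h eta s t kappa mX s0 tT h0 hst k0 eta0 Neta H.
set L := t - s in hst Neta *.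
have L0 : 0 < L by rewrite (lt_le_trans _ hst)// mulr_gt0.
have h20 : 0 < 2 * h by rewrite mulr_gt0.
pose N := Num.truncn (L / (2 * h)).
have N0 : (0 < N)%N by rewrite /N truncn_gt0 ler_pdivlMr// mul1r.
have Nr0 : (0 : R) < N%:R by rewrite ltr0n.
have /andP[N1 N2] : N%:R <= L / (2 * h) < N.+1%:R.
  by apply: truncn_itv; rewrite divr_ge0// ltW.
(* Adjusting [h] to h' in [h, 2 h] lets 2 N cells fill [s, t] exactly. *)
pose h' := L / (2 * N%:R).
have h'0 : 0 < h' by rewrite divr_gt0// mulr_gt0.
have hh' : h <= h'.
  rewrite /h' ler_pdivlMr ?mulr_gt0//; move: N1; rewrite ler_pdivlMr//; lra.
have h'h : h' <= 2 * h.
  rewrite /h' ler_pdivrMr ?mulr_gt0//; move: N2; rewrite ltr_pdivrMr// -natr1 => N2.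
  have N1' : (1 : R) <= N%:R by rewrite ler1n.
  have := ler_wpM2l (ltW h20) N1'; lra.
have sN : s + (2 * N)%:R * h' = t.
  by rewrite /h' natrM mulrC divfK ?mulf_neq0 ?gt_eqF// /L addrC subrK.
(* [block_moment_le] wants measurability at every real time, and nothing is known of [X] outside
   [0, T]. *)
pose Y (p : R) : Omega -> R := if 0 <= p <= T then (fun w => dot xi (X p w)) else cst 0.
have mY p : measurable_fun setT (Y p).
  by rewrite /Y; case: ifPn => pT; [exact: mX|exact: measurable_cst].
pose blocks b q := fun j => block_pts s h' q.+1 (2 * j + b).
have blk b q j p : (j < N)%N -> (b <= 1)%N -> p \in blocks b q j ->
    [/\ s + (2 * j + b)%:R * h' <= p, p < s + (2 * j + b).+1%:R * h', s <= p & p <= t].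
  move=> jN b1 pj; have /andP[p1 p2] := mem_block_pts h'0 pj; split => //.
    by rewrite (le_trans _ p1)// lerDl mulr_ge0// ltW.
  rewrite -sN (le_trans (ltW p2))// lerD2l ler_wpM2r ?(ltW h'0)// ler_nat.
  exact: ar1.
have momb b q : (b <= 1)%N ->
   \int[P]_w (((q.+1%:R^-1 * \sum_(p <- concat_blocks (blocks b q) N) cos (Y p w)) ^+ 2 +
              (q.+1%:R^-1 * \sum_(p <- concat_blocks (blocks b q) N) sin (Y p w)) ^+ 2) ^+ n)
   <= K * N%:R ^+ n.
  move=> b1; apply: (HK Y (blocks b q) q.+1 N eta mY) => //.
  - by move=> j; rewrite size_block_pts.
  - apply: le_trans Neta; rewrite ler_wpM2r// lerXn2r ?nnegrE//.
    by rewrite divr_ge0// ltW.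
  move=> j r l jN rj ln l1 lu.
  have [r1 r2 sr rt] := blk b q j r jN b1 rj.
  have lp p : p \in l -> s <= p.2 /\ p.2 <= r - h.
    move=> /lu /mem_concat_blocks[i ij pi].
    have [p1 p2 sp pt] := blk b q i p.2 (ltn_trans ij jN) b1 pi; split => //.
    rewrite lerBrDr (le_trans _ r1)//.
    (* A whole cell, of length h' >= h, separates two cells of the same parity. *)
    apply: (@le_trans _ _ (s + (2 * i + b).+1%:R * h' + h')); first by rewrite lerD// ltW.
    rewrite -addrA lerD2l -[X in _ + X]mul1r -mulrDl natr1 ler_wpM2r ?(ltW h'0)// ler_nat.
    exact: ar2.
  have YE w : \sum_(p <- (1, r) :: l) p.1 * Y p.2 w = lincomb X xi ((1, r) :: l) w.
    rewrite /lincomb !big_cons/=; congr (_ + _).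
      by rewrite /Y (le_trans s0 sr) (le_trans rt tT).
    rewrite big_seq [RHS]big_seq; apply: eq_bigr => p /lp[p1 p2].
    rewrite /Y (le_trans s0 p1) (le_trans p2)// (le_trans _ tT)// (le_trans _ rt)//.
    by rewrite lerBlDr lerDl ltW.
  under eq_Rintegral do rewrite YE.
  by apply: H => //; rewrite sr rt.
pose Cq q w := h' / q.+1%:R * (\sum_(p <- concat_blocks (blocks 0 q) N) cos (Y p w) +
  \sum_(p <- concat_blocks (blocks 1 q) N) cos (Y p w)).
pose Sq q w := h' / q.+1%:R * (\sum_(p <- concat_blocks (blocks 0 q) N) sin (Y p w) +
  \sum_(p <- concat_blocks (blocks 1 q) N) sin (Y p w)).
pose Z q w := Cq q w ^+ 2 + Sq q w ^+ 2.
have bsum (u : seq R) : bounded_rv (fun x => \sum_(p <- u) cos (Y p x)) /\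
    bounded_rv (fun x => \sum_(p <- u) sin (Y p x)).
  by split; apply: bounded_rv_sum => p; [exact: bounded_rv_cos|exact: bounded_rv_sin].
have bC q : bounded_rv (Cq q).
  apply: bounded_rvM; first exact: bounded_rv_cst.
  by apply: bounded_rvD; have [] := bsum (concat_blocks (blocks 0 q) N);
    have [] := bsum (concat_blocks (blocks 1 q) N).
have bS q : bounded_rv (Sq q).
  apply: bounded_rvM; first exact: bounded_rv_cst.
  by apply: bounded_rvD; have [] := bsum (concat_blocks (blocks 0 q) N);
    have [] := bsum (concat_blocks (blocks 1 q) N).
have bZ q : bounded_rv (fun w => Z q w ^+ n).
  by apply/bounded_rvX/bounded_rvD; exact: bounded_rvX.
pose V b q w := (q.+1%:R^-1 * \sum_(p <- concat_blocks (blocks b q) N) cos (Y p w)) ^+ 2 +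
              (q.+1%:R^-1 * \sum_(p <- concat_blocks (blocks b q) N) sin (Y p w)) ^+ 2.
have V0 b q w : 0 <= V b q w by rewrite addr_ge0 ?sqr_ge0.
have bV b q : bounded_rv (fun w => V b q w ^+ n).
  have [bc bs] := bsum (concat_blocks (blocks b q) N).
  by apply/bounded_rvX/bounded_rvD; apply/bounded_rvX/bounded_rvM => //; exact: bounded_rv_cst.
have Z0 q w : 0 <= Z q w by rewrite addr_ge0 ?sqr_ge0.
have h'4 : 0 <= 4 * h' ^+ 2 by apply: mulr_ge0 => //; exact: sqr_ge0.
have h'2 : 0 <= 2 * h' ^+ 2 by apply: mulr_ge0 => //; exact: sqr_ge0.
have ZV q w : Z q w ^+ n <= (4 * h' ^+ 2) ^+ n * (V 0 q w ^+ n + V 1 q w ^+ n).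
  have ZV1 : Z q w <= 2 * h' ^+ 2 * (V 0 q w + V 1 q w).
    rewrite /Z /Cq /Sq /V.
    set a := \sum_(p <- _) _; set b := \sum_(p <- _) _; set a' := \sum_(p <- _) _; set b' := \sum_(p <- _) _.
    rewrite -subr_ge0.
    have -> : 2 * h' ^+ 2 * ((q.+1%:R^-1 * a) ^+ 2 + (q.+1%:R^-1 * a') ^+ 2 +
        ((q.+1%:R^-1 * b) ^+ 2 + (q.+1%:R^-1 * b') ^+ 2)) -
        ((h' / q.+1%:R * (a + b)) ^+ 2 + (h' / q.+1%:R * (a' + b')) ^+ 2) =
        (h' / q.+1%:R) ^+ 2 * ((a - b) ^+ 2 + (a' - b') ^+ 2) by ring.
    by apply: mulr_ge0; [exact: sqr_ge0|apply: addr_ge0; exact: sqr_ge0].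
  apply: (@le_trans _ _ ((2 * h' ^+ 2 * (V 0 q w + V 1 q w)) ^+ n)).
    by rewrite lerXn2r// nnegrE ?(le_trans (Z0 q w) ZV1).
  rewrite exprMn (_ : 4 * h' ^+ 2 = 2 * h' ^+ 2 * 2); last by ring.
  rewrite [in leRHS]exprMn -mulrA ler_wpM2l ?(exprn_ge0 _ h'2)//.
  exact: expr_add_le.
have EZ q : \int[P]_w (Z q w ^+ n) <= 2 * K * (4 * (h * L)) ^+ n.
  apply: (@le_trans _ _ (\int[P]_w ((4 * h' ^+ 2) ^+ n * (V 0 q w ^+ n + V 1 q w ^+ n)))).
    apply: le_Rintegral => //; apply: bounded_rv_integrable => //.
    by apply: bounded_rvM; [exact: bounded_rv_cst|exact: bounded_rvD].
  rewrite RintegralZl//; last by apply: bounded_rv_integrable; exact: bounded_rvD.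
  rewrite RintegralD//; try exact: bounded_rv_integrable.
  apply: (@le_trans _ _ ((4 * h' ^+ 2) ^+ n * (K * N%:R ^+ n + K * N%:R ^+ n))).
    rewrite ler_wpM2l ?(exprn_ge0 _ h'4)// lerD//; exact: momb.
  rewrite (_ : _ * _ = 2 * K * (4 * h' ^+ 2 * N%:R) ^+ n); last by rewrite [in RHS]exprMn; ring.
  rewrite ler_wpM2l ?mulr_ge0//; apply: lerXn2r; rewrite ?nnegrE.
  - by apply: mulr_ge0.
  - by apply: mulr_ge0 => //; apply: mulr_ge0; exact: ltW.
  have -> : 4 * h' ^+ 2 * N%:R = 2 * h' * (h' * (2 * N%:R)) by ring.
  rewrite {2}/h' divfK ?mulf_neq0 ?gt_eqF// mulrA ler_wpM2r ?(ltW L0)//; lra.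
(* Since (|c| + |s|)^2 <= 2 (c^2 + s^2), an oscillation above [kappa] forces c^2 + s^2 above kappa^2
   / 2. *)
pose D q := [set w | (kappa ^+ 2 / 2) ^+ n < Z q w ^+ n].
have k2 : 0 < kappa ^+ 2 / 2 by rewrite divr_gt0 ?exprn_gt0.
have mD q : measurable (D q).
  have [mZ _] := bZ q.
  have := mZ measurableT `](kappa ^+ 2 / 2) ^+ n, +oo[%classic (measurable_itv _); rewrite setTI.
  rewrite (_ : _ @^-1` _ = D q)//.
  by apply/seteqP; split=> w /=; rewrite /D /= in_itv/= andbT.
have PD q : (P (D q) <= (2 * 8 ^+ n * K * (h * L / kappa ^+ 2) ^+ n)%:E)%E.
  apply: le_trans (markov_bounded_rv (bZ q) _ (exprn_gt0 n k2)) _.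
    by move=> w; rewrite exprn_ge0.
  rewrite lee_fin ler_pdivrMr ?exprn_gt0// (le_trans (EZ q))//.
  have -> : 2 * 8 ^+ n * K * (h * L / kappa ^+ 2) ^+ n * (kappa ^+ 2 / 2) ^+ n =
    2 * K * ((8 * (h * L / kappa ^+ 2) * (kappa ^+ 2 / 2)) ^+ n) by rewrite !exprMn; ring.
  rewrite (_ : 8 * _ * _ = 4 * (h * L))//.
  by field; rewrite gt_eqF.
have [mB PB] := probability_eventually_le mD PD.
exists (\bigcup_Q \bigcap_(q in [set q | (Q <= q)%N]) D q); split => // w cw nB.
rewrite leNgt; apply/negP => kosc; apply: nB.
have cwc (f : R -> R) : continuous f -> {within `[0, T], continuous (fun r => f (dot xi (X r w)))}.
  move=> cf; apply: (@within_continuous_comp _ _ (X ^~ w) (fun v => f (dot xi v))) => // v.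
  by apply: continuous_comp; [exact: continuous_dot|exact: cf].
have sNT : s + (2 * N)%:R * h' <= T by rewrite sN.
have cvgf (f : R -> R) : continuous f -> (forall x, `|f x| <= 1) ->
   h' / q.+1%:R * (\sum_(p <- concat_blocks (blocks 0 q) N) f (Y p w) +
  \sum_(p <- concat_blocks (blocks 1 q) N) f (Y p w)) @[q --> \oo] -->
   \int[mu]_(x in `[s, t]) f (dot xi (X x w)).
  move=> cf f1.
  have := cvg_riemann_blocks (N := N) (cwc f cf) (fun x => f1 _) h'0 s0 sNT.
  rewrite sN; apply: cvg_trans; apply: near_eq_cvg; apply: nearW => q.
  have E b u : (b <= 1)%N -> (forall j, u j = blocks b q j) ->
    \sum_(p <- concat_blocks u N) f (dot xi (X p w)) =
    \sum_(p <- concat_blocks (blocks b q) N) f (Y p w).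
    move=> b1 /funext ->; rewrite big_seq [RHS]big_seq; apply: eq_bigr => p.
    move=> /mem_concat_blocks[i iN pi]; have [_ _ sp pt] := blk _ _ _ _ iN b1 pi.
    by rewrite /Y (le_trans s0 sp) (le_trans pt tT).
  rewrite (E 0%N)//; last by move=> j; rewrite /blocks addn0.
  by rewrite (E 1%N)// => j; rewrite /blocks addn1.
have cC := cvgf cos (@continuous_cos R) (@cos_max R).
have cS := cvgf sin (@continuous_sin R) (@sin_max R).
have cZ : Z q w @[q --> \oo] --> cos_int (X ^~ w) xi s t ^+ 2 + sin_int (X ^~ w) xi s t ^+ 2.
  by apply: cvgD; rewrite expr2; under eq_fun do rewrite expr2; apply: cvgM.
have lim : kappa ^+ 2 / 2 < cos_int (X ^~ w) xi s t ^+ 2 + sin_int (X ^~ w) xi s t ^+ 2.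
  rewrite -[cos_int _ _ _ _ ^+ 2]real_normK ?num_real// -[sin_int _ _ _ _ ^+ 2]real_normK ?num_real//.
  move: kosc; rewrite /osc.
  set a := `|_|; set b := `|_| => kab.
  have := sqr_ge0 (a - b).
  have : kappa ^+ 2 < (a + b) ^+ 2 by rewrite ltrXn2r// ltW.
  rewrite !expr2; lra.
have [Q _ HQ] : \forall q \near \oo, kappa ^+ 2 / 2 < Z q w by move: cZ => /cvgr_gt; exact.
by exists Q => // q /= Qq; rewrite /D /= ltrXn2r ?(ltW k2) -?lt0n//; exact: HQ.
Qed.

End Tail.

(** * Frequency and time grids *)

Section Assembly.
Context {R : realType} {dO : measure_display} {Omega : measurableType dO}.
Variable P : probability Omega R.
Notation mu := (@lebesgue_measure R).

(** Borel-Cantelli, the series being bounded through 1 / x^2 <= 2 (1 / x - 1 / (x + 1)) for x >= 1.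
    [V] discards the indices below [m1], where no bound is given. *)
Lemma ae_eventually_notin (U : nat -> set Omega) (C : R) (m1 : nat) :
  (forall m, measurable (U m)) ->
  (forall m, (m1 <= m)%N -> (P (U m) <= (C / m.+1%:R ^+ 2)%:E)%E) ->
  \forall w \ae P, exists M, forall m, (M <= m)%N -> ~ U m w.
Proof.
move=> mU PU; pose V m := if (m1 <= m)%N then U m else set0.
have mV m : measurable (V m) by rewrite /V; case: ifP.
have C0 : 0 <= C.
  have := le_trans (measure_ge0 P _) (PU m1 (leqnn _)).
  by rewrite lee_fin pmulr_lge0// invr_gt0 exprn_gt0.
have PV m : (P (V m) <= (C / m.+1%:R ^+ 2)%:E)%E.
  rewrite /V; case: ifP => [|_]; first exact: PU.
  by rewrite measure0 lee_fin divr_ge0 ?sqr_ge0.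
have sumV n : (\sum_(0 <= m < n) P (V m) <= (2 * C * (1 - n.+1%:R^-1))%:E)%E.
  elim: n => [|n IH]; first by rewrite big_geq// invr1 subrr mulr0.
  rewrite big_nat_recr//=; apply: le_trans (leeD IH (PV n)) _.
  rewrite -EFinD lee_fin -[n.+2%:R]natr1.
  have n0 : (1 : R) <= n.+1%:R by rewrite ler1n.
  set x := n.+1%:R in n0 *.
  rewrite -subr_ge0.
  have -> : 2 * C * (1 - (x + 1)^-1) - (2 * C * (1 - x^-1) + C / x ^+ 2) =
     C * (x - 1) / (x ^+ 2 * (x + 1)) by field; lra.
  by rewrite divr_ge0 ?mulr_ge0 ?sqr_ge0//; lra.
have V0 : P (lim_sup_set V) = 0%E.
  apply: lim_sup_set_cvg0 => //; apply: (@le_lt_trans _ _ (2 * C)%:E); last exact: ltry.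
  apply: lime_le; first by apply: is_cvg_nneseries => *; exact: measure_ge0.
  apply: nearW => n; apply: le_trans (sumV n) _; rewrite lee_fin.
  by rewrite -[leRHS]mulr1 ler_wpM2l ?mulr_ge0// lerBlDr lerDl.
have mL : measurable (lim_sup_set V).
  by apply: bigcap_measurable => [|n _]; [exists 0%N|apply: bigcup_measurable].
exists (lim_sup_set V); split => // w; rewrite /= => nU.
apply: contrapT => nV; apply: nU.
have [n _ nVn] : exists2 n, True & ~ (\bigcup_(j >= n) V j) w.
  by apply: contrapT => H; apply: nV => n _; apply: contrapT => H'; apply: H; exists n.
exists (maxn n m1) => m; rewrite geq_max => /andP[nm m1m] Um.
by apply: nVn; exists m => //; rewrite /V m1m.
Qed.

Lemma probability_bigsetU_le (I : finType) (B : I -> set Omega) (p : R) :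
  (forall i, measurable (B i)) -> (forall i, (P (B i) <= p%:E)%E) ->
  measurable (\bigcup_(i in [set: I]) B i) /\
  (P (\bigcup_(i in [set: I]) B i) <= (#|I|%:R * p)%:E)%E.
Proof.
move=> mB PB; have -> : \bigcup_(i in [set: I]) B i = \big[setU/set0]_(i <- enum I) B i.
  rewrite -bigcup_seq; apply/seteqP; split => w [i _ Bi]; exists i => //=.
  by rewrite mem_enum.
rewrite cardE; elim: (enum I) => [|i r [mr Pr]].
  by rewrite big_nil mul0r measure0.
rewrite big_cons/=; split; first exact: measurableU.
apply: le_trans (measureU2 _ (mB i) mr) _.
rewrite -(natr1 (size r)) mulrDl mul1r EFinD addeC; exact: leeD (PB i) Pr.
Qed.

Lemma norm_coord_le_enorm (d : nat) (xi : 'rV[R]_d) (i : 'I_d) : `|xi 0 i| <= enorm xi.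
Proof.
rewrite -sqrtr_sqr ler_sqrt ?dot_ge0// /dot (bigD1 i)//= -expr2 lerDl.
by apply: sumr_ge0 => j _; rewrite -expr2 sqr_ge0.
Qed.

(** A shift by m + 1 puts each coordinate in [0, 2 (m + 1)] before rounding down, whence 2 k (m + 1)
    + 1 values. *)
Lemma frequency_grid (d k m : nat) (xi : 'rV[R]_d) : (0 < k)%N -> enorm xi < m.+1%:R ->
  exists z : {ffun 'I_d -> 'I_(2 * (k * m.+1)).+1},
    forall i, `|xi 0 i - ((z i : nat)%:R / k%:R - m.+1%:R)| <= k%:R^-1.
Proof.
move=> k0 xim.
have x0 i : 0 <= xi 0 i + m.+1%:R.
  by have := norm_coord_le_enorm xi i; rewrite ler_norml => /andP[]; lra.
have kr0 : (0 : R) < k%:R by rewrite ltr0n.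
have zlt i : (Num.truncn (k%:R * (xi 0 i + m.+1%:R))%R < (2 * (k * m.+1)).+1)%N.
  rewrite ltnS truncn_le_nat -(natr1 (2 * (k * m.+1))) mulnCA natrM.
  have : xi 0 i + m.+1%:R <= (2 * m.+1)%:R.
    by have := norm_coord_le_enorm xi i; rewrite ler_norml natrM => /andP[]; lra.
  by move=> /(ler_wpM2l (ltW kr0)); lra.
exists [ffun i => Ordinal (zlt i)] => i; rewrite ffunE/=.
have [_ g1 g2] := truncn_grid k0 (x0 i).
rewrite opprB addrA ger0_norm; lra.
Qed.

(** A grid frequency may leave the shell but stays of order m: |xi|^2 <= 2 |xi'|^2 + 2 d, and m > 4
    d absorbs the term 2 d. *)
Lemma dot_ge_of_near (d m : nat) (xi xi' : 'rV[R]_d) : (forall i, `|xi 0 i - xi' 0 i| <= 1) ->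
  m%:R <= enorm xi -> (4 * d < m)%N -> m%:R ^+ 2 / 4 <= dot xi' xi'.
Proof.
move=> near mxi dm.
have dotle : dot xi xi <= 2 * dot xi' xi' + 2 * d%:R.
  rewrite /dot mulr_sumr (_ : 2 * d%:R = \sum_(i < d) 2); last first.
    by rewrite sumr_const card_ord -[2 *+ d]mulr_natr.
  rewrite -big_split/=; apply: ler_sum => i _.
  have := near i; rewrite ler_norml => /andP[a b].
  have := sqr_ge0 (2 * xi' 0 i - xi 0 i).
  have : (xi 0 i - xi' 0 i) ^+ 2 <= 1.
    by rewrite -real_normK ?num_real// expr_le1.
  by rewrite !expr2; lra.
have : m%:R ^+ 2 <= dot xi xi.
  by rewrite -enorm_sqr lerXn2r ?nnegrE// (le_trans _ mxi).
have m1 : (1 : R) <= m%:R by rewrite ler1n (leq_ltn_trans _ dm).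
have : (4 * d)%:R <= m%:R :> R by rewrite ler_nat ltnW.
have : (m%:R : R) <= m%:R ^+ 2 by rewrite expr2 ler_peMl// (le_trans ler01).
by rewrite natrM; lra.
Qed.

(** With k of order 1 / tau there are at most a constant times (k (m + 1))^d k^2 grid data, so
    failure probabilities of order (tau / (m + 1))^(d + 2) add up to order (m + 1)^(-2), which is
    summable. The margins tau / 2 and 2 delta allow for the rounding of times. *)
Lemma as_shell_bound (d : nat) (T : R) (X : R -> Omega -> 'rV[R]_d) (good : set Omega)
    (gamma delta C0 C : R) (tau p : nat -> R) (m1 : nat) :
  0 < T -> 2^-1 <= gamma < 1 -> 0 < delta -> 0 <= C0 -> 0 <= C ->
  (forall m, 0 < tau m <= 1) -> (forall m, (m1 <= m)%N -> tau m <= delta) ->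
  (forall m, 0 <= p m) ->
  (forall m, p m <= C * (tau m / m.+1%:R) ^+ (d + 2)) ->
  (forall m xi s t, (m1 <= m)%N -> m%:R ^+ 2 / 4 <= dot xi xi -> 0 <= s -> t <= T ->
     tau m / 2 <= t - s -> t - s < 2 * delta -> exists B, [/\ measurable B, (P B <= (p m)%:E)%E &
     forall w, good w -> ~ B w ->
       osc (X ^~ w) xi s t <= C0 * Num.sqrt (tau m) * Num.sqrt (t - s)]) ->
  (\forall w \ae P, [/\ good w, measurable_path T (X ^~ w) &
     forall i, mu.-integrable `[0, T] (EFin \o (fun r => X r w 0 i))]) ->
  \forall w \ae P, exists2 K : R, 0 < K & forall m xi s t,
    m%:R <= enorm xi -> enorm xi < m.+1%:R -> 0 <= s <= T -> 0 <= t <= T ->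
    ComplexField.Normc.normc (Phi (X ^~ w) s t xi) <=
    K * (tau m `^ (1 - gamma) * `|t - s| `^ gamma).
Proof.
move=> T0 g01 d0 C00 C0' tau01 taud p0 pC H Hgood.
(* A total choice of exceptional sets, empty where the hypotheses of [H] fail. *)
have /choice[B HB] : forall q : nat * 'rV[R]_d * R * R, exists B : set Omega,
    [/\ measurable B, (P B <= (p q.1.1.1)%:E)%E &
    (m1 <= q.1.1.1)%N -> q.1.1.1%:R ^+ 2 / 4 <= dot q.1.1.2 q.1.1.2 ->
    0 <= q.1.2 -> q.2 <= T -> tau q.1.1.1 / 2 <= q.2 - q.1.2 -> q.2 - q.1.2 < 2 * delta ->
    forall w, good w -> ~ B w ->
       osc (X ^~ w) q.1.1.2 q.1.2 q.2 <= C0 * Num.sqrt (tau q.1.1.1) * Num.sqrt (q.2 - q.1.2)].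
  move=> [[[m xi] s] t] /=.
  have [hyp|hyp] := EM [/\ (m1 <= m)%N, m%:R ^+ 2 / 4 <= dot xi xi & [/\ 0 <= s, t <= T,
     tau m / 2 <= t - s & t - s < 2 * delta]].
    by case: hyp => a1 a2 [a3 a4 a5 a6]; have [B [b1 b2 b3]] := H m xi s t a1 a2 a3 a4 a5 a6; exists B.
  exists set0; rewrite measure0 lee_fin p0; split => // *.
  by exfalso; apply: hyp.
(* This gives tau / 2 <= 1 / k < tau. *)
pose k m := (Num.truncn (tau m)^-1).+1.
pose M m := (Num.truncn ((k m)%:R * T)).+1.
pose I m := ({ffun 'I_d -> 'I_(2 * (k m * m.+1)).+1} * 'I_(M m) * 'I_(M m))%type.
pose fr m (z : 'I_d -> nat) : 'rV[R]_d := \row_i ((z i)%:R / (k m)%:R - m.+1%:R).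
pose BI m (i : I m) := B (m, fr m (fun j => i.1.1 j), i.1.2%:R / (k m)%:R, i.2%:R / (k m)%:R).
pose U m := \bigcup_(i in [set: I m]) BI m i.
have mBI m i : measurable (BI m i) by have [] := HB (m, fr m (fun j => i.1.1 j), i.1.2%:R / (k m)%:R, i.2%:R / (k m)%:R).
have PBI m i : (P (BI m i) <= (p m)%:E)%E by have [] := HB (m, fr m (fun j => i.1.1 j), i.1.2%:R / (k m)%:R, i.2%:R / (k m)%:R).
have k0 m : (0 : R) < (k m)%:R by rewrite ltr0n.
have k1 m : (1 : R) <= (k m)%:R by rewrite ler1n.
have ktau m : (k m)%:R <= 2 / tau m.
  have /andP[t0 t1] := tau01 m.
  have tV : 1 <= (tau m)^-1 by rewrite invf_ge1.
  have : (Num.truncn (tau m)^-1)%:R <= (tau m)^-1 by rewrite truncn_le (le_trans ler01).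
  rewrite /k -(natr1 (Num.truncn _)); lra.
have tauk m : (k m)%:R^-1 < tau m.
  have /andP[t0 t1] := tau01 m.
  by rewrite invf_plt ?posrE// truncnS_gt.
have tauk2 m : tau m / 2 <= (k m)%:R^-1.
  have /andP[t0 t1] := tau01 m.
  by rewrite -[tau m / 2]invrK lef_pV2 ?posrE ?invr_gt0 ?divr_gt0// invf_div.
have cardI m : #|{: I m}|%:R <= (3 * ((k m)%:R * m.+1%:R)) ^+ d * ((k m)%:R * (T + 1)) ^+ 2.
  have M1 : (M m)%:R <= (k m)%:R * (T + 1).
    have : (Num.truncn ((k m)%:R * T))%:R <= (k m)%:R * T by rewrite truncn_le mulr_ge0// ltW.
    rewrite /M -(natr1 (Num.truncn _)) mulrDr; have := k1 m; lra.
  have N1 : (2 * (k m * m.+1)).+1%:R <= 3 * ((k m)%:R * m.+1%:R) :> R.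
    have : 1 <= (k m)%:R * m.+1%:R :> R by rewrite -natrM ler1n muln_gt0.
    rewrite -(natr1 (2 * _)) !natrM; set x := _ * _; lra.
  rewrite !card_prod card_ffun !card_ord !natrM -mulrA natrX -expr2.
  apply: ler_pM; rewrite ?exprn_ge0//.
    by apply: lerXn2r (N1); rewrite nnegrE ?ler0n// (le_trans _ N1).
  by apply: lerXn2r (M1); rewrite nnegrE ?ler0n// (le_trans _ M1).
pose C' := 3 ^+ d * (T + 1) ^+ 2 * 2 ^+ (d + 2) * C.
have PU m : measurable (U m) /\ (P (U m) <= (C' / m.+1%:R ^+ 2)%:E)%E.
  have [mU PU] := probability_bigsetU_le (mBI m) (PBI m); split => //.
  apply: le_trans PU _; rewrite lee_fin.
  have /andP[t0 t1] := tau01 m.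
  have m0 : (0 : R) < m.+1%:R by rewrite ltr0n.
  apply: (@le_trans _ _ ((3 * ((k m)%:R * m.+1%:R)) ^+ d * ((k m)%:R * (T + 1)) ^+ 2 *
    (C * (tau m / m.+1%:R) ^+ (d + 2)))); first by rewrite ler_pM.
  rewrite (_ : _ * _ = 3 ^+ d * (T + 1) ^+ 2 * C * (k m)%:R ^+ (d + 2) * tau m ^+ (d + 2) /
     m.+1%:R ^+ 2); last first.
    rewrite !exprMn exprVn !exprD; field.
    by rewrite expf_neq0 ?gt_eqF.
  rewrite ler_pM2r ?invr_gt0 ?exprn_gt0//.
  rewrite -[leLHS]mulrA -exprMn /C' -[leRHS]mulrA [2 ^+ _ * C]mulrC [leRHS]mulrA.
  rewrite ler_wpM2l//.
    by rewrite !mulr_ge0 ?exprn_ge0// addr_ge0// ltW.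
  by apply: lerXn2r; rewrite ?nnegrE ?mulr_ge0 ?(ltW (k0 m)) ?(ltW t0)// -ler_pdivlMr.
have ae1 := ae_eventually_notin (m1 := 0) (fun m => (PU m).1) (fun m _ => (PU m).2).
apply: filterS2 ae1 Hgood => w [m2 Hm2] [gw mw iw].
pose C1 := 2 * C0 + (4 + 2 * path_mass T (X ^~ w)).
have pm0 : 0 <= path_mass T (X ^~ w).
  apply: sumr_ge0 => i _; exact: Rintegral_ge0.
have C10 : 0 <= C1 by rewrite /C1; lra.
apply: (@regularity_of_shells _ _ _ _ mw gamma delta C1 tau (maxn (maxn m1 m2) (4 * d).+1)) => //.
move=> m xi s t; rewrite !geq_max => /andP[/andP[m1m m2m] dm] mxi xim s0 st tT taust std.
have [t0 t1] := andP (tau01 m).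
have [z zxi] := frequency_grid (ltn0Sn _ : 0 < k m)%N xim.
have sq0 := sqrtr_ge0 (tau m).
have near1 : forall i, `|xi 0 i - fr m (fun j => z j) 0 i| <= (k m)%:R^-1.
  by move=> i; rewrite mxE.
apply: (le_trans (osc_time_grid mw iw (ltn0Sn _ : 0 < k m)%N
   (K := C0 * Num.sqrt (tau m)) (delta := 2 * delta) _ near1 _ s0 st tT _ _)).
- exact: mulr_ge0.
- move=> a b ab bT abd.
  have bM : (b < M m)%N.
    by rewrite /M ltnS truncn_ge_nat ?(mulr_ge0 _ (ltW T0))// -ler_pdivrMl// mulrC.
  pose i : I m := (z, Ordinal (ltn_trans ab bM), Ordinal bM).
  have [_ _ /= Hi] := HB (m, fr m (fun j => i.1.1 j), i.1.2%:R / (k m)%:R, i.2%:R / (k m)%:R).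
  apply: Hi => //.
  + apply: (@dot_ge_of_near _ _ xi) => // j; apply: le_trans (near1 j) _.
    by rewrite invf_le1.
  + rewrite -mulrBl (le_trans (tauk2 m))// ler_peMl ?invr_ge0 ?(ltW (k0 m))//.
    by rewrite lerBrDr addrC natr1 ler_nat.
  + by move=> Bw; apply: (Hm2 m m2m); exists i.
- exact: le_trans (ltW (tauk m)) taust.
- have := tauk m; have := taud m m1m; lra.
rewrite /C1 [leRHS]mulrDl; apply: lerD.
  by rewrite [2 * (_ * _)]mulrA -[leLHS]mulrA ler_wpM2l ?mulr_ge0// lerDl ltW.
rewrite ler_wpM2l ?addr_ge0 ?mulr_ge0//.
by rewrite (le_trans (ltW (tauk m)))// lerDr mulr_ge0 ?sqrtr_ge0.
Qed.

End Assembly.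

(** * Powers and exponentials for large m *)

Section Asymptotics.
Context {R : realType}.

Lemma ge_powR_eventually (a M : R) : 0 < a ->
  exists m1 : nat, forall m, (m1 <= m)%N -> M <= m.+1%:R `^ a.
Proof.
move=> a0; exists (Num.truncn (Num.max M 0 `^ a^-1)) => m m1m.
have M0 : 0 <= Num.max M 0 by rewrite le_max lexx orbT.
apply: (@le_trans _ _ (Num.max M 0)); first by rewrite le_max lexx.
have {1}-> : Num.max M 0 = (Num.max M 0 `^ a^-1) `^ a.
  by rewrite -powRrM mulVf ?gt_eqF// powRr1.
rewrite ge0_ler_powR ?nnegrE ?powR_ge0 ?(ltW a0)//.
by rewrite ltW// (lt_le_trans (truncnS_gt _))// ler_nat ltnS.
Qed.

Lemma powRN_le_eventually (a e : R) : 0 < a -> 0 < e ->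
  exists m1 : nat, forall m, (m1 <= m)%N -> m.+1%:R `^ (- a) <= e.
Proof.
move=> a0 e0; have [m1 H] := ge_powR_eventually e^-1 a0; exists m1 => m /H.
by rewrite powRN -[X in _ -> _ <= X]invrK lef_pV2 ?posrE ?invr_gt0 ?powR_gt0.
Qed.

(** With y = (m + 1)^a, the inequality exp z >= (z / (k + 1))^(k + 1) provides one power of y more
    than y^k, which already dominates (m + 1)^b because b <= a k. *)
Lemma powR_expRN_eventually (A b a c : R) : 0 <= A -> 0 < a -> 0 < c ->
  exists m1 : nat, forall m, (m1 <= m)%N ->
    A * m.+1%:R `^ b * expR (- (c * m.+1%:R `^ a)) <= 1.
Proof.
move=> A0 a0 c0; pose k := (Num.truncn (b / a)).+1.
have bk : b <= a * k%:R by rewrite mulrC -ler_pdivrMr// ltW// truncnS_gt.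
have N0 : (0 : R) < k.+1%:R by rewrite ltr0n.
have [m1 H] := ge_powR_eventually (A * (k.+1%:R / c) ^+ k.+1) a0.
exists m1 => m /H; set y := m.+1%:R `^ a => Hy.
have y0 : 0 < y by rewrite powR_gt0.
have x1 : (1 : R) <= m.+1%:R by rewrite ler1n.
have : m.+1%:R `^ b <= y ^+ k.
  by rewrite -powR_mulrn ?(ltW y0)// -powRrM ler_powR.
move=> /(ler_wpM2l A0) /le_trans; rewrite expRN ler_pdivrMr ?expR_gt0// mul1r; apply.
have E : (c * y / k.+1%:R) ^+ k.+1 <= expR (c * y).
  rewrite -{2}(divfK (lt0r_neq0 N0) (c * y)) mulrC [X in expR X]mulrC expRM_natl.
  apply: lerXn2r; rewrite ?nnegrE ?expR_ge0//.
    by rewrite !mulr_ge0 ?invr_ge0// ltW.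
  by apply: le_trans (expR_ge1Dx _); rewrite lerDr.
apply: le_trans E.
have -> : (c * y / k.+1%:R) ^+ k.+1 = (c / k.+1%:R) ^+ k.+1 * (y * y ^+ k).
  by rewrite -exprS -exprMn; congr (_ ^+ _); ring.
rewrite mulrA ler_wpM2r ?exprn_ge0 ?(ltW y0)//.
have q0 : 0 < (c / k.+1%:R) ^+ k.+1 by rewrite exprn_gt0// divr_gt0.
by rewrite mulrC -ler_pdivrMr// -exprVn invf_div.
Qed.

End Asymptotics.

(** * Continuous processes under [SLND] or [LND] *)

Section Processes.
Context {R : realType} {dO : measure_display} {Omega : measurableType dO}.
Variable P : probability Omega R.
Notation mu := (@lebesgue_measure R).

(** A common form of both hypotheses: [SLND] is applied at time r - h and uses h < delta, [LND] uses
    that all times lie within [delta] of [r]. *)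
Lemma local_nondeterminism_cos_le (d : nat) (T : R) (F : R -> set (set Omega))
    (X : R -> Omega -> 'rV[R]_d) (beta : R) (N : nat) :
  0 < beta -> adapted_gaussian_process P T F X -> SLND P T F X beta \/ LND P T X beta ->
  exists c delta : R, [/\ 0 < c, 0 < delta &
    forall xi l (r h : R), 0 < h -> h < delta -> r <= T -> (size l < N)%N ->
      \sum_(p <- l) p.1 = -1 ->
      (forall p, p \in l -> [/\ 0 <= p.2, p.2 <= r - h & r - p.2 < delta]) ->
      `|\int[P]_w cos (lincomb X xi ((1, r) :: l) w)| <=
      expR (- (c * h `^ (2 * beta) * dot xi xi / 2))].
Proof.
move=> b0 agX [[delta [c [d0 c0 H]]]|LX]; last first.
  have [_ _ gX _] := agX.
  have [c [delta [c0 d0 H]]] := LND_cos_le N b0 gX LX.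
  exists c, delta; split => // xi l r h h0 _ rT lN l1 lr.
  have := H xi l r h 0 h0 rT lN l1 lr.
  by under eq_Rintegral do rewrite addr0.
exists c, delta; split => // xi l r h h0 hd rT lN l1 lr.
have rh0 : 0 <= r - h.
  case: l l1 lr {lN} => [|p l _ /(_ p)]; last by rewrite mem_head => /(_ isT)[p1 p2 _]; rewrite (le_trans p1).
  by rewrite big_nil => /eqP; rewrite eq_sym oppr_eq0 oner_eq0.
have rhr : r - h <= r by rewrite lerBlDr lerDl ltW.
have := @cond_var_cos_le _ _ _ P d T F X xi l (r - h) r (c * h `^ (2 * beta)) 0 agX rh0 rhr rT.
under eq_Rintegral do rewrite addr0.
apply.
  have := H (r - h) r; rewrite (_ : r - (r - h) = h) ?ger0_norm ?(ltW h0)//; last by ring.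
  apply.
  - by rewrite rh0 (le_trans rhr).
  - by rewrite rT (le_trans rh0).
  - by rewrite h0.
by move=> p /lr[-> ->].
Qed.

Lemma gaussian_measurable_dot (d : nat) (T : R) (X : R -> Omega -> 'rV[R]_d) (xi : 'rV[R]_d) (p : R) :
  gaussian_process P T X -> 0 <= p <= T -> measurable_fun setT (fun w => dot xi (X p w)).
Proof.
move=> gX pT; have := gaussian_lincomb xi (l := [:: (1, p)]) gX.
case=> [q|mX _]; first by rewrite inE => /eqP ->.
apply: eq_measurable_fun mX => w _.
by rewrite /lincomb big_cons big_nil /= mul1r addr0.
Qed.

Lemma continuous_path_integrable (d : nat) (T : R) (w : R -> 'rV[R]_d) (i : 'I_d) :
  {within `[0, T], continuous w} -> mu.-integrable `[0, T] (EFin \o (fun r => w r 0 i)).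
Proof.
move=> cw; apply: continuous_compact_integrable; first exact: segment_compact.
apply: (within_continuous_comp (f := fun v : 'rV[R]_d => v 0 i)) => //.
exact: coord_continuous.
Qed.

(** Taking kappa = sqrt (tau (t - s)) in [osc_tail] turns its bound into C (h / tau)^n, a power of x
    = m + 1 with exponent - n (theta' - theta). *)
Lemma continuous_shell_tail (d : nat) (T : R) (F : R -> set (set Omega))
    (X : R -> Omega -> 'rV[R]_d) (beta theta theta' : R) :
  0 < T -> 0 < beta -> 0 < theta -> theta < theta' -> theta' * beta < 1 ->
  adapted_gaussian_process P T F X -> SLND P T F X beta \/ LND P T X beta ->
  exists C delta : R, exists m1, [/\ 0 <= C, 0 < delta,
    forall m, (m1 <= m)%N -> m.+1%:R `^ (- theta) <= delta &
    forall m xi s t, (m1 <= m)%N -> m%:R ^+ 2 / 4 <= dot xi xi -> 0 <= s -> t <= T ->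
      m.+1%:R `^ (- theta) / 2 <= t - s -> t - s < 2 * delta ->
      exists B, [/\ measurable B,
        (P B <= (C * (m.+1%:R `^ (- theta) / m.+1%:R) ^+ (d + 2))%:E)%E &
        forall w, {within `[0, T], continuous (X ^~ w)} -> ~ B w ->
          osc (X ^~ w) xi s t <= 1 * Num.sqrt (m.+1%:R `^ (- theta)) * Num.sqrt (t - s)]].
Proof.
move=> T0 b0 th0 thth' thb agX LX.
have th'0 : 0 < theta' by exact: lt_trans thth'.
(* Chosen so that (h / tau)^n <= (tau / x)^(d + 2), as [as_shell_bound] demands. *)
pose n := (Num.truncn ((theta + 1) * (d + 2)%:R / (theta' - theta))).+1.
have hn : (theta + 1) * (d + 2)%:R <= (theta' - theta) * n%:R.
  by rewrite mulrC -[leRHS]mulrC -ler_pdivrMr ?subr_gt0// mulrC ltW// truncnS_gt.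
have [C C0 HC] := osc_tail P (ltn0Sn _ : 0 < n)%N.
have [c [delta [c0 delta0 Hchar]]] := local_nondeterminism_cos_le (2 * n).+1 b0 agX LX.
have e1 : 0 < theta' - theta by rewrite subr_gt0.
(* The order in x of h^(2 beta) |xi|^2, positive because theta' beta < 1. *)
pose a := 2 - 2 * beta * theta'.
have a0 : 0 < a by rewrite /a; lra.
(* From |xi|^2 >= m^2 / 4 and x <= 2 m comes |xi|^2 >= x^2 / 16; the half in the exponent makes
   32. *)
have c32 : 0 < c / 32 by rewrite divr_gt0.
have d20 : 0 < delta / 2 by rewrite divr_gt0.
have [m2 Hm2] := powRN_le_eventually th0 d20.
have [m3 Hm3] := ge_powR_eventually 4 e1.
have [m4 Hm4] := powRN_le_eventually th'0 d20.
have A0 : 0 <= (T / 2) ^+ (2 * n) by rewrite exprn_ge0// divr_ge0// ltW.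
have [m5 Hm5] := powR_expRN_eventually (theta' * (2 * n)%:R) A0 a0 c32.
(* Halving [delta] pays for the margin t - s < 2 delta, and m >= 1 gives x <= 2 m. *)
exists C, (delta / 2), (maxn 1 (maxn (maxn m2 m3) (maxn m4 m5))); split => //.
  by move=> m; rewrite !geq_max => /andP[_ /andP[/andP[/Hm2]]].
move=> m xi s t; rewrite !geq_max => /andP[m0 /andP[/andP[m2m m3m] /andP[m4m m5m]]] mxi s0 tT.
have := Hm3 m m3m; have := Hm4 m m4m; have := Hm5 m m5m.
have x1 : (1 : R) <= m.+1%:R by rewrite ler1n.
have mx : m.+1%:R <= 2 * m%:R :> R by rewrite -natrM ler_nat mul2n -addnn -addn1 leq_add2l.
set x : R := m.+1%:R in x1 mx *.
have x0 : 0 < x by rewrite (lt_le_trans _ x1).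
set tau := x `^ (- theta); set h := x `^ (- theta') => Heta hd H4 taust std.
have tau0 : 0 < tau by rewrite powR_gt0.
have h0 : 0 < h by rewrite powR_gt0.
have htau : h = tau / x `^ (theta' - theta).
  by rewrite /h /tau -powRN -powRD ?(gt_eqF x0) ?implybT//; congr (_ `^ _); ring.
have h4 : 4 * h <= tau.
  by rewrite htau mulrA ler_pdivrMr ?powR_gt0// mulrC ler_pM2l.
pose L := t - s; have L0 : 0 < L by rewrite (lt_le_trans _ taust)// divr_gt0.
have LT : L <= T by rewrite /L; lra.
pose eta := expR (- (c * h `^ (2 * beta) * dot xi xi / 2)).
have [] := HC d T X xi h eta s t (Num.sqrt tau * Num.sqrt L).
- by move=> p pT; case: agX => _ _ gX _; exact: gaussian_measurable_dot pT.
- exact: s0.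
- exact: tT.
- exact: h0.
- by rewrite (le_trans _ taust)//; lra.
- by rewrite mulr_gt0 ?sqrtr_gt0.
- exact: expR_ge0.
- apply: le_trans Heta.
  rewrite powRrM powR_mulrn ?powR_ge0// -exprMn.
  apply: ler_pM; rewrite ?exprn_ge0 ?expR_ge0 ?divr_ge0 ?(ltW L0) ?mulr_ge0 ?(ltW h0)//.
    apply: lerXn2r; rewrite ?nnegrE ?mulr_ge0 ?powR_ge0 ?invr_ge0 ?(ltW T0) ?(ltW L0)//.
      by rewrite mulr_ge0 // ltW.
    rewrite /h powRN invfM invrK mulrA ler_wpM2r ?powR_ge0// ler_wpM2r//.
  rewrite /eta ler_expR lerN2.
  have -> : x `^ a = h `^ (2 * beta) * x ^+ 2.
    rewrite /h -powRrM -powR_mulrn ?(ltW x0)// -powRD ?(gt_eqF x0) ?implybT//.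
    by congr (_ `^ _); rewrite /a; ring.
  have xx : x ^+ 2 / 16 <= dot xi xi.
    apply: le_trans mxi.
    have : x ^+ 2 <= (2 * m%:R) ^+ 2 by apply: lerXn2r; rewrite ?nnegrE ?mulr_ge0 ?(ltW x0).
    rewrite exprMn; lra.
  have hb0 : 0 <= c * h `^ (2 * beta) by rewrite mulr_ge0 ?powR_ge0 ?ltW.
  have := ler_wpM2l hb0 xx.
  set u := _ * dot xi xi; rewrite (_ : c / 32 * _ = c * h `^ (2 * beta) * (x ^+ 2 / 16) / 2); first lra.
  by field.
- move=> l r /andP[sr rt] ln l1 lr; apply: Hchar => //.
  + by rewrite (le_lt_trans hd)//; lra.
  + exact: le_trans tT.
  + by move=> p /lr[p1 p2]; split => //; [exact: le_trans p1|lra].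
move=> B [mB PB HB]; exists B; split => //; last first.
  by move=> w cw Bw; rewrite mul1r; exact: HB.
apply: le_trans PB _; rewrite lee_fin ler_wpM2l//.
rewrite [(_ * _) ^+ 2]exprMn !sqr_sqrtr ?(ltW tau0) ?(ltW L0)// -/L.
have -> : h * L / (tau * L) = x `^ (- (theta' - theta)).
  rewrite htau powRN; field.
  by rewrite !gt_eqF ?powR_gt0.
have -> : tau / x = x `^ (- (theta + 1)).
  rewrite /tau opprD powRD ?(gt_eqF x0) ?implybT// [x `^ (- 1)]powRN powRr1// ltW.
rewrite -!powR_mulrn ?powR_ge0// -!powRrM ler_powR// !mulNr lerN2.
exact: hn.
Qed.

Lemma continuous_process_irregular (d : nat) (T : R) (F : R -> set (set Omega))
    (X : R -> Omega -> 'rV[R]_d) (beta rho gamma : R) :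
  0 < T -> 0 < beta -> 0 < rho -> 2^-1 <= gamma < 1 -> rho * beta < 1 - gamma ->
  adapted_gaussian_process P T F X -> continuous_trajectories P T X ->
  SLND P T F X beta \/ LND P T X beta ->
  \forall w \ae P, irregular T gamma rho (fun t => X t w).
Proof.
move=> T0 b0 r0 g01 rb agX cX LX; have /andP[_ g1] := g01.
have g1' : 0 < 1 - gamma by rewrite subr_gt0.
(* This [theta] makes tau^(1 - gamma) equal to (m + 1)^(-rho). The condition rho beta < 1 - gamma
   says theta < 1 / beta and leaves room for theta' in between. *)
pose theta := rho / (1 - gamma); pose theta' := (theta + beta^-1) / 2.
have th0 : 0 < theta by rewrite divr_gt0.
have thb : theta < beta^-1 by rewrite ltr_pdivrMr// mulrC ltr_pdivlMr.
have thth' : theta < theta' by rewrite /theta'; lra.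
have th'b : theta' * beta < 1 by rewrite -ltr_pdivlMr// mul1r /theta'; lra.
have [C [delta [m1 [C0 d0 Hd H]]]] := continuous_shell_tail T0 b0 th0 thth' th'b agX LX.
pose tau m : R := m.+1%:R `^ (- theta).
have tau01 m : 0 < tau m <= 1.
  have x0 : (0 : R) < m.+1%:R by [].
  rewrite /tau powR_gt0//= powRN invf_le1 ?powR_gt0// -[leLHS](powRr0 m.+1%:R).
  by rewrite ler_powR ?ler1n ?(ltW th0).
have := @as_shell_bound _ _ _ P d T X [set w | {within `[0, T], continuous (X ^~ w)}]
  gamma delta 1 C tau (fun m => C * (tau m / m.+1%:R) ^+ (d + 2)) m1 T0 g01 d0 ler01 C0 tau01 Hd.
have p0 m : 0 <= C * (tau m / m.+1%:R) ^+ (d + 2).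
  by have /andP[t0 _] := tau01 m; rewrite mulr_ge0// exprn_ge0// divr_ge0// ltW.
move=> /(_ p0 (fun=> lexx _) H).
have good : \forall w \ae P, [/\ [set w | {within `[0, T], continuous (X ^~ w)}] w,
     measurable_path T (X ^~ w) &
     forall i, mu.-integrable `[0, T] (EFin \o (fun r => X r w 0 i))].
  apply: filterS cX => w cw; split => //; first exact: continuous_measurable_path.
  by move=> i; exact: continuous_path_integrable.
move=> /(_ good); apply: filterS => w [K K0 HK].
exists K => xi s t xi0 sT tT.
have x0 : 0 < enorm xi.
  rewrite lt_neqAle sqrtr_ge0 andbT eq_sym; apply: contra xi0 => /eqP xi0.
  by apply/eqP/rowP => i; rewrite mxE; apply/eqP; rewrite -normr_le0 -xi0 norm_coord_le_enorm.
pose m := Num.truncn (enorm xi).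
have mxi : m%:R <= enorm xi by rewrite truncn_le ltW.
have xim : enorm xi < m.+1%:R by exact: truncnS_gt.
apply: le_trans (HK m xi s t mxi xim sT tT) _.
rewrite -mulrA ler_wpM2l ?(ltW K0)// ler_wpM2r ?powR_ge0//.
rewrite /tau -powRrM mulNr divfK ?gt_eqF// !powRN lef_pV2 ?posrE ?powR_gt0//.
by rewrite ge0_ler_powR ?nnegrE ?ltW.
Qed.

End Processes.

(** * Jointly measurable processes *)

Section JointMeasurability.
Context {R : realType} {dO : measure_display} {Omega : measurableType dO}.
Variable P : probability Omega R.
Notation mu := (@lebesgue_measure R).

Lemma measurable_section_l (A : set R) (f : R * Omega -> R) (w : Omega) :
  measurable A -> measurable_fun (A `*` [set: Omega]) f ->
  measurable_fun A (fun r => f (r, w)).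
Proof.
move=> mA mf; apply: (measurable_comp (F := A `*` [set: Omega])) mf _.
- exact: measurableX.
- by move=> _ [r Ar <-].
- by apply: measurable_funS (pair2_measurable w).
Qed.

Lemma measurable_section_r (A : set R) (f : R * Omega -> R) (r : R) :
  measurable A -> A r -> measurable_fun (A `*` [set: Omega]) f ->
  measurable_fun setT (fun w => f (r, w)).
Proof.
move=> mA Ar mf; apply: (measurable_comp (F := A `*` [set: Omega])) mf _.
- exact: measurableX.
- by move=> _ [w _ <-].
- exact: pair1_measurable.
Qed.

(** The integrand is extended by zero to the whole product, where Fubini's theorem also yields the
    measurability of the partial integrals. *)
Lemma Rintegral_swap (A : set R) (f : R * Omega -> R) (M : R) :
  measurable A -> (mu A < +oo)%E -> measurable_fun (A `*` [set: Omega]) f ->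
  (forall p, `|f p| <= M) ->
  [/\ measurable_fun setT (fun w => \int[mu]_(r in A) f (r, w)),
      measurable_fun A (fun r => \int[P]_w f (r, w)) &
      \int[P]_w (\int[mu]_(r in A) f (r, w)) = \int[mu]_(r in A) (\int[P]_w f (r, w))].
Proof.
move=> mA A_fin mf fM.
pose g : R * Omega -> \bar R := EFin \o (f \_ (A `*` [set: Omega])).
have mg : measurable_fun setT g.
  apply/measurable_EFinP; apply/(measurable_restrict _ _ _).1 => //.
    exact: measurableX.
  by rewrite setTI.
have gA r w : A r -> g (r, w) = (f (r, w))%:E.
  by move=> Ar; rewrite /g /= patchT// inE.
have gNA r w : ~ A r -> g (r, w) = 0%E.
  by move=> Ar; rewrite /g /= patchN// notin_setE => -[].
have M0 : 0 <= M := le_trans (normr_ge0 _) (fM point).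
have ifl w : mu.-integrable A (EFin \o (fun r => f (r, w))).
  apply: (@integrable_bounded _ _ _ _ _ M) => //; exact: measurable_section_l.
have ifr r : A r -> P.-integrable setT (EFin \o (fun w => f (r, w))).
  move=> Ar; apply: (@integrable_bounded _ _ _ _ _ M) => //; last exact: measurable_section_r mf.
  by rewrite (le_lt_trans (probability_le1 _ _)) ?ltry.
have E1 w : (\int[mu]_r g (r, w) = (\int[mu]_(r in A) f (r, w))%R%:E)%E.
  rewrite /Rintegral fineK; last exact: integrable_fin_num (ifl w).
  rewrite [RHS]integral_mkcond; apply: eq_integral => r _.
  have [Ar|nAr] := EM (A r); first by rewrite patchT ?inE// gA.
  by rewrite patchN ?notin_setE// gNA.
have E2 r : A r -> (\int[P]_w g (r, w) = (\int[P]_w f (r, w))%R%:E)%E.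
  move=> Ar; rewrite /Rintegral fineK; last exact: integrable_fin_num (ifr r Ar).
  by apply: eq_integral => w _; rewrite gA.
have E3 : (\int[mu]_r \int[P]_w g (r, w) = \int[mu]_(r in A) (\int[P]_w f (r, w))%R%:E)%E.
  rewrite [RHS]integral_mkcond; apply: eq_integral => r _.
  have [Ar|nAr] := EM (A r); first by rewrite patchT ?inE// E2.
  rewrite patchN ?notin_setE//; apply: integral0_eq => w _; exact: gNA.
have ig : (mu \x P)%E.-integrable setT g.
  apply/integrable12ltyP => //.
  apply: (@le_lt_trans _ _ (\int[mu]_(r in A) (M%:E))%E).
    rewrite [leRHS]integral_mkcond; apply: ge0_le_integral => //.
    - by move=> r _; apply: integral_ge0 => w _; exact: abse_ge0.
    - apply: (measurable_fun_fubini_tonelli_F (abse \o g)) => [|x]; last exact: abse_ge0.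
      exact: measurableT_comp mg.
    - apply/(measurable_restrict _ _ _).1 => //; exact: measurable_cst.
    move=> r _; have [Ar|nAr] := EM (A r).
      rewrite patchT ?inE//; apply: (@le_trans _ _ (\int[P]_w M%:E)%E).
        apply: ge0_le_integral => //.
        + apply/measurableT_comp => //; apply/measurable_EFinP.
          apply: eq_measurable_fun (measurable_section_r mA Ar mf) => w _.
          by rewrite patchT// inE.
        + by move=> w _; rewrite gA// lee_fin.
      by rewrite integral_cst// -[leRHS]mule1; apply: lee_wpmul2l => //; exact: probability_le1.
    rewrite patchN ?notin_setE// (_ : (\int[P]_y _)%E = 0%E)//.
    by apply: integral0_eq => w _; rewrite gNA// abse0.
  by rewrite integral_cst// lte_mul_pinfty.
have mF := measurable_fubini_F ig; have mG := measurable_fubini_G ig.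
split.
- apply/measurable_EFinP; apply: eq_measurable_fun mG => w _; exact: E1.
- apply/measurable_EFinP; apply: eq_measurable_fun (measurable_funTS mF) => r.
  by rewrite inE => Ar; exact: E2.
rewrite [RHS]/Rintegral -E3 (Fubini ig) /Rintegral; congr fine.
by apply: eq_integral => w _; rewrite E1.
Qed.

Lemma Rintegral_itv_near_le (s t r h eta : R) (k : R -> R) :
  0 <= h -> 0 <= eta -> s <= t -> measurable_fun `[s, t] k ->
  (forall u, s <= u <= t -> `|k u| <= 1) ->
  (forall u, s <= u <= t -> h <= `|u - r| -> `|k u| <= eta) ->
  \int[mu]_(u in `[s, t]) k u <= 2 * h + (t - s) * eta.
Proof.
move=> h0 eta0 st mk k1 keta.
have fin : (mu `[s, t] < +oo)%E.
  by rewrite /= lebesgue_measure_itv/=; case: ifPn => //; rewrite -EFinD ltry.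
have ik : mu.-integrable `[s, t] (EFin \o k).
  by apply: (@integrable_bounded _ _ _ _ _ 1) => // u; rewrite /= in_itv/=; exact: k1.
pose I := `](r - h), (r + h)[%classic : set R.
have mI : measurable I by exact: measurable_itv.
have i1 : mu.-integrable `[s, t] (EFin \o (\1_I : R -> R)).
  apply: (@integrable_bounded _ _ _ _ _ 1) => //.
  by move=> u _; rewrite indicE; case: (_ \in _); rewrite ?normr1 ?normr0.
have ie : mu.-integrable `[s, t] (EFin \o (fun=> eta)).
  by apply: (@integrable_bounded _ _ _ _ _ `|eta|).
apply: (@le_trans _ _ (\int[mu]_(u in `[s, t]) (\1_I u + eta))).
  apply: le_Rintegral => //; first exact: integrable_EFinD.
  move=> u; rewrite /= in_itv/= => ust; rewrite (le_trans (ler_norm _))//.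
  rewrite indicE; have [hu|hu] := leP h `|u - r|.
    by rewrite (le_trans (keta u ust hu))// lerDr.
  rewrite mem_set; first by rewrite (le_trans (k1 u ust))// lerDl.
  by rewrite /I /= in_itv/=; move: hu; rewrite ltr_norml; lra.
rewrite RintegralD//= Rintegral_cst//= lerD//; last first.
  rewrite lebesgue_measure_itv/= lte_fin mulrC.
  by case: ltP => //= ts; rewrite mul0r mulr_ge0// subr_ge0.
rewrite /Rintegral integral_indic//.
rewrite (_ : 2 * h = fine (2 * h)%:E)//; apply: fine_le => //.
  rewrite ge0_fin_numE// (le_lt_trans _ fin)// le_measure ?inE//.
  exact: measurableI.
apply: (@le_trans _ _ (mu I)).
  by rewrite le_measure ?inE//; exact: measurableI.
rewrite /I lebesgue_measure_itv/= lte_fin; case: ltP => _; last by rewrite lee_fin mulr_ge0.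
by rewrite -EFinD lee_fin; lra.
Qed.

(** E |Phi|^2 is the double integral of E cos (xi . (X_r - X_u)), which is at most [eta] off the
    strip |r - u| < h and at most 1 on it. *)
Lemma osc_second_moment_le (d : nat) (T : R) (X : R -> Omega -> 'rV[R]_d) (xi : 'rV[R]_d)
    (s t h eta : R) : measurable_process T X ->
  0 <= s -> s <= t -> t <= T -> 0 < h -> 0 <= eta ->
  (forall u r, s <= u -> u <= r - h -> r <= t ->
    `|\int[P]_w cos (dot xi (X r w) - dot xi (X u w))| <= eta) ->
  [/\ bounded_rv (fun w => cos_int (X ^~ w) xi s t),
      bounded_rv (fun w => sin_int (X ^~ w) xi s t) &
      \int[P]_w (cos_int (X ^~ w) xi s t ^+ 2 + sin_int (X ^~ w) xi s t ^+ 2) <=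
      (t - s) * (2 * h + (t - s) * eta)].
Proof.
move=> mX s0 st tT h0 eta0 Heta; pose A : set R := `[s, t]%classic.
have mA : measurable A by exact: measurable_itv.
have Afin : (mu A < +oo)%E.
  by rewrite /= lebesgue_measure_itv/=; case: ifPn => //; rewrite -EFinD ltry.
have AE r : A r = (s <= r <= t) by rewrite /A /= in_itv.
have ts0 : 0 <= t - s by rewrite subr_ge0.
have mY : measurable_fun (A `*` [set: Omega]) (fun p : R * Omega => dot xi (X p.1 p.2)).
  apply: measurable_sum => i; apply: measurable_funM; first exact: measurable_cst.
  apply: measurable_funS (mX i).
    by apply: measurableX => //; exact: measurable_itv.
  move=> [r w] /= [+ _]; rewrite AE => /andP[sr rt]; split => //.
  by rewrite /= in_itv/= (le_trans s0) ?(le_trans rt).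
pose fc (p : R * Omega) := cos (dot xi (X p.1 p.2)).
pose fs (p : R * Omega) := sin (dot xi (X p.1 p.2)).
have mfc : measurable_fun (A `*` [set: Omega]) fc.
  exact: (measurableT_comp (continuous_measurable_fun (@continuous_cos R))).
have mfs : measurable_fun (A `*` [set: Omega]) fs.
  exact: (measurableT_comp (continuous_measurable_fun (@continuous_sin R))).
have c1 p : `|fc p| <= 1 by exact: cos_max.
have s1 p : `|fs p| <= 1 by exact: sin_max.
pose C w := \int[mu]_(r in A) fc (r, w); pose S w := \int[mu]_(r in A) fs (r, w).
have [mC _ _] := Rintegral_swap mA Afin mfc c1.
have [mS _ _] := Rintegral_swap mA Afin mfs s1.
have icst (c : R) : mu.-integrable A (EFin \o (fun=> c)).
  by apply: (@integrable_bounded _ _ _ _ _ `|c|).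
have Rcst (c : R) : \int[mu]_(r in A) c = c * (t - s).
  rewrite Rintegral_cst//= lebesgue_measure_itv/= lte_fin.
  by case: ltP => //= ts; rewrite (_ : t - s = 0)//; lra.
have ifw (f : R * Omega -> R) w : measurable_fun (A `*` [set: Omega]) f -> (forall p, `|f p| <= 1) ->
    mu.-integrable A (EFin \o (fun r => f (r, w))).
  by move=> mf f1; apply: (@integrable_bounded _ _ _ _ _ 1) => //; exact: measurable_section_l.
have bI (f : R * Omega -> R) w : measurable_fun (A `*` [set: Omega]) f -> (forall p, `|f p| <= 1) ->
    `|\int[mu]_(r in A) f (r, w)| <= t - s.
  move=> mf f1; rewrite (le_trans (le_normr_Rintegral _ (ifw f w mf f1)))//.
  rewrite -[leRHS]mul1r -Rcst le_Rintegral//; exact: (integrable_norm (ifw f w mf f1)).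
have bC : bounded_rv C by split => //; exists (t - s) => w; exact: bI.
have bS : bounded_rv S by split => //; exists (t - s) => w; exact: bI.
split; [exact: bC|exact: bS|].
(* The double integral is treated one time variable at a time: |Phi|^2 is the integral of G (r, w)
   over r, and E G (r, w) is in turn an integral over u. Each exchange is an instance of
   [Rintegral_swap]. *)
pose G (p : R * Omega) := C p.2 * fc p + S p.2 * fs p.
have mG : measurable_fun (A `*` [set: Omega]) G.
  by apply: measurable_funD; apply: measurable_funM => //; apply: measurable_funTS;
     apply: measurableT_comp.
have GL p : `|G p| <= 2 * (t - s).
  rewrite (le_trans (ler_normD _ _))// mulrDl mul1r !normrM.
  by rewrite lerD// -[leRHS]mulr1 ler_pM// bI.
have CSG w : C w ^+ 2 + S w ^+ 2 = \int[mu]_(r in A) G (r, w).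
  rewrite /G RintegralD//=; try by apply: integrable_EFinZ => //; exact: ifw.
  by rewrite !RintegralZl//; exact: ifw.
have [_ mEG EG] := Rintegral_swap mA Afin mG GL.
have -> : \int[P]_w (cos_int (X ^~ w) xi s t ^+ 2 + sin_int (X ^~ w) xi s t ^+ 2) =
    \int[mu]_(r in A) (\int[P]_w G (r, w)).
  by rewrite -EG; under eq_Rintegral do rewrite CSG.
rewrite mulrC -Rcst.
have EGle r : A r -> \int[P]_w G (r, w) <= 2 * h + (t - s) * eta.
  move=> Ar.
  pose k (p : R * Omega) := cos (dot xi (X r p.2) - dot xi (X p.1 p.2)).
  have mYr : measurable_fun setT (fun w => dot xi (X r w)).
    exact: (measurable_section_r mA Ar mY).
  have mk : measurable_fun (A `*` [set: Omega]) k.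
    apply: (measurableT_comp (continuous_measurable_fun (@continuous_cos R))).
    apply: measurable_funB => //; apply: measurable_funTS.
    exact: measurableT_comp mYr _.
  have k1 p : `|k p| <= 1 by exact: cos_max.
  have [_ mEk Ek] := Rintegral_swap mA Afin mk k1.
  have -> : \int[P]_w G (r, w) = \int[mu]_(u in A) (\int[P]_w k (u, w)).
    rewrite -Ek; apply: eq_Rintegral => w _; rewrite /k /=.
    under [RHS]eq_Rintegral do rewrite cosB.
    rewrite RintegralD//=; last 2 first.
    - by apply: integrable_EFinZ => //; exact: (ifw fc).
    - by apply: integrable_EFinZ => //; exact: (ifw fs).
    rewrite !RintegralZl//; last 2 first.
    - exact: (ifw fs).
    - exact: (ifw fc).
    by rewrite /G /= mulrC [S w * _]mulrC.
  have Ek1 u : A u -> `|\int[P]_w k (u, w)| <= 1.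
    move=> Au; have ik : P.-integrable setT (EFin \o (fun w => k (u, w))).
      by apply: bounded_rv_integrable; split; [exact: (measurable_section_r mA Au mk)|exists 1].
    rewrite (le_trans (le_normr_Rintegral _ ik))// -[leRHS](Rintegral_prob_cst P 1).
    apply: le_Rintegral => //; first exact: (integrable_norm ik).
    by apply: bounded_rv_integrable; exact: bounded_rv_cst.
  apply: (@Rintegral_itv_near_le s t r) => //; first exact: ltW.
  move=> u /andP[su ut]; move: Ar; rewrite AE => /andP[sr rt].
  rewrite /k /=; have [ur|ru] := leP u r.
    rewrite ler0_norm ?subr_le0// opprB => hur; apply: Heta => //; lra.
  rewrite gtr0_norm ?subr_gt0// => hur.
  (* The cosine is even, so for u > r the two times exchange roles. *)
  under eq_Rintegral do rewrite -cosN opprB.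
  apply: Heta => //; lra.
apply: le_Rintegral => //.
apply: (@integrable_bounded _ _ _ _ _ (2 * (t - s))) => // r Ar.
have iG : P.-integrable setT (EFin \o (fun w => G (r, w))).
  by apply: bounded_rv_integrable; split; [exact: (measurable_section_r mA Ar mG)|exists (2 * (t - s))].
rewrite (le_trans (le_normr_Rintegral _ iG))// -[leRHS](Rintegral_prob_cst P (2 * (t - s))).
apply: le_Rintegral => //; first exact: (integrable_norm iG).
by apply: bounded_rv_integrable; exact: bounded_rv_cst.
Qed.

Lemma measurable_process_path (d : nat) (T : R) (X : R -> Omega -> 'rV[R]_d) (w : Omega) :
  measurable_process T X -> measurable_path T (X ^~ w).
Proof.
by move=> mX i; exact: (measurable_section_l (f := fun p => X p.1 p.2 0 i) _ _ (mX i)).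
Qed.

Lemma L2_path_integrable (d : nat) (T : R) (w : R -> 'rV[R]_d) (i : 'I_d) :
  measurable_path T w ->
  (\int[mu]_(t in `[0%R, T]) (enorm (w t) ^+ 2)%R%:E < +oo)%E ->
  mu.-integrable `[0, T] (EFin \o (fun r => w r 0 i)).
Proof.
move=> mw L2.
have me : measurable_fun `[0, T] (fun r => enorm (w r) ^+ 2).
  apply: (eq_measurable_fun (fun r => dot (w r) (w r))).
    by move=> r _; rewrite enorm_sqr.
  by apply: measurable_sum => j; apply: measurable_funM; exact: mw.
have ie : mu.-integrable `[0, T] (EFin \o (fun r => enorm (w r) ^+ 2)).
  apply/integrableP; split; first exact/measurable_EFinP.
  rewrite (_ : (\int[mu]_(x in _) _)%E = (\int[mu]_(t in `[0%R, T]) (enorm (w t) ^+ 2)%R%:E)%E)//.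
  by apply: eq_integral => r _ /=; rewrite ger0_norm// sqr_ge0.
have i1 : mu.-integrable `[0, T] (EFin \o (fun=> 1 : R)).
  apply: (@integrable_bounded _ _ _ _ _ 1) => //; last by move=> *; rewrite normr1.
  by rewrite /= lebesgue_measure_itv/=; case: ifPn => //; rewrite -EFinD ltry.
have iD : mu.-integrable `[0, T] (EFin \o (fun r => 1 + enorm (w r) ^+ 2)).
  exact: integrable_EFinD.
apply: le_integrable iD => //.
  by apply/measurable_EFinP; exact: mw.
move=> r _ /=; rewrite lee_fin [leRHS]ger0_norm ?addr_ge0 ?sqr_ge0//.
apply: le_trans (norm_coord_le_enorm _ _) _.
have := sqrtr_ge0 (dot (w r) (w r)); rewrite -/(enorm _).
by have := sqr_ge0 (enorm (w r) - 1); rewrite !expr2; lra.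
Qed.

Lemma eSLND_cos_le (d : nat) (T : R) (F : R -> set (set Omega))
    (X : R -> Omega -> 'rV[R]_d) (beta : R) :
  adapted_gaussian_process P T F X -> eSLND P T F X beta ->
  exists c delta : R, [/\ 0 < c, 0 < delta &
    forall xi (u r h : R), 0 < h -> h < delta -> 0 <= u -> u <= r - h -> r <= T ->
      `|\int[P]_w cos (dot xi (X r w) - dot xi (X u w))| <=
      expR (- (c * `|ln h| `^ (- beta) * dot xi xi / 2))].
Proof.
move=> agX [delta [c [d0 c0 H]]]; exists c, delta; split => // xi u r h h0 hd u0 ur rT.
have rh0 : 0 <= r - h by exact: le_trans ur.
have rhr : r - h <= r by rewrite lerBlDr lerDl ltW.
have := @cond_var_cos_le _ _ _ P d T F X xi [:: (-1, u)] (r - h) r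
  (c * `|ln h| `^ (- beta)) 0 agX rh0 rhr rT.
rewrite /lincomb; under eq_Rintegral do rewrite !big_cons big_nil /= mul1r mulN1r !addr0.
apply.
  have := H (r - h) r; rewrite (_ : r - (r - h) = h); last by ring.
  apply.
  - by rewrite rh0 (le_trans rhr).
  - by rewrite rT (le_trans rh0).
  - by rewrite h0.
by move=> p; rewrite inE => /eqP -> /=; rewrite u0.
Qed.

(** With x = m + 1 and h = exp (-x) one has |ln h| = x, so beta <= 1 makes |ln h|^(-beta) |xi|^2 at
    least of order x, whence eta = exp (- kappa x). Markov's inequality leaves a probability of
    order eta / tau, to be compared with (tau / x)^(d + 2). *)
Lemma measurable_shell_tail (d : nat) (T : R) (F : R -> set (set Omega))
    (X : R -> Omega -> 'rV[R]_d) (beta : R) :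
  0 < T -> 0 < beta <= 1 -> adapted_gaussian_process P T F X ->
  measurable_process T X -> eSLND P T F X beta ->
  exists C delta q : R, exists m1, [/\ 0 <= C, 0 < delta, 0 < q,
    forall m, (m1 <= m)%N -> expR (- (q * m.+1%:R)) <= delta &
    forall m xi s t, (m1 <= m)%N -> m%:R ^+ 2 / 4 <= dot xi xi -> 0 <= s -> t <= T ->
      expR (- (q * m.+1%:R)) / 2 <= t - s -> t - s < 2 * delta ->
      exists B, [/\ measurable B,
        (P B <= (C * (expR (- (q * m.+1%:R)) / m.+1%:R) ^+ (d + 2))%:E)%E &
        forall w, setT w -> ~ B w ->
          osc (X ^~ w) xi s t <= 1 * Num.sqrt (expR (- (q * m.+1%:R))) * Num.sqrt (t - s)]].
Proof.
move=> T0 /andP[b0 b1] agX mX eX.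
have [c [delta [c0 d0 Hcos]]] := eSLND_cos_le agX eX.
(* kappa <= 1 makes h <= eta; c / 32 comes from |xi|^2 >= x^2 / 16 and the half in the exponent. *)
pose kappa := Num.min 1 (c / 32).
have k0 : 0 < kappa by rewrite lt_min ltr01 divr_gt0.
have k1 : kappa <= 1 by rewrite ge_min lexx.
have kc : kappa <= c / 32 by rewrite ge_min lexx orbT.
(* Then tau^(d + 3) = exp (- kappa x / 2) takes half of the exponent of [eta]; the other half
   absorbs x^(d + 2). *)
pose q := kappa / 2 / (d + 3)%:R.
have q0 : 0 < q by rewrite !divr_gt0// ltr0n addn_gt0 orbT.
have qk : q * (d + 3)%:R = kappa / 2.
  by rewrite /q divfK// pnatr_eq0 addn_eq0 andbF.
(* The second moment is at most L (2 + T) eta, and Markov's inequality divides it by tau L / 2. *)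
pose C := 2 * (2 + T).
have C0 : 0 <= C by rewrite /C; lra.
have expsmall (a e : R) : 0 < a -> 0 < e -> exists m1, forall m, (m1 <= m)%N -> expR (- (a * m.+1%:R)) <= e.
  move=> a0 e0; have eV0 : 0 <= e^-1 by rewrite invr_ge0 ltW.
  have [m1 H] := powR_expRN_eventually 0 eV0 ltr01 a0.
  by exists m1 => m /H; rewrite powRr0 powRr1// mulr1 mulrC ler_pdivrMr// mul1r.
have [m2 Hm2] := expsmall q delta q0 d0.
have d20 : 0 < delta / 2 by rewrite divr_gt0.
have [m3 Hm3] := expsmall 1 (delta / 2) ltr01 d20.
have k20 : 0 < kappa / 2 by rewrite divr_gt0.
have [m4 Hm4] := powR_expRN_eventually (d + 2)%:R ler01 ltr01 k20.
exists C, delta, q, (maxn (maxn 1 m2) (maxn m3 m4)); split => //.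
  by move=> m; rewrite !geq_max => /andP[/andP[_ /Hm2]].
move=> m xi s t; rewrite !geq_max => /andP[/andP[m1 _] /andP[m3m m4m]] mxi s0 tT.
have := Hm3 m m3m; have := Hm4 m m4m.
have x1 : (1 : R) <= m.+1%:R by rewrite ler1n.
have mx : m.+1%:R <= 2 * m%:R :> R by rewrite -natrM ler_nat mul2n -addnn -addn1 leq_add2l.
set x : R := m.+1%:R in x1 mx *.
have x0 : 0 < x by rewrite (lt_le_trans _ x1).
rewrite powRr1 ?(ltW x0)// powR_mulrn ?(ltW x0)// !mul1r => Hx hd taust _.
set tau := expR (- (q * x)) in taust *; set h := expR (- x) in hd *.
have tau0 : 0 < tau by exact: expR_gt0.
have h0 : 0 < h by exact: expR_gt0.
pose L := t - s; have L0 : 0 < L by rewrite (lt_le_trans _ taust)// divr_gt0.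
have LT : L <= T by rewrite /L; lra.
pose eta := expR (- (kappa * x)).
have eta0 : 0 <= eta by exact: expR_ge0.
have heta : h <= eta by rewrite /h /eta ler_expR lerN2 ler_piMl// ltW.
have Heta u r : s <= u -> u <= r - h -> r <= t ->
    `|\int[P]_w cos (dot xi (X r w) - dot xi (X u w))| <= eta.
  move=> su ur rt; have hdelta : h < delta by lra.
  have := Hcos xi u r h h0 hdelta (le_trans s0 su) ur (le_trans rt tT).
  move=> /le_trans; apply; rewrite ler_expR lerN2 /h expRK normrN gtr0_norm//.
  have xb : x^-1 <= x `^ (- beta).
    rewrite powRN lef_pV2 ?posrE ?powR_gt0// -[leRHS](powRr1 (ltW x0)).
    exact: ler_powR.
  have xx : x ^+ 2 / 16 <= dot xi xi.
    apply: le_trans mxi.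
    have : x ^+ 2 <= (2 * m%:R) ^+ 2 by apply: lerXn2r; rewrite ?nnegrE ?mulr_ge0 ?(ltW x0).
    rewrite exprMn; lra.
  apply: (@le_trans _ _ (c / 32 * x)); first by rewrite ler_wpM2r// ltW.
  rewrite (_ : c / 32 * x = c * x^-1 * (x ^+ 2 / 16) / 2); last by field; rewrite gt_eqF.
  rewrite ler_wpM2r// ler_pM ?mulr_ge0 ?sqr_ge0 ?invr_ge0 ?(ltW x0) ?(ltW c0)//.
  by rewrite ler_wpM2l ?(ltW c0).
have st : s <= t by rewrite -subr_ge0 ltW.
have [bC bS E] := osc_second_moment_le mX s0 st tT h0 eta0 Heta.
rewrite -/L in E taust *.
pose Z w := cos_int (X ^~ w) xi s t ^+ 2 + sin_int (X ^~ w) xi s t ^+ 2.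
have bZ : bounded_rv Z by apply: bounded_rvD; exact: bounded_rvX.
have a0 : 0 < tau * L / 2 by rewrite divr_gt0// mulr_gt0.
have mB : measurable [set w | tau * L / 2 < Z w].
  have [mZ _] := bZ.
  have := mZ measurableT `]tau * L / 2, +oo[%classic (measurable_itv _); rewrite setTI.
  rewrite (_ : _ @^-1` _ = [set w | tau * L / 2 < Z w])//.
  by apply/seteqP; split=> w /=; rewrite in_itv/= andbT.
exists [set w | tau * L / 2 < Z w]; split => //; last first.
  move=> w _ /= /negP; rewrite -leNgt /Z => Zw.
  rewrite -sqrtrM ?(ltW tau0)// -[leLHS]ger0_norm ?addr_ge0// -sqrtr_sqr.
  rewrite ler_sqrt ?mulr_ge0 ?(ltW tau0) ?(ltW L0)//.
  move: Zw; rewrite -[cos_int _ _ _ _ ^+ 2]real_normK ?num_real//.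
  rewrite -[sin_int _ _ _ _ ^+ 2]real_normK ?num_real// /osc.
  set u := `|_|; set v := `|_|; have := sqr_ge0 (u - v); rewrite !expr2; lra.
have Z0 w : 0 <= Z w by rewrite addr_ge0 ?sqr_ge0.
apply: le_trans (markov_bounded_rv P bZ Z0 a0) _; rewrite lee_fin.
rewrite ler_pdivrMr//.
have E2 : \int[P]_w Z w <= L * ((2 + T) * eta).
  apply: le_trans E _; rewrite ler_wpM2l ?(ltW L0)// [leRHS]mulrDl; apply: lerD.
    by rewrite ler_wpM2l.
  by rewrite ler_wpM2r.
apply: le_trans E2 _.
rewrite (_ : _ * (tau * L / 2) = L * ((2 + T) * (tau ^+ (d + 3) / x ^+ (d + 2)))); last first.
  have -> : (d + 3 = (d + 2).+1)%N by rewrite addnS.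
  rewrite [tau ^+ (d + 2).+1]exprSr /C expr_div_n.
  have := exprn_gt0 (d + 2) x0; set y := x ^+ (d + 2); set z := tau ^+ (d + 2) => y0.
  by field; rewrite gt_eqF.
rewrite ler_wpM2l ?(ltW L0)// ler_wpM2l ?addr_ge0 ?(ltW T0)//.
rewrite ler_pdivlMr ?exprn_gt0//.
have -> : tau ^+ (d + 3) = expR (- (kappa / 2 * x)).
  by rewrite /tau -expRM_natl; congr expR; rewrite -qk; ring.
have -> : eta = expR (- (kappa / 2 * x)) * expR (- (kappa / 2 * x)).
  by rewrite /eta -expRD; congr expR; field.
by rewrite -[leLHS]mulrA ler_piMr ?expR_ge0// [_ * x ^+ _]mulrC.
Qed.

Lemma measurable_process_exp_irregular (d : nat) (T : R) (F : R -> set (set Omega))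
    (X : R -> Omega -> 'rV[R]_d) (beta : R) :
  0 < T -> 0 < beta <= 1 -> adapted_gaussian_process P T F X ->
  measurable_process T X -> L2_trajectories P T X -> eSLND P T F X beta ->
  \forall w \ae P, exp_irregular T (fun t => X t w).
Proof.
move=> T0 b01 agX mX L2 eX.
have [C [delta [q [m1 [C0 d0 q0 Hd H]]]]] := measurable_shell_tail T0 b01 agX mX eX.
pose tau m : R := expR (- (q * m.+1%:R)).
have tau01 m : 0 < tau m <= 1.
  by rewrite /tau expR_gt0 expR_le1 oppr_le0 mulr_ge0// ltW.
have half1 : (2 : R)^-1 < 1 by lra.
pose gamma : R := 2^-1.
have g01 : 2^-1 <= gamma < 1 by rewrite /gamma lexx half1.
have p0 m : 0 <= C * (tau m / m.+1%:R) ^+ (d + 2).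
  by have /andP[t0 _] := tau01 m; rewrite mulr_ge0// exprn_ge0// divr_ge0// ltW.
have := @as_shell_bound _ _ _ P d T X setT gamma delta 1 C tau
  (fun m => C * (tau m / m.+1%:R) ^+ (d + 2)) m1 T0 g01 d0 ler01 C0 tau01 Hd p0 (fun=> lexx _) H.
have good : \forall w \ae P, [/\ setT w, measurable_path T (X ^~ w) &
     forall i, mu.-integrable `[0, T] (EFin \o (fun r => X r w 0 i))].
  apply: filterS L2 => w Lw; have mw := measurable_process_path w mX; split => // i.
  exact: L2_path_integrable.
move=> /(_ good); apply: filterS => w [K K0 HK].
(* With gamma = 1/2, tau^(1 - gamma) = exp (- q (m + 1) / 2), and |xi| < m + 1. *)
exists K, (q / 2), gamma; split => //.
- by rewrite divr_gt0.
- by rewrite /gamma invr_gt0 ltr0n.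
move=> xi s t xi0 sT tT.
pose m := Num.truncn (enorm xi).
have mxi : m%:R <= enorm xi by rewrite truncn_le sqrtr_ge0.
have xim : enorm xi < m.+1%:R by exact: truncnS_gt.
apply: le_trans (HK m xi s t mxi xim sT tT) _.
rewrite -mulrA ler_wpM2l ?(ltW K0)// ler_wpM2r ?powR_ge0//.
rewrite /tau /gamma /powR gt_eqF ?expR_gt0// expRK ler_expR.
have : enorm xi * (q / 2) <= m.+1%:R * (q / 2) by rewrite ler_wpM2r ?divr_ge0 ?(ltW q0)// ltW.
lra.
Qed.

End JointMeasurability.

Theorem theorem33 (R : realType) :
  (* (a); gamma depends only on rho and beta *)
  (forall beta rho : R, 0 < beta -> 0 < rho -> rho < (2 * beta)^-1 ->
   exists gamma : R, 2^-1 < gamma <= 1 /\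
   forall (T : R) (d : nat) (dO : measure_display) (Omega : measurableType dO)
     (P : probability Omega R) (F : R -> set (set Omega))
     (X : R -> Omega -> 'rV[R]_d),
     0 < T ->
     adapted_gaussian_process P T F X ->
     continuous_trajectories P T X ->
     SLND P T F X beta \/ LND P T X beta ->
     \forall w \ae P, irregular T gamma rho (fun t => X t w)) /\
  (* (b) *)
  (forall (T : R) (d : nat) (dO : measure_display) (Omega : measurableType dO)
     (P : probability Omega R) (F : R -> set (set Omega))
     (X : R -> Omega -> 'rV[R]_d) (beta : R),
     0 < T ->
     adapted_gaussian_process P T F X ->
     measurable_process T X ->
     L2_trajectories P T X ->
     0 < beta <= 1 ->
     eSLND P T F X beta ->
     \forall w \ae P, exp_irregular T (fun t => X t w)).
Proof.
split=> [beta rho b0 r0 rb|T d dO Omega P F X beta T0 agX mX L2 b01 eX]; last first.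
  exact: measurable_process_exp_irregular agX mX L2 eX.
have rb2 : rho * beta < 2^-1.
  by rewrite invfM mulrC in rb; rewrite -ltr_pdivlMr// mulrC.
(* the midpoint of [1 / 2] and [1 - rho * beta] *)
exists (3 / 4 - rho * beta / 2); split.
  have := mulr_gt0 r0 b0; lra.
move=> T d dO Omega P F X T0 agX cX LX.
have rb0 := mulr_gt0 r0 b0.
apply: (continuous_process_irregular T0 b0 r0 _ _ agX cX LX); lra.
Qed.
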